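(* Let $d\ge2$ be an integer and let $\alpha>0$ be real. Then, as $\theta\to0$ in $\mathbb{R}^d$, \[ F_d(\theta)\simeq \begin{cases} \dfrac{2}{\alpha}\,\Gamma(1-\alpha)\cos\Bigl(\dfrac{\pi\alpha}{2}\Bigr)A_d(\theta) & \text{for } \alpha<2,\\[2mm] \dfrac{2^{d-1}(d+2)}{3}\,|\theta|^2\log\dfrac{1}{|\theta|} & \text{for } \alpha=2,\\[2mm] \dfrac16\Bigl(\displaystyle\sum_{n=1}^\infty\frac{(2n+1)^d(n+1)-(2n-1)^d(n-1)}{n^{d+\alpha-1}}\Bigr)|\theta|^2 & \text{for } \alpha>2, \end{cases} \] where $|\theta|=\sqrt{\theta_1^2+\cdots+\theta_d^2}$ is the Euclidean norm.
   Context: $F_d(\theta):=\sum_{z\in\mathbb{Z}^d\setminus\{0\}}\frac{1}{\|z\|^{d+\alpha}}(1-\cos\langle z,\theta\rangle)$ for $\theta\in\mathbb{R}^d$, where $\langle\cdot,\cdot\rangle$ is the standard inner product and $\|x\|=\max_i|x_i|$ is the max-norm. $h_1(\theta)\simeq h_2(\theta)$ as $\theta\to\theta_0$ means $h_1(\theta)/h_2(\theta)\to1$ as $\theta\to\theta_0$. The function $A_d$ is \[ A_d(\theta):=\sum_{\{j_k\}\in\mathscr{J}_1}\frac{1}{\theta_{j_2}\cdots\theta_{j_d}}\int_{-\theta_{j_d}}^{\theta_{j_d}}\cdots\int_{-\theta_{j_2}}^{\theta_{j_2}}|\theta_{j_1}+\eta_2+\cdots+\eta_d|^\alpha\,d\eta_2\ldots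 d\eta_d, \] where $\mathscr{J}_1$ is the set of the $d$ sequences $\{j_1,\dots,j_d\}$ in which $j_1$ ranges over $1,\dots,d$ and $\{j_2,\dots,j_d\}$ is $\{1,\dots,d\}$ with $j_1$ removed, listed in increasing order. At points where some coordinate $\theta_j$ vanishes, $A_d$ is understood by continuous extension. Integrals are oriented. $\Gamma$ is the gamma function. For $\alpha=1$ the indeterminate quantity $\Gamma(1-\alpha)\cos(\pi\alpha/2)$ is understood as its limit $\pi/2$ (equivalently, it is read as $\frac{\pi}{2\Gamma(\alpha)\sin(\pi\alpha/2)}$). *)

(* Defs.v *)
From HB Require Import structures.
From mathcomp Require Import all_boot all_order all_algebra.
From mathcomp Require Import all_classical all_reals all_analysis.

Set Implicit Arguments.
Unset Strict Implicit.
Unset Printing Implicit Defensive.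

Import Order.TTheory GRing.Theory Num.Theory.
Import numFieldNormedType.Exports.

Local Open Scope classical_set_scope.
Local Open Scope ring_scope.

(* [^'] is the punctured neighbourhood: the value at [t0] is irrelevant. *)
Definition asymp_equiv {R : realType} {T : topologicalType}
    (h1 h2 : T -> R) (t0 : T) : Prop :=
  h1 t / h2 t @[t --> t0^'] --> (1 : R).

Section Functions.
Context {R : realType}.

Definition eucl_norm (d : nat) (theta : 'rV[R]_d) : R :=
  Num.sqrt (\sum_(i < d) theta 0 i ^+ 2).

Definition inner (d : nat) (x y : 'rV[R]_d) : R := \sum_(i < d) x 0 i * y 0 i.

(* The norm [`| _ |] of 'rV[R]_d is the max-norm.  All terms are nonnegative,
   so the sum over the lattice is the supremum of the finite partial sums. *)
Definition Fd (d : nat) (alpha : R) (theta : 'rV[R]_d) : R :=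
  fine (\esum_(z in [set z : 'rV[int]_d | z != 0])
    (let x : 'rV[R]_d := map_mx intr z in
     (1 / `|x| `^ (d%:R + alpha) * (1 - cos (inner x theta)))%:E)).

Definition oriented_integral (a b : R) (f : R -> R) : R :=
  if a <= b then \int[lebesgue_measure]_(x in `[a, b]) f x
  else - \int[lebesgue_measure]_(x in `[b, a]) f x.

(* For s = [:: s_2; ...; s_d] this is the iterated integral
   int_{-s_d}^{s_d} ... int_{-s_2}^{s_2} g [:: e_2; ...; e_d] de_2 ... de_d,
   the head of the list being the innermost variable. *)
Fixpoint iterated_integral (s : seq R) (g : seq R -> R) : R :=
  match s with
  | [::] => g [::]
  | a :: s' =>
      iterated_integral s'
        (fun v => oriented_integral (- a) a (fun e => g (e :: v)))
  end.

(* A sequence (j_1, ..., j_d) of the index set is determined by j_1, and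
   (j_2, ..., j_d) is then [other_coords theta j_1] read off [theta]:
   [enum 'I_d] lists the indices in increasing order. *)
Definition other_coords (d : nat) (theta : 'rV[R]_d) (j1 : 'I_d) : seq R :=
  [seq theta 0 j | j <- enum 'I_d & j != j1].

Definition A_formula (d : nat) (alpha : R) (theta : 'rV[R]_d) : R :=
  \sum_(j1 < d)
    1 / (\prod_(s <- other_coords theta j1) s) *
    iterated_integral (other_coords theta j1)
      (fun eta => `|theta 0 j1 + \sum_(e <- eta) e| `^ alpha).

Definition nonvanishing (d : nat) : set 'rV[R]_d :=
  [set t | forall j : 'I_d, t 0 j != 0].

(* The formula on the dense set where no coordinate vanishes, and its extension
   by continuity elsewhere. *)
Definition Ad (d : nat) (alpha : R) (theta : 'rV[R]_d) : R :=
  if [forall j : 'I_d, theta 0 j != 0] then A_formula alpha theta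
  else lim (A_formula alpha t @[t --> within (@nonvanishing d) (nbhs theta)]).

Definition Gamma_integral (x : R) : R :=
  \int[lebesgue_measure]_(t in `]0, +oo[) (t `^ (x - 1) * expR (- t)).

(* The gamma function: Euler's integral for x > 0, continued to non-integral
   x < 0 by Gamma x = Gamma (x + n) / (x (x + 1) ... (x + n - 1)), where n is
   the least natural number such that x + n > 0. *)
Definition Gamma (x : R) : R :=
  let n := if 0 < x then 0%N else (Num.truncn (- x)).+1 in
  Gamma_integral (x + n%:R) / \prod_(k < n) (x + k%:R).

(* Gamma (1 - alpha) cos (pi alpha / 2), read as its limit at alpha = 1. *)
Definition Gamma_cos (alpha : R) : R :=
  if alpha == 1 then pi / 2 else Gamma (1 - alpha) * cos (pi * alpha / 2).

End Functions.

(* Main.v *)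
Require Import Defs.
From mathcomp Require Import all_boot all_order all_algebra.
From mathcomp Require Import all_classical all_reals all_analysis.
From mathcomp Require Import measurable_realfun.
From mathcomp Require Import ring lra zify.
From mathcomp Require complex.
Import Order.TTheory GRing.Theory Num.Theory.
Import numFieldNormedType.Exports.
Local Open Scope classical_set_scope.
Local Open Scope ring_scope.
Set Implicit Arguments.
Unset Strict Implicit.
Unset Printing Implicit Defensive.

(** Group the lattice points by their max-norm.  The shell of radius [n] has
    about [n ^ (d - 1)] points and contributes [n ^ (- (d + alpha)) T_n] to [Fd],
    where [T_n] ([shell_sum]) is the sum of [1 - cos <z, theta>] over the shell;
    the theorem is about the size of [T_n] for [n] of order [1 / |theta|] when
    [alpha < 2], and for smaller [n] when [alpha >= 2].

    For [alpha < 2], the cosines sum over a cube to a product of one-variable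
    sums [D_n (theta_j)] ([big_box_cos]), and [D_n (x)] is a Riemann sum of
    [n * int_(-1)^1 cos (n x u) du].  The shell is the difference of two
    consecutive cubes, so the difference of two products telescopes into one
    term per coordinate: [T_n] is close to [n ^ (d - 1)] times the integral of
    [1 - cos (n <u, theta>)] over the faces of the cube [[-1, 1] ^ d]
    ([shell_integral_close]).  Summing over [n] inside the integral leaves
    [sum_n n ^ (- 1 - alpha) (1 - cos (n x))], which is asymptotic to
    [K |x| ^ alpha] as a Riemann sum of the integral [K] of
    [s ^ (- 1 - alpha) (1 - cos s)] over the half line ([cos_sum_asymp]).  The
    integral of [|<u, theta>| ^ alpha] over the faces is [2 A_d], by the
    substitution [eta_i = theta_i u_i], which also shows that [A_d] extends
    continuously ([iterated_integral_box_integral], [AdE]).  All errors are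
    small against [|theta| ^ alpha], and [A_d >= |theta| ^ alpha] ([A_ext_ge]).

    The value [K = Gamma (1 - alpha) cos (pi alpha / 2) / alpha] comes from
    turning the path of integration of [z ^ (- 1 - alpha) (1 - c z - e ^ (- z))],
    with [c = 0] or [c = 1] according to the size of [alpha], from the positive
    real axis, where integration by parts produces the gamma function, to the
    imaginary one ([deriv_rotated], [mellin_primitive_exists]).

    For [alpha >= 2], [1 - cos x] may be replaced by [x ^ 2 / 2], whose sum over
    the shell is an explicit multiple [shell_quad n] of the square of the
    Euclidean norm ([sum_shell_sqr]).  If [alpha > 2] the weighted series of
    these multiples converges, and interpolating the error of the replacement
    between its quadratic and quartic bounds makes it summable with a power of
    [|theta|] larger than [2] ([supercritical_error]).  If [alpha = 2] the
    weighted multiples are asymptotic to a constant over [n], the replacement is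
    good up to [n] of order [1 / |theta|], and the harmonic sum up to there is
    the logarithm ([critical_estimate]). *)

(** * Derivatives, estimates of the cosine and sums of powers *)

Section DerivativeRules.
Context {R : realType}.
Implicit Types (f g : R -> R) (x a b : R).

Lemma deriv_eq f x a b : is_derive x 1 f a -> a = b -> is_derive x 1 f b.
Proof. by move=> fa <-. Qed.

Lemma deriv_cst a x : is_derive x 1 (fun _ : R => a) 0.
Proof. exact: is_derive_cst. Qed.

Lemma deriv_id x : is_derive x 1 (fun y : R => y) 1.
Proof. exact: is_derive_id. Qed.

Lemma deriv_add f g x a b : is_derive x 1 f a -> is_derive x 1 g b ->
  is_derive x 1 (fun y => f y + g y) (a + b).
Proof. by move=> fa gb; exact: is_deriveD. Qed.

Lemma deriv_opp f x a : is_derive x 1 f a -> is_derive x 1 (fun y => - f y) (- a).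
Proof. by move=> fa; exact: is_deriveN. Qed.

Lemma deriv_mul f g x a b : is_derive x 1 f a -> is_derive x 1 g b ->
  is_derive x 1 (fun y => f y * g y) (f x * b + g x * a).
Proof. by move=> fa gb; exact: is_deriveM. Qed.

Lemma deriv_chain f g x a b : is_derive (g x) 1 f a -> is_derive x 1 g b ->
  is_derive x 1 (fun y => f (g y)) (a * b).
Proof. by move=> fa gb; exact: is_derive1_comp. Qed.

Lemma deriv_cos g x b : is_derive x 1 g b ->
  is_derive x 1 (fun y => cos (g y)) (- sin (g x) * b).
Proof. by move=> gb; apply: deriv_chain. Qed.

Lemma deriv_sin g x b : is_derive x 1 g b ->
  is_derive x 1 (fun y => sin (g y)) (cos (g x) * b).
Proof. by move=> gb; apply: deriv_chain. Qed.

Lemma deriv_exp g x b : is_derive x 1 g b ->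
  is_derive x 1 (fun y => expR (g y)) (expR (g x) * b).
Proof. by move=> gb; apply: deriv_chain. Qed.

Lemma deriv_powR p x : 0 < x ->
  is_derive x 1 (fun y : R => y `^ p) (p * x `^ (p - 1)).
Proof. exact: is_derive1_powR. Qed.

Lemma deriv_pow p g x b : 0 < g x -> is_derive x 1 g b ->
  is_derive x 1 (fun y => g y `^ p) (p * g x `^ (p - 1) * b).
Proof.
move=> gx gb; apply: (@deriv_chain (fun y => y `^ p) g) => //.
exact: is_derive1_powR.
Qed.

Lemma deriv_near f g x a : (\forall y \near x, f y = g y) ->
  is_derive x 1 f a -> is_derive x 1 g a.
Proof. by move=> fg fa; apply: near_eq_is_derive fg fa; rewrite oner_neq0. Qed.

Lemma deriv_continuous f x a : is_derive x 1 f a -> {for x, continuous f}.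
Proof.
by move=> fa; apply/differentiable_continuous/derivable1_diffP; exact: ex_derive.
Qed.

Lemma mean_value f df a b : a <= b ->
  (forall x, a <= x <= b -> is_derive x 1 f (df x)) ->
  exists2 c, a <= c <= b & f b - f a = df c * (b - a).
Proof.
move=> ab fd; have [||c] := @MVT_segment R f df a b ab.
- by move=> x /[!in_itv]/= /andP[ax xb]; apply: fd; rewrite !ltW.
- apply: derivable_within_continuous => x /[!in_itv]/= axb.
  by have axb' := fd _ axb; exact: ex_derive.
- by rewrite in_itv/=; exists c.
Qed.

Lemma deriv_bound f df a b M : (forall x, is_derive x 1 f (df x)) ->
  (forall x, Num.min a b <= x <= Num.max a b -> `|df x| <= M) ->
  `|f b - f a| <= M * `|b - a|.
Proof.
wlog ab : a b / a <= b => [wl fd dM|].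
  have [ab|/ltW ba] := leP a b; first exact: wl.
  by rewrite distrC (distrC b); apply: wl => //; rewrite minC maxC.
rewrite min_l// max_r// => fd dM.
have [c cab ->] := mean_value ab (fun x _ => fd x).
by rewrite normrM ler_wpM2r// dM.
Qed.

End DerivativeRules.

Ltac derive_step := lazymatch goal with
  | |- is_derive _ _ (fun _ => ?c) _ => notypeclasses refine (deriv_cst _ _)
  | |- is_derive _ _ (fun y => y) _ => notypeclasses refine (deriv_id _)
  | |- is_derive _ _ (fun y => @?f y + @?g y) _ =>
      notypeclasses refine (deriv_add _ _)
  | |- is_derive _ _ (fun y => - @?f y) _ => notypeclasses refine (deriv_opp _)
  | |- is_derive _ _ (fun y => @?f y * @?g y) _ =>
      notypeclasses refine (deriv_mul _ _)
  | |- is_derive _ _ (fun y => cos (@?g y)) _ => notypeclasses refine (deriv_cos _)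
  | |- is_derive _ _ (fun y => sin (@?g y)) _ => notypeclasses refine (deriv_sin _)
  | |- is_derive _ _ (fun y => expR (@?g y)) _ => notypeclasses refine (deriv_exp _)
  | |- is_derive _ _ (fun y => (@?g y) `^ _) _ =>
      notypeclasses refine (deriv_pow _ _ _); [assumption|]
  end.

(** Matching subterms contracts [fun y => cos y] to [cos] and [fun y => a + y] to
    [+%R a], so such functions are expanded again. *)
Ltac derive_tac := repeat first
  [ derive_step
  | lazymatch goal with |- is_derive ?x ?v ?f ?d =>
      change (is_derive x v (fun y => f y) d) end; derive_step ].

(** Differentiates the function of the goal by the rules above and leaves the
    comparison of the resulting derivative with the announced one. *)
Ltac derive_eq := notypeclasses refine (deriv_eq _ _); [derive_tac|rewrite /=].

Section Trig.
Context {R : realType}.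
Implicit Types (x y : R).

Lemma cos_lip x y : `|cos x - cos y| <= `|x - y|.
Proof.
rewrite -[leRHS]mul1r; apply: (@deriv_bound R cos (fun x => - sin x)) => // z _.
by rewrite normrN sin_max.
Qed.

Lemma sin_lip x y : `|sin x - sin y| <= `|x - y|.
Proof.
rewrite -[leRHS]mul1r; apply: (@deriv_bound R sin cos) => // z _.
exact: cos_max.
Qed.

Lemma one_sub_cos_ge0 x : 0 <= 1 - cos x.
Proof. by rewrite subr_ge0 cos_le1. Qed.

Lemma one_sub_cos_le2 x : 1 - cos x <= 2.
Proof. have := cos_geN1 x; lra. Qed.

Lemma sqr_le_norm x y : `|x| <= `|y| -> x ^+ 2 <= y ^+ 2.
Proof.
move=> xy; rewrite -(real_normK (num_real x)) -(real_normK (num_real y)).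
by rewrite lerXn2r ?nnegrE.
Qed.

Lemma norm_le_between x y : Num.min 0 y <= x <= Num.max 0 y -> `|x| <= `|y|.
Proof.
case: (leP 0 y) => [y0 /andP[x0 xy]|y0 /andP[x0 xy]].
  by rewrite !ger0_norm.
by rewrite !ler0_norm ?lerN2// ltW.
Qed.

Lemma one_sub_cosE x : 1 - cos x = 2 * sin (x / 2) ^+ 2.
Proof.
have -> : cos x = cos ((x / 2) *+ 2) by rewrite -[in RHS]mulr_natr divfK.
by rewrite cos_mulr2n sin2cos2 -[in LHS]mulr_natr; ring.
Qed.

Lemma one_sub_cos_le x : 1 - cos x <= x ^+ 2 / 2.
Proof.
rewrite one_sub_cosE.
have : sin (x / 2) ^+ 2 <= (x / 2) ^+ 2.
  by apply: sqr_le_norm; have := sin_lip (x / 2) 0; rewrite sin0 !subr0.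
have -> : (x / 2) ^+ 2 = x ^+ 2 / 4 by field.
lra.
Qed.

(** The second derivative of [1 - cos x - x ^ 2 / 2] is [cos x - 1], so the
    quadratic bound integrates twice to the quartic one. *)
Lemma one_sub_cos_quartic x : `|1 - cos x - x ^+ 2 / 2| <= x ^+ 4.
Proof.
pose f (y : R) := 1 - cos y - y ^+ 2 / 2.
pose df (y : R) := sin y - y.
have fd y : is_derive y 1 f (df y).
  rewrite /f; under eq_fun do rewrite expr2.
  by derive_eq; rewrite /df; field.
have dfd (y : R) : is_derive y 1 df (cos y - 1).
  by rewrite /df; derive_eq; ring.
have df_le y : `|df y| <= y ^+ 2 / 2 * `|y|.
  have -> : df y = df y - df 0 by rewrite /df sin0; ring.
  rewrite -[in `|y|](subr0 y); apply: (deriv_bound dfd) => z zy.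
  rewrite distrC ger0_norm ?one_sub_cos_ge0//.
  apply: le_trans (one_sub_cos_le z) _; rewrite ler_pM2r//.
  by apply: sqr_le_norm; exact: norm_le_between.
have -> : 1 - cos x - x ^+ 2 / 2 = f x - f 0.
  by rewrite /f cos0 expr0n/=; ring.
apply: (le_trans (y := (x ^+ 2 / 2 * `|x|) * `|x - 0|)).
  apply: (deriv_bound fd) => z /norm_le_between zx; apply: le_trans (df_le z) _.
  by apply: ler_pM => //; rewrite ?divr_ge0 ?sqr_ge0// ler_pM2r// sqr_le_norm.
rewrite subr0 -mulrA -expr2 real_normK ?num_real//.
by rewrite (_ : x ^+ 4 = x ^+ 2 * x ^+ 2); [have := sqr_ge0 x; nra|ring].
Qed.

End Trig.

Section PowerSeries.
Context {R : realType}.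
Implicit Types (x s t a : R).

(** The mean value theorem for [x ^ -s] turns the sum into a telescoping one. *)
Lemma power_step s (n : nat) : 0 < s ->
  n.+2%:R `^ (- 1 - s) <= s^-1 * (n.+1%:R `^ (- s) - n.+2%:R `^ (- s)) :> R.
Proof.
move=> s0; have ab : n.+1%:R <= n.+2%:R :> R by rewrite ler_nat.
have [|c /andP[c1 c2] E] := @mean_value R (fun x => x `^ (- s))
    (fun x => - s * x `^ (- s - 1)) n.+1%:R n.+2%:R ab.
  by move=> x /andP[x1 _]; apply: deriv_powR; apply: lt_le_trans x1; rewrite ltr0Sn.
have c0 : 0 < c by apply: lt_le_trans c1; rewrite ltr0Sn.
rewrite -[X in _ <= _ * X]opprB E mulNr mulNr opprK -natrB// subSnn mulr1 mulrA mulVf ?gt_eqF// mul1r.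
have -> : - s - 1 = - (1 + s) by ring.
have -> : - 1 - s = - (1 + s) by ring.
by rewrite !powRN lef_pV2 ?posrE ?powR_gt0// ge0_ler_powR ?nnegrE// ?addr_ge0// ltW.
Qed.

Lemma power_sum_le s (N : nat) : 0 < s ->
  \sum_(1 <= n < N) n%:R `^ (- 1 - s) <= 1 + s^-1 :> R.
Proof.
move=> s0; suff H M : \sum_(1 <= n < M.+2) n%:R `^ (- 1 - s)
    <= 1 + s^-1 - s^-1 * M.+1%:R `^ (- s) :> R.
  have c0 : 0 <= 1 + s^-1 :> R by rewrite addr_ge0// invr_ge0 ltW.
  case: N => [|[|M]]; [by rewrite big_geq|by rewrite big_geq|].
  apply: le_trans (H M) _; rewrite lerBlDr lerDl mulr_ge0 ?powR_ge0//.
  by rewrite invr_ge0 ltW.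
elim: M => [|M ih]; first by rewrite big_nat1 !powR1; lra.
by rewrite big_nat_recr//=; have := power_step M s0; lra.
Qed.

(** Interpolation between two bounds of a summand: the exponents of [n] and [t]
    on the right leave a convergent series in [n] and a power of [t] strictly
    larger than [a]. *)
Lemma interpolate a t s (n : nat) : 0 < a -> 0 < s -> s <= a ->
    s <= (2 - a) / 5 -> 0 < t -> t <= 1 -> (0 < n)%N ->
  n%:R `^ (- 1 - a) * Num.min ((n%:R * t) ^+ 2) (t + n%:R^-1)
  <= 2 * t `^ (a + s) * n%:R `^ (- 1 - s).
Proof.
move=> a0 s0 sa s5 t0 t1 n0.
have nR0 : 0 < n%:R :> R by rewrite ltr0n.
have nn0 : n%:R != 0 :> R by rewrite gt_eqF.
have tn0 : t != 0 by rewrite gt_eqF.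
have -> : n%:R `^ (- 1 - s) = n%:R `^ (- 1 - a) * n%:R `^ (a - s).
  by rewrite -powRD ?nn0 ?implybT//; congr (_ `^ _); ring.
rewrite [leRHS]mulrCA ler_wpM2l ?powR_ge0//.
set m := n%:R in nR0 nn0 *.
have [mt|mt] := leP 1 (m * t).
  have mV : m^-1 <= t by rewrite -div1r ler_pdivrMr// mulrC.
  apply: (@le_trans _ _ (2 * t)); first by rewrite ge_min; apply/orP; right; lra.
  rewrite -mulrA ler_pM2l//.
  have -> : t `^ (a + s) * m `^ (a - s) = (m * t) `^ (a - s) * t `^ (2 * s).
    rewrite powRM ?ltW// mulrC -mulrA -powRD ?tn0 ?implybT//; congr (_ * _ `^ _).
    by ring.
  have A : 1 <= (m * t) `^ (a - s).
    by rewrite -(powRr0 (m * t)) ler_powR// subr_ge0.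
  have B : t <= t `^ (2 * s) by apply: ger1_powR; [rewrite t0|lra].
  by apply: le_trans B _; rewrite ler_peMl ?powR_ge0.
have tV : t <= m^-1 by rewrite -div1r ler_pdivlMr// mulrC ltW.
apply: (@le_trans _ _ (2 * Num.min ((m * t) ^+ 2) m^-1)).
  have : 0 <= (m * t) ^+ 2 by exact: sqr_ge0.
  rewrite ge_min; case: (leP ((m * t) ^+ 2) m^-1) => h h0; apply/orP; [left|right]; lra.
rewrite -mulrA ler_pM2l//.
(* The exponent of [t] is then [2 l = a + s], and that of [n] is at most
   [a - s] because [5 s <= 2 - a]. *)
pose l := (a + s) / 2.
have l01 : 0 <= l <= 1 by rewrite /l; apply/andP; split; lra.
set mn := Num.min _ _.
have mn0 : 0 < mn by rewrite lt_min exprn_gt0 ?mulr_gt0// invr_gt0.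
have -> : mn = mn `^ l * mn `^ (1 - l).
  by rewrite -powRD ?(gt_eqF mn0) ?implybT// addrC subrK powRr1// ltW.
apply: (@le_trans _ _ (((m * t) ^+ 2) `^ l * m^-1 `^ (1 - l))).
  apply: ler_pM; rewrite ?powR_ge0//; apply: ge0_ler_powR;
    rewrite ?nnegrE ?(ltW mn0) ?sqr_ge0 ?invr_ge0 ?(ltW nR0)//; try lra.
  - by rewrite ge_min lexx.
  - by rewrite ge_min lexx orbT.
have [m0 t0'] := (ltW nR0, ltW t0).
rewrite -powR_mulrn ?mulr_ge0// -powRrM powRM//.
rewrite -powR_inv1// -powRrM.
have -> : 2%:R * l = a + s by rewrite /l; field.
rewrite mulrAC mulrC ler_wpM2l ?powR_ge0//.
rewrite -powRD ?nn0 ?implybT//.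
by rewrite ler_powR ?ler1n// /l; lra.
Qed.

(** A perturbation of every summand that is quadratic in [n t] for small [n], and
    of relative size [t + 1 / n] for large [n], does not affect asymptotics of
    order [t ^ a]. *)
Lemma sum_small a (C eta : R) : 0 < a -> a < 2 -> 0 <= C -> 0 < eta ->
  exists2 rho : R, 0 < rho & forall t (b : nat -> R) (N : nat), 0 < t -> t < rho ->
    (forall n, (0 < n)%N ->
       b n <= C * (n%:R `^ (- 1 - a) * Num.min ((n%:R * t) ^+ 2) (t + n%:R^-1))) ->
    \sum_(1 <= n < N) b n <= eta * t `^ a.
Proof.
move=> a0 a2 C0 eta0.
pose s := Num.min a ((2 - a) / 5).
have s0 : 0 < s by rewrite lt_min a0 divr_gt0// subr_gt0.
pose K := C * 2 * (1 + s^-1) + 1.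
have K0 : 0 < K.
  by rewrite ltr_wpDl// !mulr_ge0// addr_ge0// invr_ge0 ltW.
exists (Num.min 1 ((eta / K) `^ s^-1)).
  by rewrite lt_min ltr01 powR_gt0// divr_gt0.
move=> t b N t0; rewrite lt_min => /andP[t1 trho] hb.
apply: (@le_trans _ _ (\sum_(1 <= n < N) (C * (2 * t `^ (a + s)) * n%:R `^ (- 1 - s)))).
  rewrite [leLHS]big_nat_cond [leRHS]big_nat_cond; apply: ler_sum => n.
  rewrite andbT => /andP[n0 _]; apply: le_trans (hb _ n0) _.
  rewrite -[leRHS]mulrA ler_wpM2l//; apply: interpolate => //; last exact: ltW.
    by rewrite ge_min lexx.
  by rewrite ge_min lexx orbT.
rewrite -mulr_sumr.
apply: (@le_trans _ _ (K * t `^ (a + s))).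
  have := power_sum_le N s0; set S := \sum_(_ <= _ < _) _ => HS.
  have T0 : 0 <= t `^ (a + s) by exact: powR_ge0.
  rewrite [leLHS](_ : _ = C * 2 * S * t `^ (a + s)); last by ring.
  rewrite ler_wpM2r// /K.
  by apply: (@le_trans _ _ (C * 2 * (1 + s^-1))); [rewrite ler_wpM2l// mulr_ge0|lra].
rewrite powRD ?(gt_eqF t0) ?implybT// mulrCA mulrC ler_wpM2r ?powR_ge0//.
rewrite mulrC -ler_pdivlMr//.
have -> : eta / K = ((eta / K) `^ s^-1) `^ s.
  by rewrite -powRrM mulVf ?gt_eqF// powRr1// divr_ge0// ltW.
by apply: ge0_ler_powR; rewrite ?nnegrE ?powR_ge0 ?ltW.
Qed.

End PowerSeries.

(** * Cubes and cubic shells of the lattice *)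

Section Lattice.
Variable d : nat.
Implicit Types (z : 'rV[int]_d) (n : nat).

Definition sup_norm z : nat := (\max_(j < d) `|z 0%R j|)%N.

Lemma sup_normP z n :
  reflect (forall j, (`|z 0%R j| <= n)%N) (sup_norm z <= n)%N.
Proof. by apply: (iffP (bigmax_leqP _ _ _)) => h j => [|_]; exact: h. Qed.

Definition box n : seq 'rV[int]_d :=
  [seq \row_j ((f j)%:Z - n%:Z) | f : {ffun 'I_d -> 'I_(n.*2.+1)} <- enum {: {ffun 'I_d -> 'I_(n.*2.+1)}}].

Lemma mem_box n z : (z \in box n) = (sup_norm z <= n)%N.
Proof.
apply/mapP/sup_normP => [[f _ ->] j|zn].
  by rewrite mxE; have := ltn_ord (f j); move: (nat_of_ord _) => m; lia.
have zj j : (`|(z 0 j + n%:Z)%R| < n.*2.+1)%N by have := zn j; lia.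
exists [ffun j => Ordinal (zj j)]; first by rewrite mem_enum.
by apply/rowP => j; rewrite !mxE ffunE/=; have := zn j; lia.
Qed.

Lemma uniq_box n : uniq (box n).
Proof.
rewrite map_inj_uniq ?enum_uniq// => f g /rowP fg.
apply/ffunP => j; apply/val_inj; have := fg j; rewrite !mxE/=.
by move: (nat_of_ord _) (nat_of_ord _) => k m; lia.
Qed.

Definition shell n : seq 'rV[int]_d := [seq z <- box n | sup_norm z == n].

Lemma mem_shell n z : (z \in shell n) = (sup_norm z == n).
Proof.
by rewrite mem_filter mem_box; case: eqP => // ->; rewrite leqnn.
Qed.

Lemma uniq_shell n : uniq (shell n).
Proof. exact/filter_uniq/uniq_box. Qed.

Lemma perm_box n : perm_eq (box n.+1) (box n ++ shell n.+1).
Proof.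
apply: uniq_perm => [||z]; first exact: uniq_box.
  rewrite cat_uniq uniq_box uniq_shell andbT/=; apply/hasPn => z.
  by rewrite mem_shell mem_box => /eqP ->; rewrite ltnn.
by rewrite mem_cat !mem_box mem_shell leq_eqVlt orbC ltnS.
Qed.

Lemma big_shell (V : zmodType) (g : 'rV[int]_d -> V) n :
  \sum_(z <- shell n.+1) g z = \sum_(z <- box n.+1) g z - \sum_(z <- box n) g z.
Proof. by rewrite (perm_big _ (perm_box n)) big_cat/= addrAC subrr add0r. Qed.

Lemma big_box_prod (K : comNzRingType) (u : 'I_d -> int -> K) n :
  \sum_(z <- box n) \prod_j u j (z 0 j)
  = \prod_j \sum_(k < n.*2.+1) u j (k%:Z - n%:Z).
Proof.
rewrite bigA_distr_bigA big_map big_enum/=; apply: eq_bigr => f _.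
by apply: eq_bigr => j _; rewrite mxE.
Qed.

End Lattice.

(** Sums over the symmetric range [-n .. n], written as [\sum_(k < n.*2.+1)] of
    the value at [k - n]. *)
Lemma sym_sum_recr (V : nmodType) (f : int -> V) n :
  \sum_(k < n.+1.*2.+1) f (k%:Z - n.+1%:Z)
  = \sum_(k < n.*2.+1) f (k%:Z - n%:Z) + (f n.+1%:Z + f (- n.+1%:Z)).
Proof.
rewrite doubleS big_ord_recl big_ord_recr/= addrC -addrA; congr (_ + _).
  by apply: eq_bigr => i _; congr f; rewrite /bump; lia.
by congr (_ + _); congr f; rewrite /bump/=; lia.
Qed.

Lemma sym_sum_odd (R : numDomainType) (f : int -> R) n :
  (forall k, f (- k) = - f k) -> \sum_(k < n.*2.+1) f (k%:Z - n%:Z) = 0.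
Proof.
move=> fN; elim: n => [|n ih].
  rewrite big_ord1 subrr; have := fN 0; rewrite oppr0 => /eqP.
  by rewrite -addr_eq0 -mulr2n mulrn_eq0/= => /eqP.
by rewrite sym_sum_recr ih add0r fN subrr.
Qed.

Lemma sym_sum_const (R : pzRingType) n : \sum_(k < n.*2.+1) 1 = 2 * n%:R + 1 :> R.
Proof.
by rewrite sumr_const card_ord -addn1 natrD -mul2n natrM.
Qed.

Lemma sym_sum_sqr (R : numFieldType) n :
  \sum_(k < n.*2.+1) (k%:Z - n%:Z)%:~R ^+ 2
  = n%:R * (n%:R + 1) * (2 * n%:R + 1) / 3 :> R.
Proof.
elim: n => [|n ih]; first by rewrite big_ord1 subrr expr0n/= !mul0r.
rewrite (sym_sum_recr (fun k : int => k%:~R ^+ 2 : R)) ih rmorphN/= sqrrN.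
by rewrite -pmulrn -natr1; field.
Qed.

Section Dirichlet.
Context {R : realType}.
Variable d : nat.
Implicit Types (theta : 'rV[R]_d) (x : R) (n : nat).

Definition dirichlet n x : R := \sum_(k < n.*2.+1) cos ((k%:Z - n%:Z)%:~R * x).

Lemma dirichletS n x : dirichlet n.+1 x = dirichlet n x + 2 * cos (n.+1%:R * x).
Proof.
rewrite /dirichlet (sym_sum_recr (fun k : int => cos (k%:~R * x))).
by rewrite rmorphN/= -pmulrn mulNr cosN; ring.
Qed.

Lemma dirichlet0 n : dirichlet n 0 = 2 * n%:R + 1.
Proof.
by rewrite -(sym_sum_const R); apply: eq_bigr => k _; rewrite mulr0 cos0.
Qed.

Definition latvec (z : 'rV[int]_d) : 'rV[R]_d := map_mx intr z.

Import complex.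
Local Open Scope complex_scope.

Let cis x : R[i] := cos x +i* sin x.

Let cisD x y : cis (x + y) = cis x * cis y.
Proof. by rewrite /cis cosD sinD; simpc; congr (_ +i* _); rewrite addrC. Qed.

Let cis_sum (I : Type) (s : seq I) (f : I -> R) :
  cis (\sum_(i <- s) f i) = \prod_(i <- s) cis (f i).
Proof.
elim: s => [|i s ih]; first by rewrite !big_nil /cis cos0 sin0.
by rewrite !big_cons cisD ih.
Qed.

Let Re_sum (I : Type) (s : seq I) (f : I -> R[i]) :
  complex.Re (\sum_(i <- s) f i) = \sum_(i <- s) complex.Re (f i).
Proof.
elim: s => [|i s ih]; first by rewrite !big_nil.
by rewrite !big_cons -ih; case: (f i); case: (\sum_(_ <- _) _).
Qed.

Let Im_sum (I : Type) (s : seq I) (f : I -> R[i]) :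
  complex.Im (\sum_(i <- s) f i) = \sum_(i <- s) complex.Im (f i).
Proof.
elim: s => [|i s ih]; first by rewrite !big_nil.
by rewrite !big_cons -ih; case: (f i); case: (\sum_(_ <- _) _).
Qed.

(** The complex exponentials factor over the coordinates, and the imaginary
    part of each factor vanishes by symmetry. *)
Lemma big_box_cos n theta :
  \sum_(z <- box d n) cos (inner (latvec z) theta) = \prod_j dirichlet n (theta 0 j).
Proof.
have -> : \sum_(z <- box d n) cos (inner (latvec z) theta)
    = complex.Re (\sum_(z <- box d n) \prod_j cis ((z 0 j)%:~R * theta 0 j)).
  rewrite Re_sum; apply: eq_bigr => z _; rewrite -cis_sum /cis/=.
  by congr cos; apply: eq_bigr => j _; rewrite mxE.
rewrite (big_box_prod (fun j (k : int) => cis (k%:~R * theta 0 j))).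
have -> : \prod_j \sum_(k < n.*2.+1) cis ((k%:Z - n%:Z)%:~R * theta 0 j)
    = \prod_j (dirichlet n (theta 0 j))%:C.
  apply: eq_bigr => j _; apply/eqP; rewrite eq_complex Re_sum Im_sum/= eqxx/=.
  apply/eqP; apply: (sym_sum_odd (f := fun k : int => sin (k%:~R * theta 0 j))).
  by move=> k; rewrite rmorphN/= mulNr sinN.
by rewrite -(rmorph_prod (real_complex R))/=.
Qed.

End Dirichlet.

(** * Sums over the shells *)

Section ShellSums.
Context {R : realType}.
Variable d : nat.
Implicit Types (theta : 'rV[R]_d) (z : 'rV[int]_d) (n : nat).

Lemma size_box n : (size (box d n))%:R = (2 * n%:R + 1) ^+ d :> R.
Proof.
transitivity (\sum_(z <- box d n) \prod_(j < d) (1 : R)).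
  by under eq_bigr do rewrite big1_eq; rewrite big_const_seq count_predT iter_addr_0.
rewrite (big_box_prod (fun _ _ => 1 : R)).
by under eq_bigr do rewrite sym_sum_const; rewrite prodr_const card_ord.
Qed.

Lemma size_shell n : (0 < n)%N ->
  (size (shell d n))%:R = (2 * n%:R + 1) ^+ d - (2 * n%:R - 1) ^+ d :> R.
Proof.
case: n => // n _; have := big_shell (fun _ : 'rV[int]_d => 1 : R) n.
rewrite !big_const_seq !count_predT !iter_addr_0 !size_box => ->.
by rewrite -natr1; congr (_ - _ ^+ _); ring.
Qed.

Definition shell_const : R := 2 * d%:R * 3 ^+ d.-1.

Lemma shell_const_ge0 : 0 <= shell_const.
Proof. by rewrite !mulr_ge0// exprn_ge0. Qed.

Lemma size_shell_le n : (0 < n)%N ->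
  (size (shell d n))%:R <= shell_const * n%:R ^+ d.-1 :> R.
Proof.
move=> n0; rewrite size_shell// subrXX.
have n1 : 1 <= n%:R :> R by rewrite ler1n.
have -> : 2 * n%:R + 1 - (2 * n%:R - 1) = 2 :> R by ring.
rewrite /shell_const -!mulrA ler_pM2l//.
apply: (@le_trans _ _ (\sum_(i < d) (3 * n%:R) ^+ d.-1)); last first.
  by rewrite sumr_const card_ord -exprMn -[leLHS]mulr_natl.
apply: ler_sum => i _.
have -> : d.-1 = (d.-1 - i + i)%N by have := ltn_ord i; lia.
rewrite exprD addnK; apply: ler_pM; rewrite ?exprn_ge0//; try lra.
  by apply: lerXn2r; rewrite ?nnegrE; lra.
by apply: lerXn2r; rewrite ?nnegrE; lra.
Qed.

Lemma norm_latvec z : `|latvec z : 'rV[R]_d| = (sup_norm z)%:R.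
Proof.
rewrite [LHS]/Num.norm/= mx_normrE; apply/eqP; rewrite eq_le; apply/andP; split.
  apply/bigmax_leP; split => // -[i j] _ /=; rewrite ord1 mxE.
  rewrite -intr_norm -abszE -pmulrn ler_nat.
  by apply: (sup_normP z (sup_norm z) _).
have [d0|d0] := posnP d.
  have z0 : sup_norm z = 0%N.
    by rewrite /sup_norm big1// => j; have := ltn_ord j; rewrite {2}d0.
  by rewrite z0; apply/bigmax_geP; left.
have [j Ej] : exists j : 'I_d, sup_norm z = `|z 0%R j|%N.
  have [|j Ej] := @bigop.eq_bigmax 'I_d (fun j => `|z 0%R j|%N); last by exists j.
  by rewrite card_ord.
apply/bigmax_geP; right; exists (0, j) => //=.
by rewrite Ej mxE -intr_norm -abszE -pmulrn.
Qed.

Lemma norm_coord theta j : `|theta 0 j| <= `|theta|.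
Proof.
rewrite [leRHS]/Num.norm/= mx_normrE; apply/bigmax_geP; right.
by exists (0, j).
Qed.

Lemma inner_le z theta :
  `|inner (latvec z) theta| <= d%:R * ((sup_norm z)%:R * `|theta|).
Proof.
rewrite /inner; apply: le_trans (ler_norm_sum _ _ _) _.
apply: (@le_trans _ _ (\sum_(j < d) (sup_norm z)%:R * `|theta|)); last first.
  by rewrite sumr_const card_ord -[leLHS]mulr_natl.
by apply: ler_sum => j _; rewrite normrM -norm_latvec ler_pM// norm_coord.
Qed.

Definition shell_sum n theta : R :=
  \sum_(z <- shell d n) (1 - cos (inner (latvec z) theta)).

Lemma shell_sum_ge0 n theta : 0 <= shell_sum n theta.
Proof. by apply: sumr_ge0 => z _; exact: one_sub_cos_ge0. Qed.

Lemma shell_bound (f : 'rV[int]_d -> R) (B : R) n : (0 < n)%N -> 0 <= B ->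
  (forall z, sup_norm z = n -> `|f z| <= B) ->
  `|\sum_(z <- shell d n) f z| <= shell_const * n%:R ^+ d.-1 * B.
Proof.
move=> n0 B0 fB; apply: le_trans (ler_norm_sum _ _ _) _.
apply: (@le_trans _ _ (\sum_(z <- shell d n) B)).
  rewrite big_seq [leRHS]big_seq; apply: ler_sum => z; rewrite mem_shell.
  by move=> /eqP/fB.
by rewrite big_const_seq count_predT iter_addr_0 -[leLHS]mulr_natl ler_wpM2r ?size_shell_le.
Qed.

Lemma shell_sum_le2 n theta : (0 < n)%N ->
  shell_sum n theta <= shell_const * n%:R ^+ d.-1 * 2.
Proof.
move=> n0; apply: le_trans (ler_norm _) _; apply: shell_bound => // z _.
by rewrite ger0_norm ?one_sub_cos_le2// one_sub_cos_ge0.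
Qed.

Let sqr_inner_le z n theta : sup_norm z = n ->
  inner (latvec z) theta ^+ 2 <= d%:R ^+ 2 * (n%:R * `|theta|) ^+ 2.
Proof.
move=> <-; rewrite -exprMn; apply: sqr_le_norm; apply: le_trans (inner_le _ _) _.
exact: ler_norm.
Qed.

Lemma shell_sum_le n theta : (0 < n)%N ->
  shell_sum n theta
  <= shell_const * d%:R ^+ 2 * (n%:R ^+ d.-1 * (n%:R * `|theta|) ^+ 2).
Proof.
move=> n0; rewrite mulrACA; apply: le_trans (ler_norm _) _.
apply: shell_bound => // z /(sqr_inner_le theta) zn.
rewrite ger0_norm ?one_sub_cos_ge0//; apply: le_trans (one_sub_cos_le _) _.
by apply: le_trans zn; have := sqr_ge0 (inner (latvec z) theta); lra.
Qed.

Definition shell_quad n : R :=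
  n%:R * ((2 * n%:R + 1) ^+ d * (n%:R + 1) - (2 * n%:R - 1) ^+ d * (n%:R - 1)) / 6.

Let box_monomial (a b : 'I_d) n :
  \sum_(z <- box d n) (z 0 a)%:~R * (z 0 b)%:~R
  = (a == b)%:R * ((2 * n%:R + 1) ^+ d * (n%:R * (n%:R + 1)) / 3) :> R.
Proof.
pose u (j : 'I_d) (k : int) : R :=
  (if j == a then k%:~R else 1) * (if j == b then k%:~R else 1).
have pick (c : 'I_d) (f : 'I_d -> R) :
    \prod_j (if j == c then f j else 1) = f c.
  by rewrite -big_mkcond big_pred1_eq.
transitivity (\sum_(z <- box d n) \prod_j u j (z 0 j)).
  apply: eq_bigr => z _; rewrite big_split/=.
  by rewrite (pick a (fun j => (z 0 j)%:~R)) (pick b (fun j => (z 0 j)%:~R)).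
rewrite (big_box_prod u) (bigD1 a)//= /u eqxx.
have [<-|ab] := eqVneq a b; last first.
  under eq_bigr do rewrite mulr1.
  rewrite (sym_sum_odd (f := fun k => k%:~R)) ?mul0r// => k.
  by rewrite rmorphN.
under eq_bigr do rewrite -expr2.
rewrite sym_sum_sqr mul1r.
under eq_bigr => j /negPf ja.
  under eq_bigr do rewrite ja mulr1.
  rewrite sym_sum_const; over.
rewrite prodr_const cardC1 card_ord.
by rewrite -[in RHS](ltn_predK (ltn_ord a)) exprS; field.
Qed.

(** Over a cube the mixed second moments of the coordinates vanish by symmetry
    and the other ones are equal, so the quadratic form is a multiple of the
    square of the Euclidean norm; a shell is the difference of two cubes. *)
Lemma sum_shell_sqr n theta : (0 < n)%N ->
  \sum_(z <- shell d n) inner (latvec z) theta ^+ 2 / 2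
  = shell_quad n * eucl_norm theta ^+ 2.
Proof.
have box_sqr m : \sum_(z <- box d m) inner (latvec z) theta ^+ 2 / 2
    = (2 * m%:R + 1) ^+ d * (m%:R * (m%:R + 1)) / 6 * eucl_norm theta ^+ 2.
  rewrite sqr_sqrtr ?sumr_ge0// => [|j _]; last exact: sqr_ge0.
  transitivity (\sum_(z <- box d m) \sum_a \sum_b
      theta 0 a * theta 0 b / 2 * ((z 0 a)%:~R * (z 0 b)%:~R)).
    apply: eq_bigr => z _; rewrite expr2 /inner !mulr_suml; apply: eq_bigr => a _.
    rewrite mulr_sumr mulr_suml; apply: eq_bigr => b _.
    by rewrite !mxE; ring.
  rewrite exchange_big/= mulr_sumr; apply: eq_bigr => a _.
  rewrite exchange_big/= (bigD1 a)//= [X in _ + X]big1 ?addr0 => [|b ba].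
    by rewrite -mulr_sumr box_monomial eqxx mul1r; field.
  by rewrite -mulr_sumr box_monomial eq_sym (negPf ba) mul0r mulr0.
case: n => // n _; rewrite big_shell !box_sqr /shell_quad -(natr1 n).
have -> : 2 * (n%:R + 1) - 1 = 2 * n%:R + 1 :> R by ring.
by field.
Qed.

Lemma shell_sum_quartic n theta : (0 < n)%N ->
  `|shell_sum n theta - shell_quad n * eucl_norm theta ^+ 2|
  <= shell_const * d%:R ^+ 4 * (n%:R ^+ d.-1 * (n%:R * `|theta|) ^+ 4).
Proof.
move=> n0; rewrite -sum_shell_sqr// -sumrB mulrACA.
apply: shell_bound => // z /(sqr_inner_le theta) zn.
apply: le_trans (one_sub_cos_quartic _) _.
rewrite -[4%N]/(2 * 2)%N !exprM -exprMn; apply: lerXn2r => //.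
- by rewrite nnegrE sqr_ge0.
- by rewrite nnegrE mulr_ge0// sqr_ge0.
Qed.

Lemma shell_quad_ge0 n : (0 < n)%N -> 0 <= shell_quad n.
Proof.
move=> n0; have n1 : 1 <= n%:R :> R by rewrite ler1n.
rewrite !mulr_ge0// subr_ge0; apply: ler_pM; rewrite ?exprn_ge0//; try lra.
by apply: lerXn2r; rewrite ?nnegrE; lra.
Qed.

End ShellSums.

Section Fourier.
Context {R : realType}.
Variable d : nat.
Hypothesis d_gt0 : (0 < d)%N.
Variable alpha : R.
Hypothesis alpha_gt0 : 0 < alpha.
Implicit Types (theta : 'rV[R]_d) (n N : nat).

Lemma weight_pred n : (0 < n)%N ->
  n%:R `^ (- (d%:R + alpha)) * n%:R ^+ d.-1 = n%:R `^ (- 1 - alpha).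
Proof.
move=> n0; have nn0 : n%:R != 0 :> R by rewrite pnatr_eq0 -lt0n.
rewrite -powR_mulrn ?ler0n// -powRD ?nn0 ?implybT//; congr (_ `^ _).
by rewrite -[in d%:R](prednK d_gt0) -natr1; ring.
Qed.

Definition Fd_partial theta N : R :=
  \sum_(1 <= n < N) n%:R `^ (- (d%:R + alpha)) * shell_sum n theta.

Let Fd_partial_nondecreasing theta : nondecreasing_seq (Fd_partial theta).
Proof.
apply/nondecreasing_seqP => -[|N]; first by rewrite /Fd_partial !big_geq.
rewrite /Fd_partial [leRHS]big_nat_recr//= lerDl.
by rewrite mulr_ge0 ?powR_ge0 ?shell_sum_ge0.
Qed.

Let Fd_partial_is_cvg theta : cvgn (Fd_partial theta).
Proof.
apply: nondecreasing_is_cvgn => //.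
exists (shell_const d * 2 * (1 + alpha^-1)) => _ [N _ <-].
apply: (@le_trans _ _ (shell_const d * 2 * \sum_(1 <= n < N) n%:R `^ (- 1 - alpha))).
  rewrite mulr_sumr [leLHS]big_nat_cond [leRHS]big_nat_cond; apply: ler_sum => n.
  rewrite andbT => /andP[n0 _]; rewrite -weight_pred// mulrCA ler_wpM2l ?powR_ge0//.
  by rewrite mulrAC; exact: shell_sum_le2.
by rewrite ler_wpM2l ?power_sum_le// mulr_ge0// shell_const_ge0.
Qed.

(** The terms being nonnegative, the lattice may be summed shell by shell. *)
Lemma Fd_cvg theta : Fd_partial theta N @[N --> \oo] --> Fd alpha theta.
Proof.
pose term (z : 'rV[int]_d) : R :=
  1 / `|latvec z : 'rV[R]_d| `^ (d%:R + alpha) * (1 - cos (inner (latvec z) theta)).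
have term_ge0 z : 0 <= term z.
  by rewrite mulr_ge0 ?one_sub_cos_ge0// divr_ge0 ?powR_ge0.
have term0 : term 0 = 0.
  rewrite /term [inner _ _]big1 ?cos0 ?subrr ?mulr0// => j _.
  by rewrite !mxE mul0r.
have shellE n : \sum_(z <- shell d n) term z
    = n%:R `^ (- (d%:R + alpha)) * shell_sum n theta.
  rewrite mulr_sumr big_seq [RHS]big_seq; apply: eq_bigr => z.
  by rewrite mem_shell /term norm_latvec div1r -powRN => /eqP ->.
pose nz := [set z : 'rV[int]_d | z != 0].
have E : (\esum_(z in nz) (term z)%:E
    = limn (fun N => (\sum_(0 <= n < N) (\sum_(z <- shell d n) term z)%:E)))%E.
  transitivity (\esum_(z in \bigcup_n [set` shell d n]) (term z)%:E)%E.
    rewrite esum_mkcond [RHS]esum_mkcond; apply: eq_esum => z _.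
    rewrite [in RHS]mem_set; last by exists (sup_norm z) => //=; rewrite mem_shell.
    by case: ifPn => //; rewrite notin_setE/= => /negP; rewrite negbK => /eqP ->;
      rewrite term0.
  rewrite nneseries_sum_bigcup; first last.
  - by move=> z; rewrite lee_fin.
  - by move=> m n _ _ [z [/=]]; rewrite !mem_shell => /eqP <- /eqP.
  apply: congr_lim; apply/funext => N; apply: eq_bigr => n _.
  rewrite esum_fset; [|exact: finite_seq|by move=> z _; rewrite lee_fin].
  by rewrite -fsbig_seq ?uniq_shell// sumEFin.
have lE : Fd alpha theta = limn (Fd_partial theta).
  rewrite /Fd -/nz -/(latvec _) E.
  transitivity (fine (limn (fun N => (Fd_partial theta N)%:E))).
    congr fine; apply: congr_lim; apply/funext => -[|N].
      by rewrite /Fd_partial !big_geq.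
    rewrite big_ltn// shellE /shell_sum big1_seq ?mulr0 ?add0e; last first.
      move=> z /andP[_]; rewrite mem_shell => /eqP z0.
      rewrite [inner _ _]big1 ?cos0 ?subrr// => j _.
      have /sup_normP/(_ j) : (sup_norm z <= 0)%N by rewrite z0.
      by rewrite leqn0 absz_eq0 mxE => /eqP ->; rewrite mul0r.
    by rewrite sumEFin; congr EFin; apply: eq_bigr => n _; exact: shellE.
  by rewrite (EFin_lim (@Fd_partial_is_cvg theta)).
rewrite lE; exact: Fd_partial_is_cvg.
Qed.

End Fourier.

(** * The incomplete gamma function *)

Section CompactIntegral.
Context {R : realType}.
Implicit Types (f F : R -> R) (a b x M : R).

Local Notation mu := (@lebesgue_measure R).

Lemma continuous_integrable f a b : continuous f ->
  mu.-integrable `[a, b] (EFin \o f).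
Proof.
move=> cf; apply: continuous_compact_integrable; first exact: segment_compact.
exact: continuous_subspaceT.
Qed.

Lemma integral_deriv f F a b : a < b -> continuous f ->
  (forall x, is_derive x 1 F (f x)) ->
  \int[mu]_(x in `[a, b]) f x = F b - F a.
Proof.
move=> ab cf dF; have cF : continuous F by move=> x; exact: deriv_continuous.
rewrite /Rintegral (@continuous_FTC2 R f F a b ab)//.
- exact: continuous_subspaceT.
- split; first by move=> x _; have dFx := dF x; exact: ex_derive.
  + exact/cvg_at_right_filter/cF.
  + exact/cvg_at_left_filter/cF.
- by move=> x _; rewrite derive1E; have dFx := dF x; exact: derive_val.
Qed.

Lemma integral_const a b (r : R) : a <= b ->
  \int[mu]_(x in `[a, b]) r = r * (b - a).
Proof.
move=> ab; rewrite Rintegral_cst//= lebesgue_measure_itv/= lte_fin.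
by case: ltP ab => // ba ab; rewrite (le_anti (introT andP (conj ab ba))) subrr.
Qed.

Lemma norm_integral_le f a b M : a <= b -> continuous f ->
  (forall x, a <= x <= b -> `|f x| <= M) ->
  `|\int[mu]_(x in `[a, b]) f x| <= M * (b - a).
Proof.
move=> ab cf fM; rewrite -integral_const//.
have cn : continuous (fun x => `|f x|).
  by move=> x; apply: continuous_comp; [exact: cf|exact: norm_continuous].
apply: le_trans (le_normr_Rintegral _ _) _ => //; first exact: continuous_integrable.
apply: le_Rintegral.
- exact: measurable_itv.
- exact: continuous_integrable.
- by apply: continuous_integrable => x; exact: cvg_cst.
- by move=> x /=; rewrite in_itv/=; exact: fM.
Qed.

End CompactIntegral.

Section IncompleteGamma.
Context {R : realType}.
Variable p : R.
Hypothesis p_gt0 : 0 < p.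
Hypothesis p_le1 : p <= 1.
Implicit Types (s v : R).

Local Notation mu := (@lebesgue_measure R).

Let f v : R := v `^ (p - 1) * expR (- v).

Definition lower_gamma s : R := \int[mu]_(v in `[0, s]) f v.

Let f_ge0 v : 0 <= f v.
Proof. by rewrite mulr_ge0 ?powR_ge0 ?expR_ge0. Qed.

Let f_continuous v : 0 < v -> {for v, continuous f}.
Proof.
by move=> v0; apply: deriv_continuous; rewrite /f; derive_tac.
Qed.

Let f_measurable : measurable_fun [set: R] f.
Proof.
apply: measurable_funM => //.
by apply: measurableT_comp => //; exact: measurable_funN.
Qed.

(** The derivative of the bounded function [(v / (1 + v)) ^ p]. *)
Let dom v : R := p * (v `^ (p - 1) * (1 + v) `^ (- 1 - p)).

(** The constant comes from [exp v >= (1 + v / 2) ^ 2 >= (1 + v) ^ 2 / 4]. *)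
Let f_le_dom v : 0 < v -> f v <= 4 / p * dom v.
Proof.
move=> v0; have v1 : 1 <= 1 + v by rewrite lerDl ltW.
have -> : 4 / p * dom v = v `^ (p - 1) * (4 * (1 + v) `^ (- 1 - p)).
  by rewrite /dom; field; rewrite gt_eqF.
rewrite ler_wpM2l ?powR_ge0//.
apply: (@le_trans _ _ (4 * (1 + v) `^ (- 2))); last first.
  by rewrite ler_wpM2l// ler_powR//; have := p_le1; lra.
rewrite powRN expRN powR_mulrn; last by lra.
have v10 : 0 < 1 + v by lra.
rewrite -ler_pdivrMl// -invfM lef_pV2 ?posrE ?mulr_gt0 ?expR_gt0 ?exprn_gt0//.
have : 1 + v / 2 <= expR (v / 2) by exact: expR_ge1Dx.
have -> : expR v = expR (v / 2) ^+ 2.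
  by rewrite -expRM_natl; congr expR; field.
move: (expR _) => e; nra.
Qed.

Let dom_primitive v : 0 < v ->
  is_derive v 1 (fun x => x `^ p * (1 + x) `^ (- p)) (dom v).
Proof.
move=> v0; have v1 : 0 < 1 + v by rewrite ltr_wpDl.
derive_eq; rewrite /dom mulr1 add0r mulr1.
have -> : (1 + v) `^ (- p) = (1 + v) * (1 + v) `^ (- 1 - p).
  rewrite [in LHS](_ : - p = 1 + (- 1 - p)); last by ring.
  by rewrite powRD ?(gt_eqF v1) ?implybT// powRr1// ltW.
have -> : v `^ p = v * v `^ (p - 1) by rewrite mulr_powRB1// ltW.
by rewrite (_ : - p - 1 = - 1 - p); ring.
Qed.

Let integral_f_le (e M : R) : 0 < e -> e <= M ->
  (\int[mu]_(v in `[e, M]) (f v)%:E <= (4 / p)%:E)%E.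
Proof.
move=> e0; rewrite le_eqVlt => /predU1P[<-|eM].
  by rewrite set_itv1 integral_set1 lee_fin divr_ge0// ltW.
pose F x := 4 / p * (x `^ p * (1 + x) `^ (- p)).
have dF v : 0 < v -> is_derive v 1 F (4 / p * dom v).
  move=> v0; have := dom_primitive v0 => h.
  by apply: (@deriv_eq _ _ _ _ _ (deriv_mul (deriv_cst (4 / p) v) h)); ring.
have cF v : 0 < v -> {for v, continuous F}.
  by move=> v0; exact: deriv_continuous (dF v v0).
have cdom v : 0 < v -> {for v, continuous (fun x => 4 / p * dom x)}.
  move=> v0; have v1 : 0 < 1 + v by rewrite ltr_wpDl.
  by notypeclasses refine (deriv_continuous _); rewrite /dom; derive_tac.
have gt0 v : v \in `[e, M] -> 0 < v.
  by rewrite in_itv/= => /andP[+ _]; exact: lt_le_trans.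
have lef v : v \in `[e, M] -> f v <= 4 / p * dom v by move/gt0/f_le_dom.
apply: (@le_trans _ _ (\int[mu]_(v in `[e, M]) (4 / p * dom v)%:E)%E).
  apply: ge0_le_integral => //=.
  - by move=> v _; rewrite lee_fin.
  - by apply/measurable_EFinP; apply: measurable_funTS.
  - apply/measurable_EFinP; apply: measurable_funTS; apply: measurable_funM => //.
    apply: measurable_funM => //; apply: measurable_funM => //.
    apply: (measurableT_comp (measurable_powR _)) => //.
    exact: measurable_funD.
rewrite (@continuous_FTC2 _ _ F)//; first last.
- move=> v; rewrite derive1E => /subset_itv_oo_cc/gt0 v0.
  by have h := dF _ v0; exact: derive_val.
- split.
  + by move=> v /subset_itv_oo_cc/gt0 v0; have h := dF _ v0; exact: ex_derive.
  + exact/cvg_at_right_filter/cF.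
  + by apply: cvg_at_left_filter; apply: cF; exact: lt_trans eM.
- by apply: continuous_in_subspaceT => v; rewrite inE/= => /gt0; exact: cdom.
rewrite -EFinB lee_fin.
have M0 : 0 < M by exact: lt_trans eM.
have F_ge0 x : 0 <= F x by rewrite /F !mulr_ge0 ?powR_ge0// ?invr_ge0 ltW.
apply: (@le_trans _ _ (F M)); first by rewrite gerBl.
rewrite /F -[leRHS]mulr1 ler_wpM2l ?divr_ge0 ?(ltW p_gt0)//.
rewrite powRN ler_pdivrMr ?powR_gt0 ?addr_gt0// mul1r.
by apply: ge0_ler_powR; rewrite ?nnegrE ?(ltW p_gt0) ?addr_ge0 ?(ltW M0) ?lerDr.
Qed.

Let integral_f_lty : (\int[mu]_(v in `]0%R, +oo[) (f v)%:E < +oo)%E.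
Proof.
pose E n : set R := `[n.+1%:R^-1, n.+1%:R]%classic.
have E_le n : n.+1%:R^-1 <= n.+1%:R :> R.
  by rewrite (@le_trans _ _ 1) ?ler1n// invf_le1 ?ltr0n// ler1n.
have -> : [set` `]0, +oo[%R] = \bigcup_n E n.
  apply/seteqP; split => [v|v [n _]]; rewrite /E/= !in_itv/= ?andbT; last first.
    by move=> /andP[h _]; apply: lt_le_trans h; rewrite invr_gt0 ltr0n.
  move=> v0; pose n := Num.truncn (Num.max v v^-1); exists n => //=.
  have : Num.max v v^-1 < n.+1%:R by exact: truncnS_gt.
  rewrite in_itv/= gt_max => /andP[vn vVn]; rewrite (ltW vn) andbT.
  by rewrite -[leRHS]invrK lef_pV2 ?posrE ?invr_gt0 ?ltr0n// ltW.
have : (fun n => \int[mu]_(v in E n) (f v)%:E)%E @ \oo -->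
    (\int[mu]_(v in \bigcup_n E n) (f v)%:E)%E.
  apply: ge0_nondecreasing_set_cvg_integral => //.
  - apply/nondecreasing_seqP => n; apply/subsetPset => v; rewrite /E/= !in_itv/=.
    move=> /andP[nv vn]; apply/andP; split.
      by apply: le_trans nv; rewrite lef_pV2 ?posrE ?ltr0n// ler_nat.
    by apply: le_trans vn _; rewrite ler_nat.
  - by move=> n; exact: measurable_itv.
  - by move=> n; apply/measurable_EFinP; exact: measurable_funTS.
  - by move=> n v _; rewrite lee_fin.
move=> /cvg_lim <-//; apply: (@le_lt_trans _ _ (4 / p)%:E); last exact: ltry.
apply: lime_le.
  apply: ereal_nondecreasing_is_cvgn.
  apply/nondecreasing_seqP => n; apply: ge0_subset_integral => //.
  - exact: measurable_itv.
  - exact: measurable_itv.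
  - by apply/measurable_EFinP; exact: measurable_funTS.
  - by move=> v _; rewrite lee_fin.
  - move=> v; rewrite /E/= !in_itv/=.
    move=> /andP[nv vn]; apply/andP; split.
      by apply: le_trans nv; rewrite lef_pV2 ?posrE ?ltr0n// ler_nat.
    by apply: le_trans vn _; rewrite ler_nat.
by apply: nearW => n; apply: integral_f_le; rewrite ?invr_gt0 ?ltr0n.
Qed.

Lemma gamma_integrable : mu.-integrable `[0, +oo[ (EFin \o f).
Proof.
apply/integrableP; split; first by apply/measurable_EFinP; exact: measurable_funTS.
rewrite [ltLHS](_ : _ = (\int[mu]_(v in `]0%R, +oo[) (f v)%:E)%E)//.
rewrite integral_itv_obnd_cbnd.
  by apply: eq_integral => v _ /=; rewrite ger0_norm.
by apply/measurable_EFinP; exact: measurable_funTS.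
Qed.

Lemma deriv_lower_gamma s : 0 < s ->
  is_derive s 1 lower_gamma (s `^ (p - 1) * expR (- s)).
Proof.
move=> s0; have s1 : s < s + 1 by rewrite ltrDl.
have intf : mu.-integrable `[0, s + 1] (EFin \o f).
  apply: integrableS gamma_integrable => //.
  by move=> v/=; rewrite !in_itv/= => /andP[-> _].
have [dv fE] := continuous_FTC1_closed s1 intf s0 (f_continuous s0).
by apply: deriv_eq; [exact: derivableP|rewrite -derive1E].
Qed.

Lemma lower_gamma_cvg0 : lower_gamma s @[s --> 0^'+] --> 0.
Proof.
apply: cvg_at_right_filter.
apply: (@parameterized_integral_cvg_left R 0 1 f ltr01).
apply: integrableS gamma_integrable => //.
by move=> v/=; rewrite !in_itv/= => /andP[-> _].
Qed.

Let lower_gammaE s : (lower_gamma s)%:E = (\int[mu]_(v in `[0%R, s]) (f v)%:E)%E.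
Proof.
rewrite fineK//; apply: integrable_fin_num => //.
apply: integrableS gamma_integrable => //.
by move=> v/=; rewrite !in_itv/= => /andP[-> _].
Qed.

Let Gamma_integralE :
  (Gamma_integral p)%:E = (\int[mu]_(v in `[0%R, +oo[) (f v)%:E)%E.
Proof.
rewrite /Gamma_integral Rintegral_itv_obnd_cbnd.
  by rewrite fineK//; apply: integrable_fin_num => //; exact: gamma_integrable.
apply: integrableS gamma_integrable => //.
by move=> v/=; rewrite !in_itv/= !andbT; exact: ltW.
Qed.

Let le_gamma (A B : set R) : measurable A -> measurable B -> A `<=` B ->
  (\int[mu]_(v in A) (f v)%:E <= \int[mu]_(v in B) (f v)%:E)%E.
Proof.
move=> mA mB AB; apply: ge0_subset_integral => //.
- by apply/measurable_EFinP; exact: measurable_funTS.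
- by move=> v _; rewrite lee_fin.
Qed.

Lemma lower_gamma_cvgy : lower_gamma s @[s --> +oo] --> Gamma_integral p.
Proof.
pose E n : set R := `[0, n%:R]%classic.
have nd s t : s <= t -> lower_gamma s <= lower_gamma t.
  move=> st; rewrite -lee_fin !lower_gammaE; apply: le_gamma => // v/=.
  by rewrite !in_itv/= => /andP[-> /le_trans->].
have ub s : lower_gamma s <= Gamma_integral p.
  rewrite -lee_fin lower_gammaE Gamma_integralE; apply: le_gamma => // v/=.
  by rewrite !in_itv/= => /andP[-> _].
have cvgE : (lower_gamma n%:R)%:E @[n --> \oo] --> (Gamma_integral p)%:E.
  rewrite Gamma_integralE.
  have -> : [set` `[0%R, +oo[] = \bigcup_n E n.
    apply/seteqP; split => [v|v [n _]]; rewrite /E/= !in_itv/= ?andbT; last first.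
      by case/andP.
    move=> v0; exists (Num.truncn v).+1 => //=.
    by rewrite in_itv/= v0/= ltW// truncnS_gt.
  under eq_fun do rewrite lower_gammaE.
  apply: ge0_nondecreasing_set_cvg_integral => //.
  - apply/nondecreasing_seqP => n; apply/subsetPset => v; rewrite /E/= !in_itv/=.
    by move=> /andP[-> vn]; apply: le_trans vn _; rewrite ler_nat.
  - by move=> n; exact: measurable_itv.
  - by move=> n; apply/measurable_EFinP; exact: measurable_funTS.
  - by move=> n v _; rewrite lee_fin.
have /cvgrPdist_lt cvgR : lower_gamma n%:R @[n --> \oo] --> Gamma_integral p.
  exact: (fine_cvg cvgE).
apply/cvgrPdist_lt => e /cvgR[N _ /(_ N (leqnn N))/= HN].
near=> s; apply: le_lt_trans HN.
have sN : N%:R <= s by near: s; exact: nbhs_pinfty_ge.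
by rewrite !ger0_norm ?subr_ge0 ?ub// lerD2l lerN2 nd.
Unshelve. all: by end_near. Qed.

End IncompleteGamma.

(** * Rotation of a path of integration *)

Section Rotation.
Context {R : realType}.
Variables a c : R.
Hypothesis c01 : 0 <= c <= 1.
Implicit Types (s th : R).

Local Notation mu := (@lebesgue_measure R).

Let beta th : R := a * (pi / 2 - th).
Let damp s th : R := expR (- (s * cos th)).

(** With [z = s e ^ (i th)], [rot_re] and [rot_im] are the real and imaginary
    parts of [e ^ (i beta) (1 - c z - e ^ (- z))].  Multiplied by [s ^ (- a)],
    this is the holomorphic function
    [e ^ (i pi a / 2) z ^ (- a) (1 - c z - e ^ (- z))], and [w] is the opposite
    of its imaginary part. *)
Definition rot_im s th : R :=
  sin (beta th) - c * s * sin (beta th + th) - damp s th * sin (beta th - s * sin th).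

Definition rot_re s th : R :=
  cos (beta th) - c * s * cos (beta th + th) - damp s th * cos (beta th - s * sin th).

Let rot_im1 s th : R :=
  - (c * sin (beta th + th)) + damp s th * sin (beta th - s * sin th + th).

Let w s th : R := - (s `^ (- a) * rot_im s th).
Let dw s th : R := s `^ (- a - 1) * (a * rot_im s th - s * rot_im1 s th).

Let deriv_w s th : 0 < s -> is_derive s 1 (w ^~ th) (dw s th).
Proof.
move=> s0; rewrite /w /rot_im /damp.
derive_eq; rewrite /dw /rot_im1 /rot_im /damp (sinD (beta th - s * sin th)).
have -> : s `^ (- a) = s * s `^ (- a - 1).
  rewrite -[in X in _ = X * _](powRr1 (ltW s0)) -powRD ?(gt_eqF s0) ?implybT//.
  by congr (_ `^ _); ring.
ring.
Qed.

Let deriv_re s th : is_derive th 1 (rot_re s) (a * rot_im s th - s * rot_im1 s th).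
Proof.
rewrite /rot_re /beta /damp.
derive_eq; rewrite /rot_im /rot_im1 -/(beta th) -/(damp s th).
rewrite (sinD (beta th - s * sin th)).
ring.
Qed.

Let continuous_w s : continuous (w s).
Proof.
move=> th; apply: deriv_continuous; rewrite /w /rot_im /beta /damp; derive_tac.
Qed.

Let continuous_dw s : continuous (dw s).
Proof.
move=> th; apply: deriv_continuous; rewrite /dw /rot_im1 /rot_im /beta /damp; derive_tac.
Qed.

Let damp_le1 s th : 0 <= s -> 0 <= th <= pi / 2 -> damp s th <= 1.
Proof.
move=> s0 /andP[th0 th1]; rewrite -expR0 ler_expR oppr_le0 mulr_ge0//.
by apply: cos_ge0_pihalf; rewrite th1 andbT (le_trans _ th0)// oppr_le0 divr_ge0// pi_ge0.
Qed.

Let damp_sin_le1 s th x : 0 <= s -> 0 <= th <= pi / 2 -> `|damp s th * sin x| <= 1.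
Proof.
move=> s0 th01; rewrite normrM ger0_norm ?expR_ge0// mulr_ile1 ?expR_ge0//.
  exact: damp_le1.
exact: sin_max.
Qed.

Let c_sin_le1 x : `|c * sin x| <= 1.
Proof.
by case/andP: c01 => c0 c1; rewrite normrM ger0_norm// mulr_ile1 ?sin_max.
Qed.

Let rot_im_le s th : 0 <= s -> 0 <= th <= pi / 2 -> `|rot_im s th| <= 2 + s.
Proof.
move=> s0 th01; rewrite /rot_im.
have A := sin_max (beta th); have B := c_sin_le1 (beta th + th).
have C := damp_sin_le1 (beta th - s * sin th) s0 th01.
have -> : c * s * sin (beta th + th) = s * (c * sin (beta th + th)) by ring.
move: A B C; rewrite !ler_norml; move: (sin _) (c * _) (damp _ _ * _) => x y z.
by move=> /andP[? ?] /andP[? ?] /andP[? ?]; apply/andP; split; nra.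
Qed.

Let rot_im1_le s th : 0 <= s -> 0 <= th <= pi / 2 -> `|rot_im1 s th| <= 2.
Proof.
move=> s0 th01; apply: le_trans (ler_normD _ _) _; rewrite normrN.
have := c_sin_le1 (beta th + th).
have := damp_sin_le1 (beta th - s * sin th + th) s0 th01; lra.
Qed.

Definition rotated s : R := \int[mu]_(th in `[0, pi / 2]) w s th.

(** By the Cauchy-Riemann equations, the derivative of [w] in [s] is the
    derivative in [th] of [s ^ (- a - 1) rot_re]; its integral only sees the two
    axes [th = 0] and [th = pi / 2]. *)
Lemma deriv_rotated s : 0 <= a -> 0 < s ->
  is_derive s 1 rotated (s `^ (- a - 1) * (rot_re s (pi / 2) - rot_re s 0)).
Proof.
move=> a0 s0; pose u := s / 2; pose v := 2 * s.
have u0 : 0 < u by rewrite /u; lra.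
have suv : `]u, v[%classic s by rewrite /= in_itv/= /u /v; apply/andP; split; lra.
pose K := u `^ (- a - 1) * (a * (2 + v) + v * 2).
have v0 : 0 < v by rewrite /v; lra.
have K0 : 0 <= K by rewrite mulr_ge0 ?powR_ge0// addr_ge0 ?mulr_ge0 ?addr_ge0// ltW.
have pos x : `]u, v[%classic x -> 0 < x.
  by rewrite /= in_itv/= => /andP[ux _]; exact: lt_trans ux.
have mB : measurable (`[0, pi / 2]%classic : set R) by exact: measurable_itv.
have intw x : `]u, v[%classic x -> mu.-integrable `[0, pi / 2] (EFin \o w x).
  by move=> _; exact/continuous_integrable/continuous_w.
have derw x th : `]u, v[%classic x -> `[0, pi / 2]%classic th -> derivable (w ^~ th) x 1.
  by move=> /pos x0 _; have h := deriv_w th x0; exact: ex_derive.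
have d1w x th : 0 < x -> partial1of2 w x th = dw x th.
  by move=> x0; rewrite partial1of2E; have h := deriv_w th x0; exact: derive_val.
have intK : mu.-integrable `[0, pi / 2] (EFin \o cst K).
  by apply: continuous_integrable => x; exact: cvg_cst.
have wK x th : `]u, v[%classic x -> `[0, pi / 2]%classic th -> `|partial1of2 w x th| <= K.
  move=> xuv; rewrite /= in_itv/= => th01; have x0 := pos _ xuv.
  move: xuv; rewrite /= in_itv/= => /andP[ux xv]; rewrite d1w// /dw normrM.
  apply: ler_pM; rewrite ?normr_ge0//.
    rewrite ger0_norm ?powR_ge0//.
    have -> : - a - 1 = - (a + 1) by ring.
    rewrite !powRN lef_pV2 ?posrE ?powR_gt0//.
    by apply: ge0_ler_powR; rewrite ?nnegrE ?addr_ge0// ltW.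
  apply: le_trans (ler_normB _ _) _; rewrite !normrM (ger0_norm a0).
  rewrite (ger0_norm (ltW x0)).
  apply: lerD; first rewrite ler_wpM2l//.
    by apply: le_trans (rot_im_le (ltW x0) th01) _; rewrite lerD2l ltW.
  by apply: ler_pM; [exact: ltW|exact: normr_ge0|exact: ltW|exact: rot_im1_le (ltW x0) th01].
have K0' (th : R) : 0 <= cst K th by [].
have dF := @derivable_under_integral R _ _ mu w _ mB s u v suv intw derw (cst K) K0' intK wK.
have dE := @differentiation_under_integral R _ _ mu w _ mB s u v suv intw derw (cst K) K0' intK wK.
apply: deriv_eq; first exact: derivableP dF.
rewrite -derive1E dE.
transitivity (\int[mu]_(th in `[0, pi / 2]) dw s th).
  by apply: eq_Rintegral => th _; rewrite d1w.
have dre th : is_derive th 1 (fun th => s `^ (- a - 1) * rot_re s th) (dw s th).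
  have h := deriv_re s th.
  by apply: (deriv_eq (deriv_mul (deriv_cst (s `^ (- a - 1)) th) h)); rewrite /dw; ring.
have pi2 : 0 < pi / 2 :> R by rewrite divr_gt0// pi_gt0.
by rewrite (integral_deriv pi2 (continuous_dw (s := s)) dre); ring.
Qed.

Lemma rot_re_pihalf s : rot_re s (pi / 2) = 1 - cos s.
Proof.
rewrite /rot_re /beta /damp subrr mulr0 add0r cos0 cos_pihalf sin_pihalf.
by rewrite !mulr0 oppr0 expR0 mulr1 add0r cosN; ring.
Qed.

Lemma rot_re_0 s : rot_re s 0 = cos (a * (pi / 2)) * (1 - c * s - expR (- s)).
Proof.
rewrite /rot_re /beta /damp subr0 addr0 cos0 sin0 mulr1 mulr0 subr0; ring.
Qed.

(** In [rot_im], the expansion of [q] at [s = 0] cancels the other terms, up to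
    the first order if [c = 0] and up to the second if [c = 1]. *)
Let q th s : R := damp s th * sin (beta th - s * sin th).
Let q1 th s : R := - (damp s th * sin (beta th - s * sin th + th)).
Let q2 th s : R := damp s th * sin (beta th - s * sin th + th + th).

Let deriv_q th s : is_derive s 1 (q th) (q1 th s).
Proof.
rewrite /q /damp; derive_eq; by rewrite /q1 /damp (sinD (beta th - s * sin th)); ring.
Qed.

Let deriv_q1 th s : is_derive s 1 (q1 th) (q2 th s).
Proof.
rewrite /q1 /damp; derive_eq; by rewrite /q2 /damp (sinD (beta th - s * sin th + th)); ring.
Qed.

Let q0 th : q th 0 = sin (beta th).
Proof. by rewrite /q /damp !mul0r oppr0 expR0 mul1r addr0. Qed.

Let q_taylor1 th s : 0 <= s -> 0 <= th <= pi / 2 -> `|q th s - sin (beta th)| <= s.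
Proof.
move=> s0 th01; rewrite -q0.
apply: (@le_trans _ _ (1 * `|s - 0|)); last by rewrite mul1r subr0 ger0_norm.
apply: (deriv_bound (deriv_q th)) => x.
rewrite min_l// max_r// => /andP[x0 xs].
by rewrite normrN; exact: damp_sin_le1.
Qed.

Let q_taylor2 th s : 0 <= s -> 0 <= th <= pi / 2 ->
  `|q th s - sin (beta th) + s * sin (beta th + th)| <= s ^+ 2.
Proof.
move=> s0 th01; pose r x := q th x - sin (beta th) + x * sin (beta th + th).
have q10 : q1 th 0 = - sin (beta th + th).
  by rewrite /q1 /damp !mul0r oppr0 expR0 mul1r addr0.
have dr (x : R) : is_derive x 1 r (q1 th x + sin (beta th + th)).
  have h := deriv_add (deriv_add (deriv_q th x) (deriv_cst (- sin (beta th)) x))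
    (deriv_mul (deriv_id x) (deriv_cst (sin (beta th + th)) x)).
  by apply: (deriv_eq h); ring.
have -> : q th s - sin (beta th) + s * sin (beta th + th) = r s - r 0.
  by rewrite /r q0; ring.
have -> : s ^+ 2 = s * `|s - 0| by rewrite subr0 ger0_norm// expr2.
apply: (deriv_bound dr) => x; rewrite min_l// max_r// => /andP[x0 xs].
have -> : q1 th x + sin (beta th + th) = q1 th x - q1 th 0 by rewrite q10 opprK.
apply: (@le_trans _ _ (1 * `|x - 0|)); last by rewrite mul1r subr0 ger0_norm.
apply: (deriv_bound (deriv_q1 th)) => y; rewrite min_l// max_r// => /andP[y0 yx].
exact: damp_sin_le1.
Qed.


Let pi2 : 0 < pi / 2 :> R. Proof. by rewrite divr_gt0// pi_gt0. Qed.

Let rotated_bound (B : R) (l : R) s :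
  (forall th, 0 <= th <= pi / 2 -> `|w s th - l| <= B) ->
  `|rotated s - l * (pi / 2)| <= B * (pi / 2).
Proof.
move=> wB; have cl : continuous (cst l : R -> R) by move=> x; exact: cvg_cst.
have -> : rotated s - l * (pi / 2) = \int[mu]_(th in `[0, pi / 2]) (w s th - l).
  rewrite RintegralB//; [|exact/continuous_integrable/continuous_w
                         |exact: continuous_integrable].
  by rewrite (integral_const l (ltW pi2)) subr0.
have := @norm_integral_le R (fun th => w s th - l) 0 (pi / 2) B (ltW pi2).
rewrite subr0; apply => // th; apply: cvgB; [exact: continuous_w|exact: cvg_cst].
Qed.

Lemma rotated_near0 s : 0 < s ->
  `|rotated s| <= s `^ (- a) * ((1 - c) * s + c * s ^+ 2) * (pi / 2).
Proof.
move=> s0; rewrite -[X in `|X|]subr0 -(mul0r (pi / 2)).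
apply: rotated_bound => th th01; rewrite subr0 /w normrN normrM.
rewrite ger0_norm ?powR_ge0// ler_wpM2l ?powR_ge0//.
have -> : rot_im s th = - ((1 - c) * (q th s - sin (beta th))
    + c * (q th s - sin (beta th) + s * sin (beta th + th))).
  by rewrite /rot_im -/(q th s); ring.
case/andP: c01 => c0 c1; rewrite normrN; apply: le_trans (ler_normD _ _) _.
rewrite !normrM (ger0_norm c0) (@ger0_norm _ (1 - c)) ?subr_ge0//.
by apply: lerD; rewrite ler_wpM2l ?subr_ge0 ?q_taylor1 ?q_taylor2// ltW.
Qed.

Lemma rotated_near_infty s : 0 < s -> `|rotated s| <= s `^ (- a) * (2 + c * s) * (pi / 2).
Proof.
move=> s0; rewrite -[X in `|X|]subr0 -(mul0r (pi / 2)).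
apply: rotated_bound => th th01; rewrite subr0 /w normrN normrM.
rewrite ger0_norm ?powR_ge0// ler_wpM2l ?powR_ge0// /rot_im.
case/andP: c01 => c0 c1.
apply: le_trans (ler_normB _ _) _.
have := damp_sin_le1 (beta th - s * sin th) (ltW s0) th01.
have : `|sin (beta th) - c * s * sin (beta th + th)| <= 1 + c * s; last by lra.
apply: le_trans (ler_normB _ _) _; apply: lerD; first exact: sin_max.
rewrite normrM ger0_norm ?mulr_ge0//; last exact: ltW.
by rewrite ler_piMr ?sin_max// mulr_ge0// ltW.
Qed.

(** For [a = 1] the argument [beta th + th] is constantly [pi / 2]. *)
Lemma rotated_near_infty_critical s : a = 1 -> c = 1 -> 0 < s ->
  `|rotated s - pi / 2| <= 2 * s^-1 * (pi / 2).
Proof.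
move=> a1 c1 s0; rewrite -[X in rotated s - X]mul1r.
apply: rotated_bound => th th01.
have -> : w s th - 1 = - (s^-1 * (sin (beta th) - q th s)).
  rewrite /w /rot_im -/(q th s) /beta a1 c1 !mul1r subrK sin_pihalf.
  by rewrite powR_inv1 ?(ltW s0)//; field; rewrite gt_eqF.
rewrite normrN normrM (@ger0_norm _ s^-1) ?invr_ge0 ?(ltW s0)// mulrC.
rewrite ler_wpM2r ?invr_ge0 ?(ltW s0)//; apply: le_trans (ler_normB _ _) _.
have := damp_sin_le1 (beta th - s * sin th) (ltW s0) th01.
by have := sin_max (beta th); rewrite /q; lra.
Qed.

End Rotation.

(** * The Mellin transform of [1 - cos] *)

Section MellinCosine.
Context {R : realType}.
Implicit Types (a p s : R) (f g : R -> R).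

Lemma powR_cvgy p : p < 0 -> s `^ p @[s --> +oo] --> (0 : R).
Proof.
move=> p0; apply/cvgrPdist_lt => e e0; near=> s.
have s1 : e `^ p^-1 < s by near: s; exact: nbhs_pinfty_gt.
rewrite sub0r normrN ger0_norm ?powR_ge0//.
have -> : e = (e `^ p^-1) `^ p by rewrite -powRrM mulVf ?lt_eqF// powRr1// ltW.
have e1 : 0 < e `^ p^-1 by exact: powR_gt0.
have s0 : 0 < s by exact: lt_trans s1.
have pE (x : R) : x `^ p = (x `^ (- p))^-1 by rewrite powRN invrK.
rewrite (pE s) (pE (e `^ p^-1)) ltf_pV2 ?posrE ?powR_gt0//.
by apply: gt0_ltr_powR; rewrite ?oppr_gt0 ?nnegrE ?(ltW e1) ?(ltW s0).
Unshelve. all: by end_near. Qed.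

Lemma cvg0_dominated (F : set_system R) {FF : Filter F} f g :
  (\forall s \near F, 0 < s) -> (forall s, 0 < s -> `|f s| <= g s) ->
  g s @[s --> F] --> 0 -> f s @[s --> F] --> 0.
Proof.
move=> F0 fg g0; apply/norm_cvg0P.
apply: (@squeeze_cvgr _ _ _ _ (cst 0) g) => //; last exact: cvg_cst.
by apply: filterS F0 => s s0; rewrite normr_ge0 fg.
Qed.

Let near0y : \forall s \near +oo%R, 0 < s :> R.
Proof. exact: nbhs_pinfty_gt. Qed.

Let near00 : \forall s \near 0^'+, 0 < s :> R.
Proof. exact: nbhs_right_gt. Qed.

Let exp_le s : 0 < s -> 0 <= 1 - expR (- s) <= s.
Proof.
move=> s0; have := expR_ge1Dx (- s) => h; apply/andP; split; last by lra.
by rewrite subr_ge0 -expR0 ler_expR oppr_le0 ltW.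
Qed.

Let exp_le1 s : 0 < s -> 0 <= 1 - expR (- s) <= 1.
Proof. by move=> /exp_le/andP[-> _]; rewrite gerBl expR_ge0. Qed.

Let exp2_le s : 0 < s -> 0 <= expR (- s) - 1 + s <= s.
Proof.
move=> s0; have := expR_ge1Dx (- s) => h; apply/andP; split; first by lra.
by have /andP[h1 _] := exp_le s0; lra.
Qed.

Let exp2_le_sqr s : 0 < s -> expR (- s) - 1 + s <= s ^+ 2.
Proof.
move=> s0; have [|x /andP[x0 xs] E] := @mean_value R
    (fun x => expR (- x) - 1 + x) (fun x => 1 - expR (- x)) 0 s (ltW s0).
  by move=> x _; derive_eq; ring.
move: E; rewrite oppr0 expR0 subrr !addr0 subr0 => ->.
rewrite expr2 ler_wpM2r ?(ltW s0)//; apply: le_trans xs.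
have := expR_ge1Dx (- x); lra.
Qed.

(** The improper integral over the half line of [s ^ (- a - 1) (1 - cos s)] is
    expressed by the limits of an antiderivative. *)
Definition mellin_primitive a (P : R -> R) :=
  [/\ forall s, 0 < s -> is_derive s 1 P (s `^ (- a - 1) * (1 - cos s)),
      P s @[s --> 0^'+] --> 0 & P s @[s --> +oo] --> Gamma_cos a / a].

Let mulpow s p q : 0 < s -> s `^ p * s `^ q = s `^ (p + q).
Proof. by move=> s0; rewrite powRD// (gt_eqF s0) implybT. Qed.

Let mulpow1 s p : 0 < s -> s `^ p * s = s `^ (p + 1).
Proof. by move=> s0; rewrite -mulpow// powRr1// ltW. Qed.

Let mulpow2 s p : 0 < s -> s `^ p * s ^+ 2 = s `^ (p + 2).
Proof. by move=> s0; rewrite -mulpow// powR_mulrn// ltW. Qed.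

Let powR_cvg0' p : 0 < p -> s `^ p @[s --> 0^'+] --> (0 : R).
Proof. exact: powR_cvg0. Qed.

Let cvg0Mr (F : set_system R) {FF : Filter F} f k :
  f s @[s --> F] --> (0 : R) -> f s * k @[s --> F] --> (0 : R).
Proof. by move=> f0; rewrite -(mul0r k); apply: cvgMr_tmp. Qed.

Let cvg0Ml (F : set_system R) {FF : Filter F} f k :
  f s @[s --> F] --> (0 : R) -> k * f s @[s --> F] --> (0 : R).
Proof. by move=> f0; rewrite -(mulr0 k); apply: cvgMl_tmp. Qed.

Let cvg0D (F : set_system R) {FF : Filter F} f g :
  f s @[s --> F] --> (0 : R) -> g s @[s --> F] --> (0 : R) ->
  f s + g s @[s --> F] --> (0 : R).
Proof. by move=> f0 g0; rewrite -(addr0 0); apply: cvgD. Qed.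

Let cvg0B (F : set_system R) {FF : Filter F} f g :
  f s @[s --> F] --> (0 : R) -> g s @[s --> F] --> (0 : R) ->
  f s - g s @[s --> F] --> (0 : R).
Proof. by move=> f0 g0; rewrite -(subr0 0); apply: cvgB. Qed.

(** By [rot_re_0], it remains to integrate [s ^ (- a - 1) (1 - exp (- s))], which
    by parts reduces to the incomplete gamma function at [1 - a]. *)
Lemma mellin_lt1 a : 0 < a -> a < 1 -> exists P, mellin_primitive a P.
Proof.
move=> a0 a1; have c01 : 0 <= (0 : R) <= 1 by rewrite lexx ler01.
have p0 : 0 < 1 - a by lra.
have p1 : 1 - a <= 1 by lra.
pose C := cos (a * (pi / 2)) / a.
pose P s := rotated a 0 s
  + C * (lower_gamma (1 - a) s - s `^ (- a) * (1 - expR (- s))).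
have an0 : a != 0 by rewrite gt_eqF.
exists P; split.
- move=> s s0; have dr := deriv_rotated c01 (ltW a0) s0.
  have dg := deriv_lower_gamma p0 p1 s0.
  have dp : is_derive s 1 (fun x => x `^ (- a) * (1 - expR (- x)))
      (s `^ (- a) * expR (- s) - a * s `^ (- a - 1) * (1 - expR (- s))).
    by derive_eq; ring.
  apply: (deriv_eq (deriv_add dr (deriv_mul (deriv_cst C s) (deriv_add dg (deriv_opp dp))))).
  rewrite rot_re_pihalf rot_re_0 /C.
  by rewrite (_ : 1 - a - 1 = - a); [field|ring].
- apply: cvg0D.
    have h s (s0 : 0 < s) := rotated_near0 a c01 s0.
    apply: (cvg0_dominated near00 h).
    apply: cvg0Mr; rewrite subr0.
    apply: (@cvg_trans _ (s `^ (1 - a) @[s --> 0^'+])); last exact: powR_cvg0'.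
    apply: near_eq_cvg; near=> s.
    by rewrite mul1r mul0r addr0 mulpow1 ?[- a + 1]addrC//; near: s.
  apply: cvg0Ml; apply: cvg0B.
    exact: (lower_gamma_cvg0 p0 p1).
  apply: (cvg0_dominated near00 (g := fun s => s `^ (1 - a))); last exact: powR_cvg0'.
  move=> s s0; have /andP[h0 hs] := exp_le s0.
  rewrite ger0_norm ?mulr_ge0 ?powR_ge0//.
  by rewrite [1 - a]addrC -mulpow1// ler_wpM2l ?powR_ge0.
- have -> : Gamma_cos a / a = 0 + C * (Gamma_integral (1 - a) - 0).
    rewrite /Gamma_cos (lt_eqF a1) /Gamma p0 big_ord0 addr0 /C.
    by rewrite (_ : pi * a / 2 = a * (pi / 2)); field.
  apply: cvgD.
    have h s (s0 : 0 < s) := rotated_near_infty a c01 s0.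
    apply: (cvg0_dominated near0y h).
    apply: cvg0Mr; under eq_fun do rewrite mul0r addr0.
    by apply: cvg0Mr; apply: powR_cvgy; rewrite oppr_lt0.
  apply: cvgMl_tmp; apply: cvgB; first exact: (lower_gamma_cvgy p0 p1).
  apply: (cvg0_dominated near0y (g := fun s => s `^ (- a))); last first.
    by apply: powR_cvgy; rewrite oppr_lt0.
  move=> s s0; have /andP[h0 hs] := exp_le1 s0.
  rewrite ger0_norm ?mulr_ge0 ?powR_ge0//.
  by rewrite ler_piMr ?powR_ge0.
Unshelve. all: by end_near. Qed.

(** The real axis contributes the factor [cos (pi / 2) = 0]; the value of the
    integral comes from the arc at infinity. *)
Lemma mellin_eq1 : exists P, mellin_primitive (1 : R) P.
Proof.
have c01 : 0 <= (1 : R) <= 1 by rewrite lexx ler01.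
exists (rotated 1 1); split.
- move=> s s0; have dr := deriv_rotated c01 ler01 s0.
  apply: (deriv_eq dr); rewrite rot_re_pihalf rot_re_0 !mul1r cos_pihalf; ring.
- have h s (s0 : 0 < s) := rotated_near0 1 c01 s0.
    apply: (cvg0_dominated near00 h).
  apply: cvg0Mr; rewrite subrr.
  apply: (@cvg_trans _ (s `^ 1 @[s --> 0^'+])); last exact: powR_cvg0'.
  apply: near_eq_cvg; near=> s.
  have E : - 1 + 2 = 1 :> R by ring.
  by rewrite mul1r mul0r add0r mulpow2 ?E//; near: s.
- rewrite /Gamma_cos eqxx divr1; apply/subr_cvg0.
  have h s (s0 : 0 < s) := rotated_near_infty_critical erefl erefl s0.
  apply: (cvg0_dominated near0y h); apply: cvg0Mr.
  apply: cvg0Ml.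
  apply: (@cvg_trans _ (s `^ (- 1) @[s --> +oo])); last by apply: powR_cvgy; rewrite oppr_lt0.
  apply: near_eq_cvg; near=> s.
  by rewrite powR_inv1// ltW//; near: s.
Unshelve. all: by end_near. Qed.

(** The linear term of [1 - c z - exp (- z)], with [c = 1], makes the integral
    converge at [0]; two integrations by parts lead to the incomplete gamma
    function at [2 - a]. *)
Lemma mellin_gt1 a : 1 < a -> a < 2 -> exists P, mellin_primitive a P.
Proof.
move=> a1 a2; have c01 : 0 <= (1 : R) <= 1 by rewrite lexx ler01.
have a0 : 0 < a by lra.
have p0 : 0 < 2 - a by lra.
have p1 : 2 - a <= 1 by lra.
have an0 : a != 0 by rewrite gt_eqF.
have a1n0 : 1 - a != 0 by rewrite subr_eq0 lt_eqF.
pose C := cos (a * (pi / 2)) / a.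
pose D := C / (1 - a).
pose P s := rotated a 1 s
  + (C * (s `^ (- a) * (expR (- s) - 1 + s))
     + D * (lower_gamma (2 - a) s - s `^ (1 - a) * (1 - expR (- s)))).
exists P; split.
- move=> s s0; have dr := deriv_rotated c01 (ltW a0) s0.
  have dg := deriv_lower_gamma p0 p1 s0.
  have dp : is_derive s 1 (fun x => x `^ (- a) * (expR (- x) - 1 + x))
      (s `^ (- a) * (1 - expR (- s)) - a * s `^ (- a - 1) * (expR (- s) - 1 + s)).
    by derive_eq; ring.
  have dq : is_derive s 1 (fun x => x `^ (1 - a) * (1 - expR (- x)))
      (s `^ (1 - a) * expR (- s) + (1 - a) * s `^ (1 - a - 1) * (1 - expR (- s))).
    by derive_eq; ring.
  apply: (deriv_eq (deriv_add dr (deriv_add (deriv_mul (deriv_cst C s) dp)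
     (deriv_mul (deriv_cst D s) (deriv_add dg (deriv_opp dq)))))).
  rewrite rot_re_pihalf rot_re_0 /D /C.
  rewrite (_ : 2 - a - 1 = 1 - a); last by ring.
  rewrite (_ : 1 - a - 1 = - a); last by ring.
  by field; rewrite ?an0 ?a1n0.
- apply: cvg0D.
    have h s (s0 : 0 < s) := rotated_near0 a c01 s0.
    apply: (cvg0_dominated near00 h).
    apply: cvg0Mr; rewrite subrr.
    apply: (@cvg_trans _ (s `^ (2 - a) @[s --> 0^'+])); last exact: powR_cvg0'.
    apply: near_eq_cvg; near=> s.
    by rewrite mul1r mul0r add0r mulpow2 ?[- a + 2]addrC//; near: s.
  apply: cvg0D; apply: cvg0Ml.
    apply: (cvg0_dominated near00 (g := fun s => s `^ (2 - a))); last exact: powR_cvg0'.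
    move=> s s0; have /andP[h0 hs] := exp2_le s0.
    rewrite ger0_norm ?mulr_ge0 ?powR_ge0//.
    by rewrite [2 - a]addrC -mulpow2// ler_wpM2l ?powR_ge0// exp2_le_sqr.
  apply: cvg0B; first exact: (lower_gamma_cvg0 p0 p1).
  apply: (cvg0_dominated near00 (g := fun s => s `^ (2 - a))); last exact: powR_cvg0'.
  move=> s s0; have /andP[h0 hs] := exp_le s0.
  rewrite ger0_norm ?mulr_ge0 ?powR_ge0//.
  rewrite (_ : 2 - a = 1 - a + 1); last by ring.
  by rewrite -mulpow1// ler_wpM2l ?powR_ge0.
- have -> : Gamma_cos a / a = 0 + (C * 0 + D * (Gamma_integral (2 - a) - 0)).
    rewrite /Gamma_cos (gt_eqF a1) /Gamma subr_gt0 ltNge (ltW a1)/=.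
    have -> : Num.truncn (- (1 - a)) = 0%N.
      by apply: truncn_def; apply/andP; split; lra.
    rewrite big_ord_recl big_ord0 addr0 mulr1 /D /C.
    rewrite (_ : 1 - a + 1 = 2 - a); last by ring.
    by rewrite (_ : pi * a / 2 = a * (pi / 2)); field; rewrite ?an0 ?a1n0.
  apply: cvgD.
    have h s (s0 : 0 < s) := rotated_near_infty a c01 s0.
    apply: (cvg0_dominated near0y h).
    apply: cvg0Mr.
    apply: (@cvg_trans _ (s `^ (- a) * 2 + s `^ (1 - a) @[s --> +oo])).
      apply: near_eq_cvg; near=> s.
      by rewrite mul1r [RHS]mulrDr mulpow1 ?[- a + 1]addrC//; near: s.
    apply: cvg0D; last by apply: powR_cvgy; lra.
    by apply: cvg0Mr; apply: powR_cvgy; lra.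
  apply: cvgD; apply: cvgMl_tmp.
    apply: (cvg0_dominated near0y (g := fun s => s `^ (1 - a))); last first.
      by apply: powR_cvgy; lra.
    move=> s s0; have /andP[h0 hs] := exp2_le s0.
    rewrite ger0_norm ?mulr_ge0 ?powR_ge0//.
    by rewrite [1 - a]addrC -mulpow1// ler_wpM2l ?powR_ge0.
  apply: cvgB; first exact: (lower_gamma_cvgy p0 p1).
  apply: (cvg0_dominated near0y (g := fun s => s `^ (1 - a))); last first.
    by apply: powR_cvgy; lra.
  move=> s s0; have /andP[h0 hs] := exp_le1 s0.
  rewrite ger0_norm ?mulr_ge0 ?powR_ge0//.
  by rewrite ler_piMr ?powR_ge0.
Unshelve. all: by end_near. Qed.

Lemma mellin_primitive_exists a : 0 < a -> a < 2 -> exists P, mellin_primitive a P.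
Proof.
move=> a0 a2; have [a1|a1|->] := ltgtP a 1.
- exact: mellin_lt1.
- exact: mellin_gt1.
- exact: mellin_eq1.
Qed.

End MellinCosine.

(** * A one-dimensional series *)

Section OneDimensionalSum.
Context {R : realType}.
Implicit Types (a x eta : R) (n N : nat).

Definition cos_sum a N x : R :=
  \sum_(1 <= n < N) n%:R `^ (- 1 - a) * (1 - cos (n%:R * x)).

Definition power_sum a N : R := \sum_(1 <= n < N) n%:R `^ (- 1 - a).

Definition power_tail a N : R := limn (power_sum a) - power_sum a N.

Lemma power_sum_nondecreasing a : nondecreasing_seq (power_sum a).
Proof.
apply/nondecreasing_seqP => -[|N]; first by rewrite /power_sum !big_geq.
by rewrite /power_sum [leRHS]big_nat_recr//= lerDl powR_ge0.
Qed.

Lemma power_sum_is_cvg a : 0 < a -> cvgn (power_sum a).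
Proof.
move=> a0; apply: nondecreasing_is_cvgn; first exact: power_sum_nondecreasing.
by exists (1 + a^-1) => _ [N _ <-]; exact: power_sum_le.
Qed.

Lemma power_tail_cvg0 a : 0 < a -> power_tail a N @[N --> \oo] --> 0.
Proof.
move=> a0; rewrite -(subrr (limn (power_sum a))).
by apply: cvgB; [exact: cvg_cst|exact: power_sum_is_cvg].
Qed.

(** Because [1 - cos] is bounded, this is uniform in [x]: the number of terms may
    be chosen after [x], of an order larger than [1 / x]. *)
Lemma cos_sum_tail a x N M : 0 < a -> (0 < N)%N -> (N <= M)%N ->
  `|cos_sum a M x - cos_sum a N x| <= 2 * power_tail a N.
Proof.
move=> a0 N0 NM; rewrite /cos_sum (big_cat_nat N0 NM)/= addrAC subrr add0r.
apply: (@le_trans _ _ (\sum_(N <= n < M) 2 * n%:R `^ (- 1 - a))).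
  apply: le_trans (ler_norm_sum _ _ _) _; apply: ler_sum => n _.
  rewrite normrM ger0_norm ?powR_ge0// mulrC ler_wpM2r ?powR_ge0//.
  by rewrite ger0_norm ?one_sub_cos_ge0// one_sub_cos_le2.
rewrite -mulr_sumr ler_pM2l//.
have -> : \sum_(N <= n < M) n%:R `^ (- 1 - a) = power_sum a M - power_sum a N.
  by rewrite /power_sum (big_cat_nat N0 NM)/= addrAC subrr add0r.
rewrite lerD2r; apply: nondecreasing_cvgn_le; first exact: power_sum_nondecreasing.
exact: power_sum_is_cvg.
Qed.

Let kernel a s : R := s `^ (- a - 1) * (1 - cos s).

(** [xi] is the point of the cell [[n x, (n + 1) x]] provided by the mean value
    theorem.  The two members of the minimum come from [1 - cos y <= y ^ 2 / 2]
    and from the variation of the kernel over the cell. *)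
Let kernel_cell a x xi n : 0 < a -> a < 2 -> 0 < x -> (0 < n)%N ->
    n%:R * x <= xi <= n.+1%:R * x ->
  `|n%:R `^ (- 1 - a) * (1 - cos (n%:R * x)) - x `^ a * (kernel a xi * x)|
  <= 6 * (n%:R `^ (- 1 - a) * Num.min ((n%:R * x) ^+ 2) (x + n%:R^-1)).
Proof.
move=> a0 a2 x0 n0 /andP[nx xn].
have nR0 : 0 < n%:R :> R by rewrite ltr0n.
have n1 : 1 <= n%:R :> R by rewrite ler1n.
have nx0 : 0 < n%:R * x by rewrite mulr_gt0.
have xi0 : 0 < xi by exact: lt_le_trans nx.
have nS : n.+1%:R = n%:R + 1 :> R by rewrite -natr1.
pose y := n%:R * x / xi.
have y1 : y <= 1 by rewrite ler_pdivrMr// mul1r.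
have y0 : 0 < y by rewrite divr_gt0.
have E : x `^ a * (kernel a xi * x)
    = n%:R `^ (- 1 - a) * (y `^ (1 + a) * (1 - cos xi)).
  have X : x `^ a * x = x `^ (1 + a).
    by rewrite addrC powRD ?(gt_eqF x0) ?implybT// powRr1// ltW.
  rewrite /kernel [LHS](_ : _ = (x `^ a * x) * xi `^ (- a - 1) * (1 - cos xi)); last by ring.
  rewrite X mulrA; congr (_ * _).
  rewrite /y powRM ?invr_ge0 ?(ltW nx0) ?(ltW xi0)// powRM ?(ltW nR0) ?(ltW x0)//.
  rewrite -powR_inv1 ?(ltW xi0)// -powRrM mulN1r.
  rewrite (_ : - 1 - a = - (1 + a)); last by ring.
  rewrite (_ : - a - 1 = - (1 + a)); last by ring.
  by rewrite !powRN; field; rewrite !gt_eqF ?powR_gt0.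
rewrite E -mulrBr normrM ger0_norm ?powR_ge0// mulrCA ler_wpM2l ?powR_ge0//.
have Y1 : y `^ (1 + a) <= 1.
  apply: (@le_trans _ _ (y `^ 0)); last by rewrite powRr0.
  by apply: ger_powR; [rewrite y0|lra].
have Y0 : 0 <= y `^ (1 + a) by exact: powR_ge0.
have YV : 1 - 3 * n%:R^-1 <= y `^ (1 + a).
  have u1 : n%:R / (n%:R + 1) <= y.
    rewrite /y ler_pdivlMr// mulrAC ler_pdivrMr ?addr_gt0//.
    by rewrite -mulrA ler_pM2l// mulrC -nS.
  have u0 : 0 < n%:R / (n%:R + 1) :> R by rewrite divr_gt0// addr_gt0.
  apply: (@le_trans _ _ (y `^ 3%:R)); last by apply: ger_powR; [rewrite y0|lra].
  rewrite powR_mulrn ?(ltW y0)//.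
  apply: (@le_trans _ _ ((n%:R / (n%:R + 1)) ^+ 3)); last first.
    by apply: lerXn2r; rewrite ?nnegrE ?(ltW u0) ?(ltW y0).
  have -> : n%:R / (n%:R + 1) = 1 - (n%:R + 1)^-1 :> R.
    by field; rewrite gt_eqF// addr_gt0.
  have v0 : 0 < (n%:R + 1)^-1 :> R by rewrite invr_gt0 addr_gt0.
  have v1 : (n%:R + 1)^-1 <= n%:R^-1 :> R by rewrite lef_pV2 ?posrE ?addr_gt0// lerDl.
  have v2 : (n%:R + 1)^-1 <= 1 :> R by rewrite invf_le1 ?addr_gt0// lerDr.
  by move: v0 v1 v2; move: (_ + 1)^-1 (n%:R^-1) => v z v0 v1 v2; nra.
have c0 := one_sub_cos_ge0 xi; have c2 := one_sub_cos_le2 xi.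
have d0 := one_sub_cos_ge0 (n%:R * x).
rewrite minr_pMr// le_min; apply/andP; split.
  have cx := one_sub_cos_le xi; have dx := one_sub_cos_le (n%:R * x).
  have xin : xi <= 2 * (n%:R * x).
    apply: le_trans xn _; rewrite nS mulrDl mul1r; have : x <= n%:R * x; last by lra.
    by rewrite ler_peMl// ltW.
  have xi2 : xi ^+ 2 <= 4 * (n%:R * x) ^+ 2.
    have -> : 4 * (n%:R * x) ^+ 2 = (2 * (n%:R * x)) ^+ 2 by ring.
    by apply: lerXn2r; rewrite ?nnegrE ?mulr_ge0// ltW.
  have sq0 := sqr_ge0 (n%:R * x).
  rewrite ler_norml; apply/andP; split; nra.
have cl := cos_lip xi (n%:R * x).
have : `|xi - n%:R * x| <= x.
  by rewrite ger0_norm ?subr_ge0// lerBlDr addrC -[X in _ + X]mul1r -mulrDl -nS.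
move=> /(le_trans cl); rewrite ler_norml => /andP[l1 l2].
have nV : 0 < n%:R^-1 :> R by rewrite invr_gt0.
rewrite ler_norml; apply/andP; split; nra.
Qed.

Let norm_sumB (f g : nat -> R) N :
  `|\sum_(1 <= n < N) f n - \sum_(1 <= n < N) g n| <= \sum_(1 <= n < N) `|f n - g n|.
Proof. by rewrite -sumrB; exact: ler_norm_sum. Qed.

(** The series is a Riemann sum of mesh [x] for the integral of the kernel, and
    [sum_small] absorbs the error of every cell. *)
Lemma cos_sum_asymp a eta : 0 < a -> a < 2 -> 0 < eta ->
  exists2 rho : R, 0 < rho & forall x N, (0 < N)%N -> `|x| < rho ->
    `|cos_sum a N x - Gamma_cos a / a * `|x| `^ a|
    <= eta * `|x| `^ a + 2 * power_tail a N.
Proof.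
move=> a0 a2 eta0; have [P [dP /cvgrPdist_le P0 /cvgrPdist_le Py]] := mellin_primitive_exists a0 a2.
have eta3 : 0 < eta / 3 by rewrite divr_gt0.
have [rho1 rho1_gt0 small] := sum_small a0 a2 (ler0n R 6) eta3.
have [rho2 /= rho2_gt0 near0] := P0 _ eta3.
exists (Num.min rho1 rho2) => [|x N N0]; first by rewrite lt_min rho1_gt0.
have tail_ge0 : 0 <= power_tail a N.
  rewrite subr_ge0; apply: nondecreasing_cvgn_le; first exact: power_sum_nondecreasing.
  exact: power_sum_is_cvg.
have -> : cos_sum a N x = cos_sum a N `|x|.
  apply: eq_bigr => n _; congr (_ * (1 - _)).
  by case: (ger0P x) => // _; rewrite mulrN cosN.
have [->|x0] := eqVneq x 0.
  rewrite normr0 powR0 ?(gt_eqF a0)// !mulr0 subr0 add0r => _.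
  rewrite /cos_sum big1 ?normr0 ?mulr_ge0// => n _.
  by rewrite mulr0 cos0 subrr mulr0.
have {x0} x0 : 0 < `|x| by rewrite normr_gt0.
move: {x} (`|x|) x0 => x x0; rewrite lt_min => /andP[x1 x2].
have [A [_ HA]] := Py _ eta3.
pose M := maxn N (Num.truncn (A / x)).+1.
have AM : A < M%:R * x.
  rewrite -ltr_pdivrMr//; apply: lt_le_trans (truncnS_gt _) _.
  by rewrite ler_nat leq_maxr.
have M0 : (0 < M)%N by rewrite leq_max orbT.
have tail : `|cos_sum a M x - cos_sum a N x| <= 2 * power_tail a N.
  by apply: cos_sum_tail => //; exact: leq_maxl.
have H1 : `|cos_sum a M x - x `^ a * (P (M%:R * x) - P x)| <= eta / 3 * x `^ a.
  have -> : P (M%:R * x) - P x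
      = \sum_(1 <= n < M) (P (n.+1%:R * x) - P (n%:R * x)).
    by rewrite (telescope_sumr (fun n => P (n%:R * x)))// mul1r.
  rewrite mulr_sumr; apply: le_trans (norm_sumB _ _ _) _.
  apply: small => // n n0.
  have [||xi nxi ->] := @mean_value R P (fun s => s `^ (- a - 1) * (1 - cos s))
      (n%:R * x) (n.+1%:R * x).
  - by rewrite ler_pM2r// ler_nat.
  - by move=> s /andP[ns _]; apply: dP; apply: lt_le_trans ns; rewrite mulr_gt0 ?ltr0n.
  rewrite -mulrBl -natrB// subSnn mul1r.
  exact: (kernel_cell a0 a2 x0 n0 nxi).
have H2 : `|P x| <= eta / 3.
  rewrite -normrN -sub0r; apply: near0 => //=.
  by rewrite sub0r normrN ger0_norm// ltW.
have H3 : `|Gamma_cos a / a - P (M%:R * x)| <= eta / 3 by exact: HA.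
have xa0 : 0 <= x `^ a by exact: powR_ge0.
have -> : cos_sum a N x - Gamma_cos a / a * x `^ a
   = (cos_sum a N x - cos_sum a M x)
   + ((cos_sum a M x - x `^ a * (P (M%:R * x) - P x))
   + x `^ a * ((P (M%:R * x) - Gamma_cos a / a) - P x)) by ring.
apply: le_trans (ler_normD _ _) _; rewrite addrC; apply: lerD; last by rewrite distrC.
apply: le_trans (ler_normD _ _) _; rewrite normrM (ger0_norm xa0).
have : `|P (M%:R * x) - Gamma_cos a / a - P x| <= eta / 3 + eta / 3.
  by apply: le_trans (ler_normB _ _) _; rewrite distrC; exact: lerD.
move=> H4; have := ler_wpM2l xa0 H4; lra.
Qed.

End OneDimensionalSum.

(** * Integrals over boxes and the function A *)

Section Antiderivative.
Context {R : realType}.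
Implicit Types (p : R -> R) (x y : R).

Local Notation mu := (@lebesgue_measure R).

(** The integral from [- B] is an antiderivative only on the right of [- B]; the
    normalisation at [0] makes the choices of [B] agree. *)
Lemma continuous_antiderivative p : continuous p ->
  exists F : R -> R, forall x, is_derive x 1 F (p x).
Proof.
move=> cp; pose G B x := \int[mu]_(t in `[- B, x]) p t.
have dG B x : - B < x -> is_derive x 1 (G B) (p x).
  move=> Bx; have x1 : x < x + 1 by rewrite ltrDl.
  have [dv fE] := continuous_FTC1_closed x1 (continuous_integrable _ _ cp) Bx (cp x).
  by apply: deriv_eq; [exact: derivableP|rewrite -derive1E].
have indep B B' x : `|x| < B -> `|x| < B' -> G B x - G B 0 = G B' x - G B' 0.
  move=> xB xB'; pose D y := G B y - G B' y.
  have dD y : - `|x| <= y -> is_derive y 1 D 0.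
    move=> xy; have h1 : - B < y by apply: lt_le_trans xy; rewrite ltrN2.
    have h2 : - B' < y by apply: lt_le_trans xy; rewrite ltrN2.
    by apply: (deriv_eq (deriv_add (dG _ _ h1) (deriv_opp (dG _ _ h2)))); rewrite subrr.
  have : D x = D 0.
    have [x0|/ltW x0] := leP 0 x.
      have [|c _] := @mean_value R D (fun _ => 0) 0 x x0.
        by move=> y /andP[y0 _]; apply: dD; apply: le_trans y0; rewrite oppr_le0.
      by rewrite mul0r => /eqP; rewrite subr_eq0 => /eqP.
    have [|c _] := @mean_value R D (fun _ => 0) x 0 x0.
      by move=> y /andP[xy _]; apply: dD; rewrite ler0_norm// opprK.
    by rewrite mul0r => /eqP; rewrite subr_eq0 => /eqP.
  by rewrite /D; lra.
exists (fun x => G (`|x| + 1) x - G (`|x| + 1) 0) => x0.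
pose B := `|x0| + 2.
apply: (@deriv_near R (fun x => G B x - G B 0)); last first.
  have h : - B < x0.
    by rewrite /B ltrNl; apply: le_lt_trans (ler_norm _) _; rewrite normrN ltrDl.
  by apply: (deriv_eq (deriv_add (dG _ _ h) (deriv_cst (- G B 0) x0))); rewrite addr0.
near=> x; apply: indep; last by rewrite ltrDl.
have : `|x0 - x| < 1 by near: x; exact: (@cvgr_dist_lt _ _ _ _ _ id).
by have := ler_distD x0 x 0; rewrite !subr0 distrC /B; lra.
Unshelve. all: by end_near. Qed.

End Antiderivative.

Section MeanOperator.
Context {R : realType}.
Implicit Types (p q : R -> R) (a b x y : R) (s : seq R).

Local Notation mu := (@lebesgue_measure R).

(** The substitution [e = a u] removes the division by [a] from the formula for
    [A], and with it the singularity at [a = 0]. *)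
Definition seg_integral a p x : R := \int[mu]_(u in `[-1, 1]) p (x + a * u).

Definition box_integral s p : R -> R := foldl (fun q a => seg_integral a q) p s.

Let continuous_affine p a x : continuous p -> continuous (fun u => p (x + a * u)).
Proof.
move=> cp u; apply: (@continuous_comp _ _ _ (fun u : R => x + a * u) p); last exact: cp.
by apply: deriv_continuous; derive_tac.
Qed.

Lemma seg_integral_FTC p F a x : continuous p -> (forall y : R, is_derive y 1 F (p y)) ->
  a * seg_integral a p x = F (x + a) - F (x - a).
Proof.
move=> cp dF; have [->|a0] := eqVneq a 0; first by rewrite mul0r addr0 subr0 subrr.
have dFa (u : R) : is_derive u 1 (fun u : R => F (x + a * u) / a) (p (x + a * u)).
  have h : is_derive u 1 (fun u : R => x + a * u) a by derive_eq; ring.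
  have hF := @deriv_chain R F (fun u => x + a * u) u _ _ (dF _) h.
  apply: (deriv_eq (deriv_mul hF (deriv_cst a^-1 u))).
  by rewrite mulr0 add0r mulrC mulfK.
have lt11 : -1 < 1 :> R by lra.
rewrite /seg_integral (integral_deriv lt11 (@continuous_affine p a x cp) dFa).
by rewrite mulrN mulr1; field.
Qed.

Lemma seg_integral0 p x : seg_integral 0 p x = 2 * p x.
Proof.
rewrite /seg_integral; under eq_Rintegral do rewrite mul0r addr0.
by rewrite integral_const; lra.
Qed.

Lemma seg_integralN p a x : continuous p -> seg_integral (- a) p x = seg_integral a p x.
Proof.
move=> cp; have [->|a0] := eqVneq a 0; first by rewrite oppr0.
have [F dF] := continuous_antiderivative cp.
have h1 := seg_integral_FTC a x cp dF; have h2 := seg_integral_FTC (- a) x cp dF.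
by apply: (mulfI a0); rewrite h1; move: h2; rewrite opprK mulNr; lra.
Qed.

Lemma seg_integral_continuous p a : continuous p -> continuous (seg_integral a p).
Proof.
move=> cp; have [->|a0] := eqVneq a 0.
  rewrite (_ : seg_integral 0 p = fun x => 2 * p x); last first.
    by apply/funext => x; rewrite seg_integral0.
  by move=> x; apply: cvgMl_tmp; exact: cp.
have [F dF] := continuous_antiderivative cp.
rewrite (_ : seg_integral a p = fun x => (F (x + a) - F (x - a)) / a); last first.
  by apply/funext => x; rewrite -(seg_integral_FTC a x cp dF) mulrC mulKf.
have sh (b x : R) : is_derive x 1 (fun x => F (x + b)) (p (x + b)).
  have h : is_derive x 1 (fun x : R => x + b) 1 by derive_eq; ring.
  by have hF := @deriv_chain R F (fun x => x + b) x _ _ (dF _) h; apply: (deriv_eq hF); rewrite mulr1.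
move=> x; apply: deriv_continuous.
Qed.

Lemma seg_integralD p q a x : continuous p -> continuous q ->
  seg_integral a (fun y => p y + q y) x = seg_integral a p x + seg_integral a q x.
Proof.
by move=> cp cq; rewrite /seg_integral RintegralD//;
  apply: continuous_integrable; exact: continuous_affine.
Qed.

Lemma seg_integralZ p (k : R) a x : continuous p ->
  seg_integral a (fun y => k * p y) x = k * seg_integral a p x.
Proof.
move=> cp; rewrite /seg_integral RintegralZl//.
by apply: continuous_integrable; exact: continuous_affine.
Qed.

Let continuousD p q : continuous p -> continuous q -> continuous (fun x => p x + q x).
Proof. by move=> cp cq x; apply: cvgD; [exact: cp|exact: cq]. Qed.

Let continuousZ p (k : R) : continuous p -> continuous (fun x => k * p x).
Proof. by move=> cp x; apply: cvgMl_tmp; exact: cp. Qed.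

Lemma box_integralD s p q x : continuous p -> continuous q ->
  box_integral s (fun y => p y + q y) x = box_integral s p x + box_integral s q x.
Proof.
elim: s p q => [|a s ih] p q cp cq //=.
rewrite -ih; [|exact: seg_integral_continuous..].
by congr box_integral; apply/funext => y; exact: seg_integralD.
Qed.

Lemma box_integralZ s p (k : R) x : continuous p ->
  box_integral s (fun y => k * p y) x = k * box_integral s p x.
Proof.
elim: s p => [|a s ih] p cp //=; rewrite -ih; last exact: seg_integral_continuous.
by congr box_integral; apply/funext => y; exact: seg_integralZ.
Qed.

Lemma box_integral_sum s (c : nat -> R) (f : nat -> R -> R) N x :
  (forall n, continuous (f n)) ->
  box_integral s (fun y => \sum_(1 <= n < N) c n * f n y) x
  = \sum_(1 <= n < N) c n * box_integral s (f n) x.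
Proof.
move=> cf; have c0 : continuous (fun _ : R => 0 : R) by move=> y; exact: cvg_cst.
have z0 : box_integral s (fun _ => 0) x = 0.
  rewrite -[RHS](mul0r (box_integral s (fun _ => 0) x)) -box_integralZ//.
  by congr box_integral; apply/funext => y; rewrite mul0r.
have cS M : continuous (fun y => \sum_(1 <= n < M) c n * f n y).
  elim: M => [|[|M] ih].
  - by rewrite (_ : (fun _ => _) = fun _ => 0)//; apply/funext => y; rewrite big_geq.
  - by rewrite (_ : (fun _ => _) = fun _ => 0)//; apply/funext => y; rewrite big_geq.
  - rewrite (_ : (fun _ => _) = fun y => \sum_(1 <= n < M.+1) c n * f n y + c M.+1 * f M.+1 y).
      by apply: continuousD => //; exact: continuousZ.
    by apply/funext => y; rewrite big_nat_recr.
elim: N => [|[|N] ih].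
- rewrite big_geq// -[RHS]z0; congr box_integral; apply/funext => y; exact: big_geq.
- rewrite big_geq// -[RHS]z0; congr box_integral; apply/funext => y; exact: big_geq.
- rewrite big_nat_recr//= -ih -box_integralZ// -box_integralD//; last exact: continuousZ.
  by congr box_integral; apply/funext => y; rewrite big_nat_recr.
Qed.

(** Every integration over [[-1, 1]] costs a factor [2] and moves the argument
    by at most the corresponding coordinate.  The two lists of coordinates are
    images of the same list, which pairs them off. *)
Lemma box_integral_close (T : Type) (I : seq T) (f g : T -> R) p q x y (e : R) :
  continuous p -> continuous q ->
  (forall x' y', `|x' - x| <= \sum_(i <- I) `|f i| ->
     `|x' - y'| <= `|x - y| + \sum_(i <- I) `|f i - g i| -> `|p x' - q y'| <= e) ->
  `|box_integral [seq f i | i <- I] p x - box_integral [seq g i | i <- I] q y|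
  <= 2 ^+ size I * e.
Proof.
elim: I p q e => [|i I ih] p q e cp cq pq /=.
  by rewrite expr0 mul1r; apply: pq; rewrite !big_nil ?addr0 ?subrr ?normr0.
rewrite exprSr -mulrA; apply: ih; [exact: seg_integral_continuous..|].
move=> x' y' xx' xy'; rewrite /seg_integral -RintegralB//;
  [|exact/continuous_integrable/continuous_affine..].
have := @norm_integral_le R (fun u => p (x' + f i * u) - q (y' + g i * u)) (-1) 1 e.
rewrite opprK (_ : 1 + 1 = 2 :> R)// [e * 2]mulrC; apply; first by lra.
  by move=> u; apply: cvgB; exact: continuous_affine.
move=> u u1; have {}u1 : `|u| <= 1 by rewrite ler_norml.
have bnd (k : R) : `|k * u| <= `|k| by rewrite normrM ler_piMr.
apply: pq; rewrite !big_cons.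
  rewrite (_ : _ - x = f i * u + (x' - x)); last by ring.
  by apply: le_trans (ler_normD _ _) _; exact: lerD.
rewrite (_ : _ - _ = (f i - g i) * u + (x' - y')); last by ring.
apply: le_trans (ler_normD _ _) _; rewrite addrCA; exact: lerD.
Qed.

Lemma box_integral_dist s p q x (e : R) : continuous p -> continuous q ->
  (forall y, `|y - x| <= \sum_(a <- s) `|a| -> `|p y - q y| <= e) ->
  `|box_integral s p x - box_integral s q x| <= 2 ^+ size s * e.
Proof.
move=> cp cq pq; rewrite -[s in box_integral s p]map_id -[s in box_integral s q]map_id.
apply: box_integral_close => // y z yx.
rewrite subrr normr0 add0r big1 => [|a _]; last by rewrite subrr normr0.
by rewrite normr_le0 subr_eq0 => /eqP <-; exact: pq.
Qed.

(** The integral of [cos (y u)] over [[-1, 1]]. *)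
Definition seg_cos y : R := if y == 0 then 2 else 2 * sin y / y.

Lemma seg_integral_cos (k : R) a x :
  seg_integral a (fun y => cos (k * y)) x = seg_cos (k * a) * cos (k * x).
Proof.
have ccos : continuous (fun y : R => cos (k * y)).
  by move=> y; apply: deriv_continuous; derive_tac.
rewrite /seg_cos; have [ka|] := eqVneq (k * a) 0.
  rewrite /seg_integral; under eq_Rintegral => u _.
    rewrite mulrDr mulrA ka mul0r addr0; over.
  by rewrite integral_const; lra.
rewrite mulf_eq0 negb_or => /andP[k0 a0].
have dF y : is_derive y 1 (fun y : R => sin (k * y) / k) (cos (k * y)).
  by derive_eq; field.
apply: (mulfI a0); rewrite (seg_integral_FTC a x ccos dF) mulrDr mulrBr sinD sinB.
by field; rewrite k0 a0.
Qed.

Lemma box_integral_cos s (k : R) x :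
  box_integral s (fun y => cos (k * y)) x = cos (k * x) * \prod_(a <- s) seg_cos (k * a).
Proof.
have ccos : continuous (fun y : R => cos (k * y)).
  by move=> y; apply: deriv_continuous; derive_tac.
elim: s => [|a s ih] /=; first by rewrite big_nil mulr1.
rewrite (_ : seg_integral a _ = fun y => seg_cos (k * a) * cos (k * y)); last first.
  by apply/funext => y; exact: seg_integral_cos.
by rewrite box_integralZ// ih big_cons; ring.
Qed.

Lemma box_integral_cst s (c : R) x : box_integral s (fun _ => c) x = 2 ^+ size s * c.
Proof.
have c1 : continuous (fun y : R => cos (0 * y)).
  by move=> y; apply: deriv_continuous; derive_tac.
transitivity (box_integral s (fun y => c * cos (0 * y)) x).
  by congr box_integral; apply/funext => y; rewrite mul0r cos0 mulr1.
rewrite box_integralZ// box_integral_cos mul0r cos0 mul1r mulrC; congr (_ * _).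
under eq_bigr do rewrite mul0r /seg_cos eqxx.
by rewrite big_const_seq count_predT iter_mulr_1.
Qed.

Lemma oriented_integral_seg_integral p a x : continuous p ->
  oriented_integral (- a) a (fun e => p (e + x)) = a * seg_integral a p x.
Proof.
move=> cp; have [F dF] := continuous_antiderivative cp.
have cpx : continuous (fun e => p (e + x)).
  move=> e; apply: (@continuous_comp _ _ _ (fun e : R => e + x) p); last exact: cp.
  by apply: deriv_continuous; derive_tac.
have dFx (e : R) : is_derive e 1 (fun e => F (e + x)) (p (e + x)).
  have h : is_derive e 1 (fun e : R => e + x) 1 by derive_eq; ring.
  by have hF := @deriv_chain R F (fun e => e + x) e _ _ (dF _) h; apply: (deriv_eq hF); rewrite mulr1.
rewrite (seg_integral_FTC a x cp dF) /oriented_integral.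
have [a0|a0|->] := ltgtP a 0.
- have h : a < - a by lra.
  by rewrite leNgt h/= (integral_deriv h cpx dFx) opprB ![x + _]addrC.
- have h : - a < a by lra.
  by rewrite (ltW h) (integral_deriv h cpx dFx) ![x + _]addrC.
- by rewrite oppr0 lexx set_itv1 Rintegral_set1 addr0 subrr.
Qed.

(** The oriented integrals account for negative entries of [s]. *)
Lemma iterated_integral_box_integral s p x : continuous p ->
  iterated_integral s (fun v => p (x + \sum_(e <- v) e))
  = (\prod_(a <- s) a) * box_integral s p x.
Proof.
elim: s p => [|a s ih] p cp /=; first by rewrite !big_nil addr0 mul1r.
have cZ : continuous (fun y => a * seg_integral a p y).
  by apply: continuousZ; exact: seg_integral_continuous.
rewrite (_ : (fun v => _) = fun v => a * seg_integral a p (x + \sum_(e <- v) e)).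
  rewrite (ih _ cZ) box_integralZ; last exact: seg_integral_continuous.
  by rewrite big_cons; ring.
apply/funext => v; rewrite -oriented_integral_seg_integral//; congr oriented_integral.
by apply/funext => e; rewrite big_cons; congr p; ring.
Qed.

End MeanOperator.

Section ExtendedA.
Context {R : realType}.
Variable d : nat.
Variable alpha : R.
Hypothesis alpha_gt0 : 0 < alpha.
Implicit Types (theta : 'rV[R]_d) (x y : R).

Lemma abs_powR_continuous : continuous (fun x : R => `|x| `^ alpha).
Proof.
move=> x; have [->|x0] := eqVneq x 0.
  apply/cvgrPdist_lt => e e0; rewrite normr0 powR0 ?gt_eqF//; near=> y.
  rewrite sub0r normrN ger0_norm ?powR_ge0//.
  have ye : `|y| < e `^ alpha^-1.
    rewrite -normrN -sub0r; near: y; apply: (@cvgr_dist_lt _ _ _ _ _ id) => //.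
    exact: powR_gt0.
  have -> : e = (e `^ alpha^-1) `^ alpha.
    by rewrite -powRrM mulVf ?gt_eqF// powRr1// ltW.
  by apply: gt0_ltr_powR; rewrite ?nnegrE ?powR_ge0.
apply: (@continuous_comp _ _ _ (fun x : R => `|x|) (fun x => x `^ alpha)).
  exact: norm_continuous.
by apply: deriv_continuous; apply: deriv_powR; rewrite normr_gt0.
Unshelve. all: by end_near. Qed.

(** Only one of the two points is confined to the segment. *)
Lemma uniformly_continuous_segment (p : R -> R) (B e : R) : continuous p -> 0 < e ->
  exists2 r : R, 0 < r & forall x y, `|x| <= B -> `|x - y| <= r -> `|p x - p y| <= e.
Proof.
move=> cp e0; have /compact_near_coveringP cov := @segment_compact R (- B) B.
pose P (r x : R) := forall y, `|x - y| <= r -> `|p x - p y| <= e.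
have /cov H : forall x, `[- B, B]%classic x -> \forall x' \near x & r \near 0^'+, P r x'.
  move=> x _; have e2 : 0 < e / 2 by rewrite divr_gt0.
  have [r /= r0 Hr] := (cvgrPdist_lt _ _).1 (cp x) _ e2.
  have r2 : 0 < r / 2 by rewrite divr_gt0.
  exists (ball x (r / 2), [set s | s < r / 2]) => /=.
    by split; [exact: nbhsx_ballx|exact: nbhs_right_lt].
  move=> [x' s] /= [xx' sr] y x'y; move: xx'; rewrite /ball/= => xx'.
  have h1 : `|p x - p x'| < e / 2 by apply: Hr => /=; lra.
  have h2 : `|p x - p y| < e / 2.
    apply: Hr => /=; rewrite (_ : x - y = (x - x') + (x' - y)); last by ring.
    by apply: le_lt_trans (ler_normD _ _) _; lra.
  rewrite (_ : _ - _ = (p x - p y) - (p x - p x')); last by ring.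
  by apply: le_trans (ler_normB _ _) _; lra.
have : \forall r \near 0^'+, 0 < r /\ `[- B, B]%classic `<=` P r.
  by apply: filterI; [exact: nbhs_right_gt|exact: H].
move=> /filter_ex[r [r0 Pr]]; exists r => // x y xB; apply: Pr.
by rewrite /= in_itv/= -ler_norml.
Qed.

Definition A_ext theta : R :=
  \sum_(j < d) box_integral (other_coords theta j) (fun x => `|x| `^ alpha) (theta 0 j).

Lemma A_formulaE theta : nonvanishing theta -> A_formula alpha theta = A_ext theta.
Proof.
move=> nz; apply: eq_bigr => j _.
rewrite (iterated_integral_box_integral _ _ abs_powR_continuous) mulrA div1r mulVf ?mul1r//.
rewrite prodf_seq_neq0; apply/allP => a /mapP[i _ ->] /=; exact: nz.
Qed.

Lemma box_integral_coords_cvg theta j :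
  box_integral (other_coords eta j) (fun x => `|x| `^ alpha) (eta 0 j) @[eta --> theta]
  --> box_integral (other_coords theta j) (fun x => `|x| `^ alpha) (theta 0 j).
Proof.
apply/(@cvgrPdist_le _ _ _ _ (nbhs_filter theta)) => e e0.
pose I := [seq i <- enum 'I_d | i != j].
pose B := `|theta 0 j| + \sum_(i <- I) `|theta 0 i|.
have e2 : 0 < e / 2 ^+ size I by rewrite divr_gt0// exprn_gt0.
have [r r0 Hr] := uniformly_continuous_segment B abs_powR_continuous e2.
have rd : 0 < r / d.+1%:R by rewrite divr_gt0.
near=> eta.
have close i : `|theta 0 i - eta 0 i| <= r / d.+1%:R.
  have : `|theta - eta| < r / d.+1%:R.
    by near: eta; apply: (@cvgr_dist_lt _ _ _ _ _ id).
  move=> /ltW; apply: le_trans; rewrite (_ : _ - _ = (theta - eta) 0 i).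
    exact: norm_coord.
  by rewrite !mxE.
rewrite -[e](@divfK _ (2 ^+ size I)) ?expf_neq0// mulrC.
apply: box_integral_close; [exact: abs_powR_continuous..|] => x y xB xy.
apply: Hr.
  rewrite -(subrK (theta 0 j) x); apply: le_trans (ler_normD _ _) _.
  by rewrite addrC lerD2l.
apply: le_trans xy _.
apply: (@le_trans _ _ (r / d.+1%:R + \sum_(i <- I) r / d.+1%:R)).
  by apply: lerD => //; apply: ler_sum => i _.
rewrite big_const_seq count_predT iter_addr_0 -mulrS -[leRHS](@divfK _ d.+1%:R) ?pnatr_eq0//.
rewrite [leRHS]mulr_natr; apply: ler_wpMn2l; first exact: ltW.
rewrite ltnS size_filter; apply: leq_trans (count_size _ _) _.
by rewrite size_enum_ord.
Unshelve. all: by end_near. Qed.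

Lemma A_ext_continuous : continuous A_ext.
Proof.
rewrite /A_ext; apply: continuous_big => [|j _ theta]; first exact: add_continuous.
exact: box_integral_coords_cvg.
Qed.

Lemma nonvanishing_dense theta : ProperFilter (within (@nonvanishing R d) (nbhs theta)).
Proof.
apply: within_nbhs_proper => B /nbhs_ballP[r /= r0 rB].
exists (\row_j if theta 0 j == 0 then r / 2 else theta 0 j); split.
  by move=> j; rewrite mxE; have [_|] := eqVneq (theta 0 j) 0 => //; rewrite gt_eqF// divr_gt0.
apply: rB; split => // i j; rewrite ord1 mxE.
have [->|_] := eqVneq (theta 0 j) 0; last exact: ballxx.
by rewrite /ball/= sub0r normrN ger0_norm; lra.
Qed.

Lemma AdE theta : Ad alpha theta = A_ext theta.
Proof.
rewrite /Ad; case: ifP => [/forallP nz|_]; first exact: A_formulaE.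
have PF := nonvanishing_dense theta.
apply: cvg_lim => //.
apply: (@cvg_trans _ (A_ext t @[t --> within (@nonvanishing R d) (nbhs theta)])).
  by apply: near_eq_cvg; near=> t; rewrite A_formulaE//; near: t; exact: withinT.
apply: cvg_trans (A_ext_continuous (x := theta)).
exact/cvg_app/cvg_within.
Unshelve. all: by end_near. Qed.

(** One of [x + a u] and [x - a u] is at least as far from [0] as [x] is. *)
Let seg_integral_ge_abs (p : R -> R) a x : continuous p -> (forall y, `|y| `^ alpha <= p y) ->
  `|x| `^ alpha <= seg_integral a p x.
Proof.
move=> cp pge.
have cs (b : R) : continuous (fun u : R => p (x + b * u)).
  move=> u; apply: (@continuous_comp _ _ _ (fun u : R => x + b * u) p); last exact: cp.
  by apply: deriv_continuous; derive_tac.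
have : 2 * (`|x| `^ alpha) <= seg_integral a p x + seg_integral (- a) p x.
  rewrite /seg_integral -RintegralD//; [|exact/continuous_integrable/cs..].
  have -> : 2 * (`|x| `^ alpha) = \int[lebesgue_measure]_(u in `[-1, 1]) (`|x| `^ alpha).
    by rewrite integral_const; lra.
  apply: le_Rintegral.
  - exact: measurable_itv.
  - by apply: continuous_integrable => u; exact: cvg_cst.
  - by apply: continuous_integrable => u; apply: cvgD; exact: cs.
  move=> u _; rewrite mulNr.
  have [h|h] := leP `|x| `|x + a * u|.
    apply: (@le_trans _ _ (p (x + a * u))).
      by apply: le_trans (pge _); apply: ge0_ler_powR; rewrite ?nnegrE ?(ltW alpha_gt0).
    by rewrite lerDl; apply: le_trans (pge _); exact: powR_ge0.
  have h' : `|x| <= `|x - a * u|.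
    by have := ler_normD (x + a * u) (x - a * u);
      rewrite (_ : _ + _ = 2 * x) ?normrM ?(@ger0_norm _ 2)//; [lra|ring].
  apply: (@le_trans _ _ (p (x - a * u))).
    by apply: le_trans (pge _); apply: ge0_ler_powR; rewrite ?nnegrE ?(ltW alpha_gt0).
  by rewrite lerDr; apply: le_trans (pge _); exact: powR_ge0.
by rewrite seg_integralN//; lra.
Qed.

Lemma box_integral_ge_abs s (p : R -> R) x : continuous p ->
  (forall y, `|y| `^ alpha <= p y) -> `|x| `^ alpha <= box_integral s p x.
Proof.
elim: s p => [|a s ih] p cp pge //=; apply: ih; first exact: seg_integral_continuous.
by move=> y; exact: seg_integral_ge_abs.
Qed.

(** The term of the coordinate of largest absolute value is enough. *)
Lemma A_ext_ge theta : (0 < d)%N -> `|theta| `^ alpha <= A_ext theta.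
Proof.
move=> d0; have [j ->] : exists j, `|theta| = `|theta 0 j|.
  have [t0|t0] := eqVneq `|theta| 0.
    exists (Ordinal d0); rewrite t0; apply/esym/eqP.
    by rewrite eq_le normr_ge0 andbT -t0 norm_coord.
  have [[i j] /=] := mx_norm_neq0 t0.
  by rewrite ord1 => E; exists j.
have ge0 i : 0 <= box_integral (other_coords theta i) (fun x => `|x| `^ alpha) (theta 0 i).
  apply: le_trans (powR_ge0 _ _) (box_integral_ge_abs _ _ abs_powR_continuous _) => //.
rewrite /A_ext (bigD1 j)//=; apply: (@le_trans _ _
   (box_integral (other_coords theta j) (fun x => `|x| `^ alpha) (theta 0 j))).
  exact: (box_integral_ge_abs _ _ abs_powR_continuous).
by rewrite lerDl sumr_ge0.
Qed.

End ExtendedA.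

(** * Shell sums as surface integrals *)

Section ProductComparison.
Context {R : realType}.
Variable I : eqType.
Implicit Types (a b c m : I -> R) (s : seq I).

(** Multiplying by [M] keeps the exponent of the sharp bound free of a
    predecessor. *)
Lemma prod_close s m c (M delta : R) : 0 <= M -> 0 <= delta ->
  (forall i, `|m i| <= M) -> (forall i, `|c i| <= M) ->
  (forall i, `|m i - c i| <= delta) ->
  M * `|\prod_(i <- s) m i - \prod_(i <- s) c i|
  <= (size s)%:R * delta * M ^+ size s.
Proof.
move=> M0 d0 mM cM mc.
have prodc s' : `|\prod_(i <- s') c i| <= M ^+ size s'.
  elim: s' => [|i s' ih]; first by rewrite big_nil normr1.
  by rewrite big_cons normrM exprS ler_pM.
elim: s => [|i s ih]; first by rewrite !big_nil subrr normr0 mulr0 !mul0r.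
rewrite !big_cons/=; set X := \prod_(_ <- _) _ in ih *; set Y := \prod_(_ <- _) _ in ih *.
have -> : m i * X - c i * Y = m i * (X - Y) + (m i - c i) * Y by ring.
apply: (@le_trans _ _ (M * (M * `|X - Y|) + M * (delta * M ^+ size s))).
  rewrite -mulrDr ler_wpM2l//; apply: le_trans (ler_normD _ _) _.
  by rewrite !normrM; apply: lerD; [rewrite ler_wpM2r|exact: ler_pM (prodc s)].
apply: (@le_trans _ _ (M * ((size s)%:R * delta * M ^+ size s) + M * (delta * M ^+ size s))).
  by rewrite lerD2r ler_wpM2l.
by rewrite -natr1 exprS le_eqVlt; apply/orP; left; apply/eqP; ring.
Qed.

End ProductComparison.

Section Telescope.
Context {R : realType}.
Variable d : nat.

(** The factors are replaced one at a time. *)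
Lemma prod_telescope (a b : 'I_d -> R) :
  \prod_i a i - \prod_i b i
  = \sum_j (a j - b j) * \prod_(i | i != j) (if (i < j)%N then a i else b i).
Proof.
pose F k := \prod_(i < d) (if (i < k)%N then a i else b i).
have -> : \prod_i a i = F d by apply: eq_bigr => i _; rewrite ltn_ord.
have -> : \prod_i b i = F 0%N by apply: eq_bigr.
rewrite -(telescope_sumr F)// big_mkord; apply: eq_bigr => j _.
rewrite /F (bigD1 j)//= ltnSn [X in _ - X](bigD1 j)//= ltnn mulrBl; congr (_ - _).
congr (_ * _); apply: eq_bigr => i ij.
by rewrite ltnS leq_eqVlt (inj_eq val_inj) (negPf ij).
Qed.

End Telescope.

Section ShellApproximation.
Context {R : realType}.
Variable d : nat.
Hypothesis d_gt0 : (0 < d)%N.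
Implicit Types (theta : 'rV[R]_d) (x y : R) (n : nat).

Let sin_step x y : `|x * cos y - (sin y - sin (y - x))| <= x ^+ 2.
Proof.
pose r u := u * cos y - (sin y - sin (y - u)).
have dr (u : R) : is_derive u 1 r (cos y - cos (y - u)).
  by rewrite /r; derive_eq; ring.
have -> : x * cos y - (sin y - sin (y - x)) = r x - r 0.
  by rewrite /r subr0; ring.
have -> : x ^+ 2 = `|x| * `|x - 0| by rewrite subr0 -normrM -expr2 ger0_norm// sqr_ge0.
apply: (deriv_bound dr) => u /norm_le_between ux.
by apply: le_trans (cos_lip _ _) _; rewrite opprB addrC subrK.
Qed.

(** [x cos (k x)] is close to the increment of the sine from [(k - 1) x] to
    [k x], and these increments add up to the sine in [seg_cos]. *)
Lemma dirichlet_close n x : `|dirichlet n x - n%:R * seg_cos (n%:R * x)| <= 1 + 2 * n%:R * `|x|.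
Proof.
have [->|x0] := eqVneq x 0.
  rewrite dirichlet0 mulr0 /seg_cos eqxx normr0 mulr0 addr0.
  by rewrite (_ : _ - _ = 1) ?normr1//; ring.
have H : `|x * dirichlet n x - 2 * sin (n%:R * x)| <= `|x| * (1 + 2 * n%:R * `|x|).
  elim: n => [|n ih].
    by rewrite /dirichlet big_ord1 subrr !mul0r sin0 cos0 !(mulr0, mul0r) subr0 addr0 !mulr1.
  rewrite dirichletS.
  have -> : x * (dirichlet n x + 2 * cos (n.+1%:R * x)) - 2 * sin (n.+1%:R * x)
      = (x * dirichlet n x - 2 * sin (n%:R * x))
      + 2 * (x * cos (n.+1%:R * x) - (sin (n.+1%:R * x) - sin (n.+1%:R * x - x))).
    have -> : n.+1%:R * x - x = n%:R * x by rewrite -natr1; ring.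
    by ring.
  apply: le_trans (ler_normD _ _) _; rewrite normrM (@ger0_norm _ 2)//.
  have := sin_step x (n.+1%:R * x); rewrite -(real_normK (num_real x)) -[n.+1%:R]natr1.
  by move: ih; rewrite -!natr1; move: (`|_|) (`|x|) => A X; lra.
have [->|n0] := posnP n.
  by rewrite /dirichlet big_ord1 subrr !mul0r cos0 subr0 normr1 mulr0 mul0r addr0.
have nR : n%:R != 0 :> R by rewrite pnatr_eq0 -lt0n.
rewrite -(ler_pM2l (_ : 0 < `|x|)) ?normr_gt0// -normrM; apply: le_trans H.
rewrite le_eqVlt; apply/orP; left; apply/eqP; congr (`|_|).
by rewrite /seg_cos mulf_eq0 (negPf nR) (negPf x0)/=; field; rewrite ?nR ?x0.
Qed.

Lemma seg_cos_le y : `|seg_cos y| <= 2.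
Proof.
rewrite /seg_cos; case: eqVneq => [_|y0]; first by rewrite ger0_norm.
rewrite normrM normfV ler_pdivrMr ?normr_gt0// normrM (@ger0_norm _ 2)//.
by rewrite ler_pM2l//; have := sin_lip y 0; rewrite sin0 !subr0.
Qed.

Lemma dirichlet_le n x : `|dirichlet n x| <= 2 * n%:R + 1.
Proof.
apply: le_trans (ler_norm_sum _ _ _) _; rewrite -(sym_sum_const R n).
by apply: ler_sum => k _; exact: cos_max.
Qed.

Let others (j : 'I_d) := [seq i <- enum 'I_d | i != j].

Let size_others j : size (others j) = d.-1.
Proof.
by rewrite -[d in RHS]card_ord -(cardC1 j) cardE /others enumT.
Qed.

Let big_others j (F : 'I_d -> R) : \prod_(i | i != j) F i = \prod_(i <- others j) F i.
Proof. by rewrite big_filter big_enum_cond. Qed.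

(** The difference of the products telescopes; the sum is what remains when every
    other factor is replaced by the corresponding integral. *)
Let shell_error n theta : R :=
  (\prod_j dirichlet n (theta 0 j) - \prod_j dirichlet n.-1 (theta 0 j))
  - \sum_j 2 * cos (n%:R * theta 0 j)
      * \prod_(i | i != j) (n%:R * seg_cos (n%:R * theta 0 i)).

Definition error_const : R := d%:R * (2 * (d%:R * (3 * 3 ^+ d.-1))).

Let shell_error_le n theta : (0 < n)%N -> `|theta| <= 1 ->
  `|shell_error n theta| <= error_const * (n%:R ^+ d.-1 * (`|theta| + n%:R^-1)).
Proof.
case: n => // n _ t1; set N : R := n.+1%:R; set t := `|theta|.
have N0 : 0 < N by rewrite ltr0n.
have N1 : 1 <= N by rewrite ler1n.
have nE : n%:R = N - 1 :> R by rewrite /N -natr1 addrK.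
have tj j : `|theta 0 j| <= t by exact: norm_coord.
rewrite /shell_error prod_telescope -sumrB /=.
apply: le_trans (ler_norm_sum _ _ _) _.
pose B := 2 * (d%:R * (3 * 3 ^+ d.-1)) * (N ^+ d.-1 * (t + N^-1)).
apply: (@le_trans _ _ (\sum_(j < d) B)); last first.
  by rewrite sumr_const card_ord -mulr_natl mulrA.
rewrite {}/B.
apply: ler_sum => j _; rewrite !big_others.
have -> : dirichlet n.+1 (theta 0 j) - dirichlet n (theta 0 j)
    = 2 * cos (n.+1%:R * theta 0 j) by rewrite dirichletS; ring.
rewrite -mulrBr normrM -mulrA; apply: ler_pM => //.
  by rewrite normrM (@ger0_norm _ 2)// -[leRHS]mulr1 ler_pM2l// cos_max.
pose M := 3 * N; pose delta := 3 * (1 + N * t).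
have M0 : 0 < M by rewrite mulr_gt0.
have t0 : 0 <= t by exact: normr_ge0.
have delta0 : 0 <= delta by rewrite mulr_ge0 ?addr_ge0 ?mulr_ge0 ?(ltW N0).
have dM k x : (k <= n.+1)%N -> `|dirichlet k x| <= M.
  move=> kn; apply: le_trans (dirichlet_le _ _) _.
  have : k%:R <= N by rewrite ler_nat.
  by rewrite /M; lra.
have dclose x : `|x| <= t -> `|dirichlet n.+1 x - N * seg_cos (N * x)| <= 1 + 2 * N * t.
  by move=> xt; apply: le_trans (dirichlet_close _ _) _; rewrite lerD2l ler_wpM2l.
pose m (i : 'I_d) := if (i < j)%N then dirichlet n.+1 (theta 0 i) else dirichlet n (theta 0 i).
pose c (i : 'I_d) := N * seg_cos (N * theta 0 i).
have mM i : `|m i| <= M by rewrite /m; case: ifP => _; apply: dM.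
have cM i : `|c i| <= M.
  rewrite normrM (ger0_norm (ltW N0)) /M mulrC.
  by rewrite ler_wpM2r ?(ltW N0)//; apply: le_trans (seg_cos_le _) _; rewrite ler_nat.
have mc i : `|m i - c i| <= delta.
  have ci := dclose _ (tj i); have Nt : 0 <= N * t by rewrite mulr_ge0 ?(ltW N0).
  rewrite /m /c; case: ifP => _; first by apply: le_trans ci _; rewrite /delta; lra.
  have -> : dirichlet n (theta 0 i) = dirichlet n.+1 (theta 0 i) - 2 * cos (N * theta 0 i).
    by rewrite dirichletS addrK.
  have := cos_max (N * theta 0 i).
  move: ci; rewrite !ler_norml => /andP[h1 h2] /andP[h3 h4].
  by apply/andP; split; rewrite /delta; lra.
have H := prod_close (others j) (ltW M0) delta0 mM cM mc.
rewrite -(ler_pM2l M0); apply: le_trans H _; rewrite size_others.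
have -> : M * (d%:R * (3 * 3 ^+ d.-1) * (N ^+ d.-1 * (t + N^-1)))
    = d%:R * (3 * delta * M ^+ d.-1).
  by rewrite /M /delta exprMn; field; rewrite gt_eqF.
have P0 : 0 <= delta * M ^+ d.-1 by rewrite mulr_ge0// exprn_ge0// ltW.
move: delta0 P0; move: (M ^+ _) => Q; clearbody delta => D0 DQ0.
rewrite -[leLHS]mulrA; apply: ler_pM => //; first by rewrite ler_nat leq_pred.
by lra.
Qed.

(** The integral of [1 - cos (n <u, theta>)] over the boundary of the cube
    [[-1, 1] ^ d]: two opposite faces for each coordinate. *)
Definition shell_integral n theta : R :=
  \sum_j 2 * box_integral (other_coords theta j) (fun x => 1 - cos (n%:R * x)) (theta 0 j).

Let prod_other_coords theta j (F : R -> R) :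
  \prod_(a <- other_coords theta j) F a = \prod_(i | i != j) F (theta 0 i).
Proof. by rewrite big_map big_others. Qed.

Lemma size_other_coords theta j : size (other_coords theta j) = d.-1.
Proof. by rewrite size_map size_others. Qed.

Let continuous_one_sub_cos n : continuous (fun x : R => 1 - cos (n%:R * x)).
Proof. by move=> x; apply: deriv_continuous; derive_tac. Qed.

Let box_integral_one_sub_cos n theta j :
  box_integral (other_coords theta j) (fun x => 1 - cos (n%:R * x)) (theta 0 j)
  = 2 ^+ d.-1 - cos (n%:R * theta 0 j) * \prod_(i | i != j) seg_cos (n%:R * theta 0 i).
Proof.
have ccos : continuous (fun y : R => cos (n%:R * y)).
  by move=> y; apply: deriv_continuous; derive_tac.
have c1 : continuous (fun _ : R => 1 : R) by move=> y; exact: cvg_cst.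
transitivity (box_integral (other_coords theta j) (fun x => 1 + (- 1) * cos (n%:R * x)) (theta 0 j)).
  by congr box_integral; apply/funext => x; rewrite mulN1r.
rewrite box_integralD//; last by move=> y; apply: cvgMl_tmp; exact: ccos.
rewrite box_integralZ// box_integral_cst box_integral_cos size_other_coords mulr1 mulN1r.
by rewrite (prod_other_coords theta j (fun x => seg_cos (n%:R * x))).
Qed.

Let shell_diff n theta : (0 < n)%N ->
  shell_sum n theta - n%:R ^+ d.-1 * shell_integral n theta
  = shell_error n 0 - shell_error n theta.
Proof.
case: n => // n _; rewrite /shell_sum big_shell !sumrB !big_box_cos.
have box1 m : \sum_(z <- box d m) (1 : R) = \prod_(j < d) dirichlet m ((0 : 'rV[R]_d) 0 j).
  rewrite big_const_seq count_predT iter_addr_0 size_box.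
  by under eq_bigr do rewrite mxE dirichlet0; rewrite prodr_const card_ord.
rewrite !box1 /shell_error/=.
have E (eta : 'rV[R]_d) j : \prod_(i | i != j) (n.+1%:R * seg_cos (n.+1%:R * eta 0 i))
    = n.+1%:R ^+ d.-1 * \prod_(i | i != j) seg_cos (n.+1%:R * eta 0 i).
  by rewrite big_split/= prodr_const cardC1 card_ord.
have -> : n.+1%:R ^+ d.-1 * shell_integral n.+1 theta
    = \sum_j 2 * cos (n.+1%:R * (0 : 'rV[R]_d) 0 j)
        * \prod_(i | i != j) (n.+1%:R * seg_cos (n.+1%:R * (0 : 'rV[R]_d) 0 i))
    - \sum_j 2 * cos (n.+1%:R * theta 0 j)
        * \prod_(i | i != j) (n.+1%:R * seg_cos (n.+1%:R * theta 0 i)).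
  rewrite -sumrB mulr_sumr; apply: eq_bigr => j _; rewrite !E box_integral_one_sub_cos.
  have -> : \prod_(i | i != j) seg_cos (n.+1%:R * (0 : 'rV[R]_d) 0 i) = 2 ^+ d.-1.
    under eq_bigr do rewrite mxE mulr0 /seg_cos eqxx.
    by rewrite prodr_const cardC1 card_ord.
  by rewrite mxE mulr0 cos0; ring.
by ring.
Qed.

(** By [big_box_cos] both terms are differences between a value at [0] and one at
    [theta], and so is the error. *)
Lemma shell_integral_close n theta : (0 < n)%N -> `|theta| <= 1 ->
  `|shell_sum n theta - n%:R ^+ d.-1 * shell_integral n theta|
  <= 2 * error_const * (n%:R ^+ d.-1 * (`|theta| + n%:R^-1)).
Proof.
move=> n0 t1; rewrite shell_diff//; apply: le_trans (ler_normB _ _) _.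
have E0 : 0 <= error_const by rewrite !mulr_ge0// exprn_ge0.
have h0 := @shell_error_le n (0 : 'rV[R]_d) n0.
rewrite normr0 in h0; have {}h0 := h0 ler01.
have h1 := shell_error_le n0 t1.
have : error_const * (n%:R ^+ d.-1 * (0 + n%:R^-1))
    <= error_const * (n%:R ^+ d.-1 * (`|theta| + n%:R^-1)).
  by rewrite !ler_wpM2l ?exprn_ge0// lerD2r.
by move=> h2; lra.
Qed.

Lemma sum_other_coords theta j : \sum_(a <- other_coords theta j) `|a| <= d.-1%:R * `|theta|.
Proof.
rewrite big_map -/(others j); apply: (@le_trans _ _ (\sum_(i <- others j) `|theta|)).
  by apply: ler_sum => i _; exact: norm_coord.
by rewrite big_const_seq count_predT iter_addr_0 size_others mulr_natl.
Qed.

(** Asymptotics at [0] of a function of one variable can thus be integrated over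
    a face of the cube, for [theta] small. *)
Lemma coord_reach theta j y :
  `|y - theta 0 j| <= \sum_(a <- other_coords theta j) `|a| -> `|y| <= d%:R * `|theta|.
Proof.
move=> /le_trans/(_ (sum_other_coords theta j)) h.
rewrite -(subrK (theta 0 j) y); apply: le_trans (ler_normD _ _) _.
have -> : d%:R * `|theta| = d.-1%:R * `|theta| + `|theta|.
  by rewrite -[in d%:R](prednK d_gt0) -natr1; ring.
by apply: lerD => //; exact: norm_coord.
Qed.

Definition shell_integral_const : R := d%:R * (2 * (2 ^+ d.-1 * d%:R ^+ 2)).

Lemma shell_integral_le n theta : `|shell_integral n theta| <= shell_integral_const * (n%:R * `|theta|) ^+ 2.
Proof.
apply: le_trans (ler_norm_sum _ _ _) _.
pose B := 2 * (2 ^+ d.-1 * d%:R ^+ 2) * (n%:R * `|theta|) ^+ 2.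
apply: (@le_trans _ _ (\sum_(j < d) B)); last first.
  by rewrite sumr_const card_ord -[leLHS]mulr_natl /shell_integral_const -[leRHS]mulrA.
rewrite {}/B.
apply: ler_sum => j _; rewrite normrM (@ger0_norm _ 2)// -mulrA ler_pM2l//.
rewrite -[leRHS]mulrA -exprMn.
have c0 : continuous (fun _ : R => 0 : R) by move=> y; exact: cvg_cst.
have := @box_integral_dist R (other_coords theta j) (fun x => 1 - cos (n%:R * x)) (fun _ => 0)
  (theta 0 j) ((d%:R * (n%:R * `|theta|)) ^+ 2) (continuous_one_sub_cos (n := n)) c0.
rewrite box_integral_cst mulr0 subr0 size_other_coords; apply => y /coord_reach yt.
rewrite subr0 ger0_norm ?one_sub_cos_ge0//; apply: le_trans (one_sub_cos_le _) _.
have : (n%:R * y) ^+ 2 <= (d%:R * (n%:R * `|theta|)) ^+ 2.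
  apply: sqr_le_norm; rewrite !normrM !normr_id !(@ger0_norm _ _%:R)//.
  by rewrite mulrCA ler_wpM2l.
by have := sqr_ge0 (n%:R * y); lra.
Qed.

End ShellApproximation.

(** * Exponents below 2 *)

Section Asymptotics.
Context {R : realType}.
Variable d : nat.
Hypothesis d_gt0 : (0 < d)%N.
Implicit Types (theta : 'rV[R]_d) (alpha : R).

Lemma asymp_equivI (F G : 'rV[R]_d -> R) :
  (forall eta : R, 0 < eta -> exists2 rho : R, 0 < rho & forall theta,
     0 < `|theta| -> `|theta| < rho -> 0 < G theta /\ `|F theta - G theta| <= eta * G theta) ->
  asymp_equiv F G 0.
Proof.
move=> FG; rewrite /asymp_equiv; apply/(@cvgrPdist_le _ _ _ _ (dnbhs_filter (0 : 'rV[R]_d))) => e e0.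
have [rho rho0 H] := FG _ e0.
near=> theta.
have t0 : 0 < `|theta| by rewrite normr_gt0; near: theta; exact: nbhs_dnbhs_neq.
have trho : `|theta| < rho by near: theta; exact: dnbhs0_lt.
have [G0 FGe] := H _ t0 trho.
rewrite -[1](@divff _ (G theta)) ?gt_eqF// -mulrBl normrM normfV (ger0_norm (ltW G0)).
by rewrite ler_pdivrMr// distrC.
Unshelve. all: by end_near. Qed.

(** The constant is the integral of a nonnegative function that is positive on
    [[1, 2]]. *)
Lemma Gamma_cos_gt0 alpha : 0 < alpha -> alpha < 2 -> 0 < Gamma_cos alpha.
Proof.
move=> a0 a2; have [P [dP P0 Py]] := mellin_primitive_exists a0 a2.
have kge0 s : 0 < s -> 0 <= s `^ (- alpha - 1) * (1 - cos s).
  by move=> s0; rewrite mulr_ge0 ?powR_ge0 ?one_sub_cos_ge0.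
have nd s t : 0 < s -> s <= t -> P s <= P t.
  move=> s0 st; have [|c /andP[sc _] E] := mean_value st
      (df := fun s => s `^ (- alpha - 1) * (1 - cos s)) (f := P).
    by move=> x /andP[sx _]; apply: dP; exact: lt_le_trans sx.
  rewrite -subr_ge0 E mulr_ge0 ?subr_ge0// kge0//; exact: lt_le_trans sc.
have P1 : 0 <= P 1.
  apply: (cvgr_to_le P0); near=> s.
  apply: nd; first by near: s; exact: nbhs_right_gt.
  by near: s; exact: nbhs_right_le.
have P2 : 0 < P 2.
  have [||c /andP[c1 c2] E] := @mean_value R P
      (fun s => s `^ (- alpha - 1) * (1 - cos s)) 1 2; first by lra.
    by move=> x /andP[sx _]; apply: dP; exact: lt_le_trans sx.
  have c0 : 0 < c by exact: lt_le_trans c1.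
  have : 0 < c `^ (- alpha - 1) * (1 - cos c).
    rewrite mulr_gt0 ?powR_gt0// one_sub_cosE mulr_gt0// exprn_gt0//.
    by apply: sin2_gt0; apply/andP; split; lra.
  by move: E; rewrite (_ : 2 - 1 = 1) ?mulr1; [lra|ring].
have : 0 < Gamma_cos alpha / alpha.
  apply: (lt_le_trans P2); apply: (cvgr_to_ge Py); near=> s.
  by apply: nd; [lra|near: s; exact: nbhs_pinfty_ge].
by rewrite pmulr_lgt0// invr_gt0.
Unshelve. all: by end_near. Qed.

Lemma shell_integral_sum alpha theta N :
  \sum_(1 <= n < N) n%:R `^ (- 1 - alpha) * shell_integral n theta
  = \sum_j 2 * box_integral (other_coords theta j) (cos_sum alpha N) (theta 0 j).
Proof.
have -> : \sum_(1 <= n < N) n%:R `^ (- 1 - alpha) * shell_integral n theta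
   = \sum_(1 <= n < N) \sum_j 2 * (n%:R `^ (- 1 - alpha)
       * box_integral (other_coords theta j) (fun x => 1 - cos (n%:R * x)) (theta 0 j)).
  by apply: eq_bigr => n _; rewrite mulr_sumr; apply: eq_bigr => j _; ring.
rewrite exchange_big/=; apply: eq_bigr => j _; rewrite -mulr_sumr; congr (_ * _).
rewrite -(@box_integral_sum R _ (fun n => n%:R `^ (- 1 - alpha)) (fun n x => 1 - cos (n%:R * x)))//.
by move=> n x; apply: deriv_continuous; derive_tac.
Qed.

Lemma cos_sum_continuous alpha N : continuous (cos_sum alpha N : R -> R).
Proof.
rewrite /cos_sum; apply: continuous_big => [|n _ x]; first exact: add_continuous.
by apply: deriv_continuous; derive_tac.
Qed.

(** The error of [shell_integral_close] is absorbed by [sum_small], and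
    [cos_sum_asymp] is integrated over the faces of the cube.  Both estimates are
    uniform in the number of terms, which is sent to infinity at the end. *)
Lemma Fd_approx alpha (eta : R) : 0 < alpha -> alpha < 2 -> 0 < eta ->
  exists2 rho : R, 0 < rho & forall theta, 0 < `|theta| -> `|theta| < rho ->
    `|Fd alpha theta - 2 / alpha * Gamma_cos alpha * Ad alpha theta|
    <= eta * `|theta| `^ alpha.
Proof.
move=> a0 a2 eta0; set K := Gamma_cos alpha / alpha.
have dR : 1 <= d%:R :> R by rewrite ler1n.
have sc0 : 0 <= shell_const d :> R by exact: shell_const_ge0.
have ec0 : 0 <= error_const d :> R by rewrite !mulr_ge0// exprn_ge0.
have mc0 : 0 <= shell_integral_const d :> R by rewrite !mulr_ge0// exprn_ge0.
(* Covers the quadratic bounds of both sums as well as [shell_integral_close]. *)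
pose C0 : R := shell_const d * d%:R ^+ 2 + shell_integral_const d + 2 * error_const d.
have sd0 : 0 <= shell_const d * d%:R ^+ 2 :> R by rewrite mulr_ge0// exprn_ge0.
have C00 : 0 <= C0 by rewrite /C0; lra.
have eta3 : 0 < eta / 4 by rewrite divr_gt0.
have [rho1 rho1_gt0 small] := sum_small a0 a2 C00 eta3.
pose D : R := d%:R * (2 * 2 ^+ d.-1).
have D0 : 0 < D by rewrite !mulr_gt0 ?exprn_gt0 ?ltr0n.
have d0 : 0 < d%:R :> R by rewrite ltr0n.
have da0 : 0 < d%:R `^ alpha :> R by exact: powR_gt0.
have eta2 : 0 < eta / 4 / (D * d%:R `^ alpha) by rewrite divr_gt0// mulr_gt0.
have [rho2 rho2_gt0 asymp] := cos_sum_asymp a0 a2 eta2.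
exists (Num.min 1 (Num.min rho1 (rho2 / d%:R))).
  by rewrite !lt_min ltr01 rho1_gt0 divr_gt0// ltr0n.
move=> theta t0; set t := `|theta|; rewrite !lt_min => /and3P[t1 trho1].
rewrite ltr_pdivlMr ?ltr0n// mulrC => dtrho.
have ta0 : 0 < t `^ alpha by exact: powR_gt0.
have error N : `|Fd_partial alpha theta N
    - \sum_(1 <= n < N) n%:R `^ (- 1 - alpha) * shell_integral n theta| <= eta / 4 * t `^ alpha.
  rewrite -sumrB; apply: le_trans (ler_norm_sum _ _ _) _.
  apply: (small t (fun n => `|n%:R `^ (- (d%:R + alpha)) * shell_sum n theta
     - n%:R `^ (- 1 - alpha) * shell_integral n theta|)) => // n n0.
  rewrite -(weight_pred d_gt0 alpha n0) -mulrA -mulrBr normrM ger0_norm ?powR_ge0//.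
  have nd0 : 0 <= n%:R ^+ d.-1 :> R by exact: exprn_ge0.
  rewrite -[X in C0 * X]mulrA mulrCA ler_wpM2l ?powR_ge0//.
  rewrite !minr_pMr// le_min; apply/andP; split.
    apply: le_trans (ler_normB _ _) _; rewrite ger0_norm ?shell_sum_ge0// normrM ger0_norm//.
    have h1 := shell_sum_le theta n0; have h2 := ler_wpM2l nd0 (shell_integral_le d_gt0 n theta).
    have : 0 <= error_const d * (n%:R ^+ d.-1 * (n%:R * t) ^+ 2).
      by rewrite mulr_ge0// mulr_ge0// sqr_ge0.
    by move: h1 h2; rewrite /C0 -/t; move: (shell_const d * _) (shell_integral_const _) (error_const _) => x y z; lra.
  apply: le_trans (shell_integral_close n0 (ltW t1)) _.
  apply: ler_wpM2r; last by rewrite /C0; lra.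
  by rewrite mulr_ge0// addr_ge0 ?invr_ge0.
have main N : (0 < N)%N -> `|\sum_(1 <= n < N) n%:R `^ (- 1 - alpha) * shell_integral n theta
    - 2 * K * A_ext alpha theta| <= eta / 4 * t `^ alpha + 2 * D * power_tail alpha N.
  move=> N0; rewrite shell_integral_sum /A_ext mulr_sumr -sumrB.
  apply: le_trans (ler_norm_sum _ _ _) _.
  pose B := 2 * (2 ^+ d.-1 * (eta / 4 / (D * d%:R `^ alpha) * (d%:R * t) `^ alpha
     + 2 * power_tail alpha N)).
  apply: (@le_trans _ _ (\sum_(j < d) B)); last first.
    rewrite sumr_const card_ord -[leLHS]mulr_natl /B powRM ?ler0n ?(ltW t0)//.
    rewrite le_eqVlt; apply/orP; left; apply/eqP.
    by rewrite /D; field; rewrite !gt_eqF ?exprn_gt0 ?ltr0n.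
  apply: ler_sum => j _; rewrite -mulrA -mulrBr normrM (@ger0_norm _ 2)// /B ler_pM2l//.
  rewrite -box_integralZ; last exact: abs_powR_continuous.
  rewrite -(size_other_coords theta j); apply: box_integral_dist.
  - exact: cos_sum_continuous.
  - by move=> x; apply: cvgMl_tmp; exact: abs_powR_continuous.
  move=> y /(coord_reach d_gt0) yt; apply: le_trans (asymp _ _ N0 _) _.
    exact: le_lt_trans dtrho.
  rewrite lerD2r ler_wpM2l ?(ltW eta2)//.
  have dt0 : 0 <= d%:R * t by rewrite mulr_ge0 ?(ltW t0).
  by apply: ge0_ler_powR; [exact: ltW|exact: normr_ge0|exact: dt0|exact: yt].
have /cvgrPdist_le cF := @Fd_cvg R d d_gt0 alpha a0 theta.
have /cvgrPdist_le cT := power_tail_cvg0 a0.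
have e0 : 0 < eta / 4 * t `^ alpha by rewrite mulr_gt0.
have e1 : 0 < eta / 4 * t `^ alpha / (2 * D) by rewrite divr_gt0// mulr_gt0.
have [N [N0 [FN TN]]] : exists N, (0 < N)%N /\
    (`|Fd alpha theta - Fd_partial alpha theta N| <= eta / 4 * t `^ alpha /\
     `|0 - power_tail alpha N| <= eta / 4 * t `^ alpha / (2 * D)).
  have h0 : \forall N \near \oo, (0 < N)%N by exact: nbhs_infty_gt.
  exact: filter_ex (filterI h0 (filterI (cF _ e0) (cT _ e1))).
rewrite AdE// (_ : 2 / alpha * _ = 2 * K); last by rewrite /K; field; rewrite gt_eqF.
have hm := main N N0; have he := error N.
have {}TN : 2 * D * power_tail alpha N <= eta / 4 * t `^ alpha.
  rewrite mulrC -ler_pdivlMr ?mulr_gt0//; apply: le_trans TN.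
  by rewrite sub0r normrN; exact: ler_norm.
set S := \sum_(1 <= n < N) _ in hm he.
rewrite (_ : _ - _ = (Fd alpha theta - Fd_partial alpha theta N)
   + ((Fd_partial alpha theta N - S) + (S - 2 * K * A_ext alpha theta))); last by ring.
apply: le_trans (ler_normD _ _) _.
have := ler_normD (Fd_partial alpha theta N - S) (S - 2 * K * A_ext alpha theta).
lra.
Qed.

Lemma subcritical alpha : 0 < alpha -> alpha < 2 ->
  asymp_equiv (Fd alpha)
    (fun theta : 'rV[R]_d => 2 / alpha * Gamma_cos alpha * Ad alpha theta) 0.
Proof.
move=> a0 a2; apply: asymp_equivI => eta eta0.
have G0 := Gamma_cos_gt0 a0 a2.
have c0 : 0 < 2 / alpha * Gamma_cos alpha by rewrite mulr_gt0// divr_gt0.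
have [rho rho0 H] := Fd_approx a0 a2 (mulr_gt0 eta0 c0).
exists rho => // theta t0 trho.
have A0 : `|theta| `^ alpha <= Ad alpha theta by rewrite AdE//; exact: A_ext_ge.
have ta0 : 0 < `|theta| `^ alpha by exact: powR_gt0.
split; first by rewrite mulr_gt0//; exact: lt_le_trans A0.
apply: le_trans (H _ t0 trho) _; rewrite -[leLHS]mulrA.
by apply: ler_wpM2l; [exact: ltW|apply: ler_wpM2l; [exact: ltW|]].
Qed.

End Asymptotics.

(** * Exponents above 2 *)

Section MomentBounds.
Context {R : realType}.
Variable d : nat.
Hypothesis d_gt0 : (0 < d)%N.
Implicit Types (theta : 'rV[R]_d).

Lemma eucl_norm_le theta : eucl_norm theta ^+ 2 <= d%:R * `|theta| ^+ 2.
Proof.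
rewrite sqr_sqrtr ?sumr_ge0// => [|j _]; last exact: sqr_ge0.
apply: (@le_trans _ _ (\sum_(j < d) `|theta| ^+ 2)).
  by apply: ler_sum => j _; apply: sqr_le_norm; rewrite normr_id norm_coord.
by rewrite sumr_const card_ord -[leLHS]mulr_natl.
Qed.

Lemma norm_le_eucl theta : `|theta| <= eucl_norm theta.
Proof.
rewrite [leLHS]/Num.norm/= mx_normrE; apply/bigmax_leP; split => [|[i j] _ /=].
  exact: sqrtr_ge0.
rewrite ord1 -sqrtr_sqr; apply: ler_wsqrtr.
by rewrite (bigD1 j)//= lerDl sumr_ge0// => k _; exact: sqr_ge0.
Qed.

Definition quad_const : R := shell_const d * d%:R ^+ 2.

Lemma quad_const_ge0 : 0 <= quad_const.
Proof. by rewrite mulr_ge0 ?shell_const_ge0// exprn_ge0. Qed.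

(** Evaluate [sum_shell_sqr] at the vector with all coordinates equal to [1]. *)
Lemma shell_quad_le n : (0 < n)%N ->
  shell_quad d n <= quad_const * (n%:R ^+ d.-1 * n%:R ^+ 2).
Proof.
move=> n0; have d1 : 1 <= d%:R :> R by rewrite ler1n.
pose u : 'rV[R]_d := const_mx 1.
have u1 : `|u| <= 1.
  rewrite [leLHS]/Num.norm/= mx_normrE; apply/bigmax_leP; split => // -[i j] _ /=.
  by rewrite mxE normr1.
have ud : 1 <= eucl_norm u ^+ 2.
  rewrite sqr_sqrtr ?sumr_ge0// => [|j _]; last exact: sqr_ge0.
  under eq_bigr do rewrite mxE expr1n.
  by rewrite sumr_const card_ord.
apply: (@le_trans _ _ (shell_quad d n * eucl_norm u ^+ 2)).
  by rewrite ler_peMr ?shell_quad_ge0.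
rewrite -sum_shell_sqr// /quad_const mulrACA; apply: le_trans (ler_norm _) _.
apply: shell_bound => // z zn.
have : inner (latvec z) u ^+ 2 <= d%:R ^+ 2 * n%:R ^+ 2.
  rewrite -exprMn; apply: sqr_le_norm; apply: le_trans (inner_le _ _) _.
  rewrite zn (ger0_norm (mulr_ge0 _ _))// ler_wpM2l//.
  by rewrite ler_piMr.
rewrite ger0_norm ?divr_ge0 ?sqr_ge0//.
have := sqr_ge0 (inner (latvec z) u); lra.
Qed.

End MomentBounds.

Section Supercritical.
Context {R : realType}.
Variable d : nat.
Hypothesis d_gt0 : (0 < d)%N.
Implicit Types (theta : 'rV[R]_d).

(** The quartic bound serves for [n |theta| <= 1] and the quadratic ones beyond;
    each is there below the power of intermediate exponent. *)
Lemma shell_sum_interp n theta (l : R) : (0 < n)%N -> 0 < `|theta| ->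
    0 <= l -> l <= 1 ->
  `|shell_sum n theta - shell_quad d n * eucl_norm theta ^+ 2|
  <= 2 * quad_const d * d%:R ^+ 2
     * (n%:R ^+ d.-1 * (n%:R * `|theta|) `^ (2 + l)).
Proof.
move=> n0 t0 l0 l1; set t := `|theta|.
have d1 : 1 <= d%:R :> R by rewrite ler1n.
have dd1 : 1 <= d%:R ^+ 2 :> R by rewrite exprn_ege1.
have dd2 : d%:R <= d%:R ^+ 2 :> R by rewrite expr2; nra.
have nt0 : 0 < n%:R * t by rewrite mulr_gt0 ?ltr0n.
have q0 : 0 <= quad_const d :> R by exact: quad_const_ge0.
have qd0 : 0 <= quad_const d * d%:R ^+ 2 :> R by rewrite mulr_ge0// exprn_ge0.
have nd0 : 0 <= n%:R ^+ d.-1 :> R by exact: exprn_ge0.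
have [nt1|nt1] := leP (n%:R * t) 1.
  apply: le_trans (shell_sum_quartic theta n0) _.
  have -> : shell_const d * d%:R ^+ 4 = quad_const d * d%:R ^+ 2 :> R.
    by rewrite /quad_const; ring.
  apply: (@le_trans _ _ (quad_const d * d%:R ^+ 2 * (n%:R ^+ d.-1 * (n%:R * t) `^ (2 + l)))).
    apply: (ler_wpM2l qd0); apply: ler_wpM2l => //.
    rewrite -powR_mulrn ?(ltW nt0)//; apply: ger_powR; first by rewrite nt0.
    by lra.
  by rewrite ler_wpM2r ?mulr_ge0 ?powR_ge0//; have := qd0; lra.
apply: le_trans (ler_normB _ _) _.
have sq0 : 0 <= shell_quad d n * eucl_norm theta ^+ 2.
  by apply: mulr_ge0; [exact: shell_quad_ge0|exact: sqr_ge0].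
rewrite ger0_norm ?shell_sum_ge0// (ger0_norm sq0).
have le2 : (n%:R * t) ^+ 2 <= (n%:R * t) `^ (2 + l).
  by rewrite -powR_mulrn ?(ltW nt0)//; apply: ler_powR; [exact: ltW|lra].
have h1 := shell_sum_le theta n0.
have h2 : shell_quad d n * eucl_norm theta ^+ 2
    <= quad_const d * d%:R * (n%:R ^+ d.-1 * (n%:R * t) ^+ 2).
  apply: (@le_trans _ _ (quad_const d * (n%:R ^+ d.-1 * n%:R ^+ 2) * (d%:R * t ^+ 2))).
    by apply: ler_pM; rewrite ?shell_quad_ge0 ?sqr_ge0 ?shell_quad_le// eucl_norm_le.
  by rewrite le_eqVlt; apply/orP; left; apply/eqP; ring.
apply: (@le_trans _ _ (2 * quad_const d * d%:R ^+ 2 * (n%:R ^+ d.-1 * (n%:R * t) ^+ 2))).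
  have X0 : 0 <= n%:R ^+ d.-1 * (n%:R * t) ^+ 2 by rewrite mulr_ge0// sqr_ge0.
  move: h1 h2; rewrite -/(quad_const d) -/t; set X := _ ^+ _ * _ ^+ 2 in X0 *.
  have : quad_const d * X <= quad_const d * d%:R ^+ 2 * X.
    by rewrite ler_wpM2r// ler_peMr.
  have : quad_const d * d%:R * X <= quad_const d * d%:R ^+ 2 * X.
    by rewrite ler_wpM2r// ler_wpM2l.
  lra.
have c0 : 0 <= 2 * quad_const d * d%:R ^+ 2 :> R by have := qd0; lra.
by apply: (ler_wpM2l c0); exact: ler_wpM2l.
Qed.

Variable alpha : R.
Hypothesis alpha_gt2 : 2 < alpha.

Definition quad_sum N : R :=
  \sum_(1 <= n < N) n%:R `^ (- (d%:R + alpha)) * shell_quad d n.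

Lemma quad_sum_nondecreasing : nondecreasing_seq quad_sum.
Proof.
apply/nondecreasing_seqP => -[|N]; first by rewrite /quad_sum !big_geq.
rewrite /quad_sum [leRHS]big_nat_recr//= lerDl.
by rewrite mulr_ge0 ?powR_ge0 ?shell_quad_ge0.
Qed.

Lemma quad_sum_is_cvg : cvgn quad_sum.
Proof.
apply: nondecreasing_is_cvgn; first exact: quad_sum_nondecreasing.
have s0 : 0 < alpha - 2 by have := alpha_gt2; lra.
exists (quad_const d * (1 + (alpha - 2)^-1)) => _ [N _ <-].
apply: (@le_trans _ _ (quad_const d * \sum_(1 <= n < N) n%:R `^ (- 1 - (alpha - 2)))).
  rewrite mulr_sumr [leLHS]big_nat_cond [leRHS]big_nat_cond; apply: ler_sum => n.
  rewrite andbT => /andP[n0 _].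
  have nn0 : n%:R != 0 :> R by rewrite pnatr_eq0 -lt0n.
  have -> : - 1 - (alpha - 2) = (- 1 - alpha) + 2 by ring.
  rewrite powRD ?nn0 ?implybT// -(weight_pred d_gt0 alpha n0) powR_mulrn ?ler0n//.
  rewrite -[X in _ <= _ * X]mulrA [leRHS]mulrCA.
  by apply: ler_wpM2l; [exact: powR_ge0|exact: shell_quad_le].
by rewrite ler_wpM2l ?quad_const_ge0 ?power_sum_le.
Qed.

Lemma quad_sum_gt0 : 0 < limn quad_sum.
Proof.
apply: (@lt_le_trans _ _ (quad_sum 2)).
  rewrite /quad_sum big_nat1 powR1 /shell_quad.
  have : 0 < 3 ^+ d :> R by rewrite exprn_gt0.
  rewrite (_ : 2 * 1 + 1 = 3 :> R); [lra|ring].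
apply: (nondecreasing_cvgn_le quad_sum_nondecreasing quad_sum_is_cvg).
Qed.

Lemma supercritical_error (l s : R) : 0 <= l -> l <= 1 -> 0 < s -> l + s = alpha - 2 ->
  forall theta, 0 < `|theta| ->
  `|Fd alpha theta - limn quad_sum * eucl_norm theta ^+ 2|
  <= 2 * quad_const d * d%:R ^+ 2 * (1 + s^-1) * `|theta| `^ (2 + l).
Proof.
move=> l0 l1 s0 ls theta t0.
have a0 : 0 < alpha by have := alpha_gt2; lra.
have q0 : 0 <= 2 * quad_const d * d%:R ^+ 2 :> R.
  by rewrite !mulr_ge0 ?quad_const_ge0// exprn_ge0.
have H N : `|Fd_partial alpha theta N - quad_sum N * eucl_norm theta ^+ 2|
    <= 2 * quad_const d * d%:R ^+ 2 * (1 + s^-1) * `|theta| `^ (2 + l).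
  rewrite mulr_suml -sumrB; apply: le_trans (ler_norm_sum _ _ _) _.
  apply: (@le_trans _ _ (2 * quad_const d * d%:R ^+ 2 *
      (\sum_(1 <= n < N) n%:R `^ (- 1 - s)) * `|theta| `^ (2 + l))).
    rewrite mulr_sumr mulr_suml [leLHS]big_nat_cond [leRHS]big_nat_cond.
    apply: ler_sum => n; rewrite andbT => /andP[n0 _].
    have nn0 : n%:R != 0 :> R by rewrite pnatr_eq0 -lt0n.
    rewrite -mulrA -mulrBr normrM ger0_norm ?powR_ge0//.
    apply: le_trans (ler_wpM2l (powR_ge0 _ _) (shell_sum_interp n0 t0 l0 l1)) _.
    have -> : n%:R `^ (- 1 - s) = n%:R `^ (- (d%:R + alpha)) * n%:R ^+ d.-1 * n%:R `^ (2 + l) :> R.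
      rewrite (weight_pred d_gt0 alpha n0) -powRD ?nn0 ?implybT//; congr (_ `^ _).
      by have := ls; lra.
    rewrite powRM ?ler0n ?(ltW t0)//.
    by rewrite le_eqVlt; apply/orP; left; apply/eqP; ring.
  by rewrite ler_wpM2r ?powR_ge0// ler_wpM2l// power_sum_le.
have L : `|Fd_partial alpha theta N - quad_sum N * eucl_norm theta ^+ 2| @[N --> \oo]
    --> `|Fd alpha theta - limn quad_sum * eucl_norm theta ^+ 2|.
  apply: cvg_norm; apply: cvgB; first exact: Fd_cvg.
  by apply: cvgMr_tmp; exact: quad_sum_is_cvg.
by apply: (cvgr_to_le L); apply: nearW.
Qed.

Lemma quad_sumE : limn quad_sum = 1 / 6 *
  limn (fun N : nat => \sum_(1 <= n < N)
    ((2 * n%:R + 1) ^+ d * (n%:R + 1) - (2 * n%:R - 1) ^+ d * (n%:R - 1))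
    / n%:R `^ (d%:R + alpha - 1)).
Proof.
set S := (fun N : nat => _).
have E : S = (fun N => 6 * quad_sum N).
  apply/funext => N; rewrite /S /quad_sum mulr_sumr.
  rewrite [LHS]big_nat_cond [RHS]big_nat_cond; apply: eq_bigr => n; rewrite andbT => /andP[n0 _].
  have nn0 : n%:R != 0 :> R by rewrite pnatr_eq0 -lt0n.
  rewrite -powRN (_ : - _ = - (d%:R + alpha) + 1); last by ring.
  by rewrite powRD ?nn0 ?implybT// powRr1 ?ler0n// /shell_quad; field.
have -> : limn S = 6 * limn quad_sum.
  by apply: cvg_lim => //; rewrite E; apply: cvgMl_tmp; exact: quad_sum_is_cvg.
by field.
Qed.

Lemma supercritical :
  asymp_equiv (Fd alpha)
    (fun theta : 'rV[R]_d =>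
       1 / 6 *
       limn (fun N : nat => \sum_(1 <= n < N)
          ((2 * n%:R + 1) ^+ d * (n%:R + 1)
           - (2 * n%:R - 1) ^+ d * (n%:R - 1))
          / n%:R `^ (d%:R + alpha - 1)) *
       eucl_norm theta ^+ 2) 0.
Proof.
have a2 := alpha_gt2.
rewrite -quad_sumE; apply: asymp_equivI => eta eta0.
(* [2 + l] must stay below [alpha] for the errors to be summable. *)
pose l := Num.min 1 ((alpha - 2) / 2).
have l0 : 0 < l by rewrite lt_min ltr01 divr_gt0// subr_gt0.
have l1 : l <= 1 by rewrite ge_min lexx.
have s0 : 0 < alpha - 2 - l.
  have : l <= (alpha - 2) / 2 by rewrite ge_min lexx orbT.
  lra.
have ls : l + (alpha - 2 - l) = alpha - 2 by ring.
have c0 := quad_sum_gt0.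
have := supercritical_error (ltW l0) l1 s0 ls.
set K := 2 * _ * _ * _ => H.
have K0 : 0 <= K.
  rewrite mulr_ge0 ?addr_ge0 ?invr_ge0 ?(ltW s0)//.
  by rewrite !mulr_ge0 ?quad_const_ge0// exprn_ge0.
pose r := eta * limn quad_sum / (K + 1).
have r0 : 0 < r by rewrite divr_gt0 ?mulr_gt0// ltr_wpDl.
exists (r `^ l^-1) => [|theta t0 tr]; first exact: powR_gt0.
have te := norm_le_eucl theta.
have e0 : 0 < eucl_norm theta by exact: lt_le_trans te.
split; first by rewrite mulr_gt0// exprn_gt0.
apply: le_trans (H _ t0) _.
have -> : `|theta| `^ (2 + l) = `|theta| ^+ 2 * `|theta| `^ l.
  by rewrite powRD ?(gt_eqF t0) ?implybT// powR_mulrn.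
have tl : `|theta| `^ l <= r.
  have -> : r = (r `^ l^-1) `^ l by rewrite -powRrM mulVf ?gt_eqF// powRr1// ltW.
  by apply: ge0_ler_powR; rewrite ?nnegrE ?powR_ge0 ?ltW.
apply: (@le_trans _ _ ((K + 1) * (eucl_norm theta ^+ 2 * r))).
  apply: ler_pM; [exact: K0|by rewrite mulr_ge0 ?powR_ge0 ?sqr_ge0|by rewrite lerDl|].
  apply: ler_pM; [exact: sqr_ge0|exact: powR_ge0| |exact: tl].
  by apply: lerXn2r; rewrite ?nnegrE// ltW.
rewrite /r le_eqVlt; apply/orP; left; apply/eqP; field.
by rewrite gt_eqF// ltr_wpDl.
Qed.

End Supercritical.

(** * The exponent 2 *)

Section CriticalSums.
Context {R : realType}.
Implicit Types (x e : R).

(** The powers of [x] in front keep the exponents free of predecessors. *)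
Lemma expr_first_order x e k : 1 <= x -> `|e| <= 1 ->
  `|x * (x * (x + e) ^+ k - x ^+ k.+1 - k%:R * e * x ^+ k)| <= 4 ^+ k * x ^+ k.
Proof.
move=> x1 e1; elim: k => [|k].
  by rewrite !expr0 expr1 !(mulr1, mul0r, mul1r) subrr subr0 mulr0 normr0.
set E := x * (x + e) ^+ k - _ - _ => ih.
have -> : x * (x * (x + e) ^+ k.+1 - x ^+ k.+2 - k.+1%:R * e * x ^+ k.+1)
    = (x + e) * (x * E) + k%:R * e ^+ 2 * (x * x ^+ k).
  by rewrite /E !exprS -(natr1 k); ring.
have xk : 1 <= x ^+ k by exact: exprn_ege1.
have k4 : k%:R <= 4 ^+ k :> R.
  by rewrite -natrX ler_nat; exact/ltnW/ltn_expl.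
apply: le_trans (ler_normD _ _) _; rewrite normrM.
have h1 : `|x + e| * `|x * E| <= (2 * x) * (4 ^+ k * x ^+ k).
  apply: ler_pM => //; apply: le_trans (ler_normD _ _) _.
  rewrite (ger0_norm (le_trans ler01 x1)); lra.
have h2 : `|k%:R * e ^+ 2 * (x * x ^+ k)| <= 4 ^+ k * 1 * (x * x ^+ k).
  rewrite normrM (ger0_norm (_ : 0 <= x * x ^+ k)); last by rewrite mulr_ge0//; lra.
  rewrite ler_wpM2r//; first by rewrite mulr_ge0//; lra.
  rewrite normrM; apply: ler_pM => //; first by rewrite normr_nat.
  by rewrite normrX exprn_ile1.
have p0 : 0 <= 4 ^+ k * (x * x ^+ k) by rewrite !mulr_ge0 ?exprn_ge0//; lra.
move: h1 h2 p0; rewrite !exprS; lra.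
Qed.

Lemma harmonic_ge M : ln M.+1%:R <= \sum_(1 <= n < M.+1) n%:R^-1 :> R.
Proof.
elim: M => [|M ih]; first by rewrite big_geq// ln1.
rewrite big_nat_recr//=.
have -> : M.+2%:R = M.+1%:R * (1 + M.+1%:R^-1) :> R.
  by rewrite mulrDr mulr1 divff// natr1.
rewrite lnM ?posrE ?ltr0Sn ?addr_gt0 ?invr_gt0//.
apply: lerD => //; apply: le_ln1Dx.
by apply: (@lt_trans _ _ 0); rewrite ?ltrN10// invr_gt0.
Qed.

Lemma harmonic_le M : \sum_(1 <= n < M.+2) n%:R^-1 <= 1 + ln M.+1%:R :> R.
Proof.
elim: M => [|M ih]; first by rewrite big_nat1 ln1 invr1 addr0.
rewrite big_nat_recr//=.
have E : M.+1%:R = M.+2%:R * (1 - M.+2%:R^-1) :> R.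
  by rewrite mulrBr mulr1 divff// -(natr1 M.+1) addrK.
have i1 : M.+2%:R^-1 < 1 :> R by rewrite invf_lt1// ltr1n.
have : ln M.+1%:R = ln M.+2%:R + ln (1 - M.+2%:R^-1) :> R.
  by rewrite E lnM// posrE ?ltr0Sn// subr_gt0.
have : ln (1 - M.+2%:R^-1) <= - M.+2%:R^-1 :> R by apply: le_ln1Dx; rewrite ltrN2.
by move: ih; set y := M.+2%:R^-1; lra.
Qed.

End CriticalSums.

Section ShellMoment.
Context {R : realType}.
Variable d : nat.
Hypothesis d_gt0 : (0 < d)%N.

Definition critical_const : R := 2 ^+ (d - 1) * (d%:R + 2) / 3.

Lemma critical_const_gt0 : 0 < critical_const.
Proof.
by rewrite divr_gt0// mulr_gt0// ?exprn_gt0// addr_gt0// ltr0n.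
Qed.

(** The two powers in [shell_quad n] are [(2 n) ^ d], plus or minus
    [d (2 n) ^ (d - 1)], up to lower order. *)
Lemma shell_quad_main n : (0 < n)%N ->
  `|shell_quad d n - critical_const * n%:R ^+ d.+1| <= 8 ^+ d * n%:R ^+ d :> R.
Proof.
move=> n0; have n1 : 1 <= n%:R :> R by rewrite ler1n.
set m : R := n%:R in n1 *; pose x := 2 * m; have x2 : 2 <= x by rewrite /x; lra.
have x1 : 1 <= x by lra.
have h1 := @expr_first_order R x 1 d x1; rewrite normr1 in h1.
have h2 := @expr_first_order R x (- 1) d x1; rewrite normrN1 in h2.
have {h1} := h1 (lexx _); set A := x * (x + 1) ^+ d - _ - _ => h1.
have {h2} := h2 (lexx _); set B := x * (x - 1) ^+ d - _ - _ => h2.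
have E : x * (x * (shell_quad d n - critical_const * m ^+ d.+1))
    = (x * (x / 2 * (x * A - x * B) + (x * A + x * B))) / 12.
  rewrite /shell_quad /critical_const -/m -/x /A /B.
  have -> : m = x / 2 by rewrite /x; field.
  rewrite expr_div_n -[d in 2 ^- d.+1](@subnK 1 d)// addn1 !exprS.
  by field; rewrite expf_neq0.
have xd0 : 0 <= x ^+ d by rewrite exprn_ge0//; lra.
have b0 : 0 <= 4 ^+ d * x ^+ d by rewrite mulr_ge0// exprn_ge0.
have : `|x * (x * (shell_quad d n - critical_const * m ^+ d.+1))| <= x * (x * (4 ^+ d * x ^+ d)).
  rewrite E [X in `|X|](_ : _ = x * ((x / 2 * (x * A - x * B) + (x * A + x * B)) / 12)); last by ring.
  rewrite normrM (ger0_norm (_ : 0 <= x)); last by lra.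
  rewrite ler_wpM2l//; first by lra.
  rewrite normrM (ger0_norm (_ : 0 <= 12^-1)) ?invr_ge0//.
  set a := x * A in h1 *; set b := x * B in h2 *.
  have g1 : `|a - b| <= 2 * (4 ^+ d * x ^+ d) by apply: le_trans (ler_normB _ _) _; lra.
  have g2 : `|a + b| <= 2 * (4 ^+ d * x ^+ d) by apply: le_trans (ler_normD _ _) _; lra.
  have g3 : `|x / 2 * (a - b)| <= x / 2 * (2 * (4 ^+ d * x ^+ d)).
    by rewrite normrM (ger0_norm (_ : 0 <= x / 2)) ?ler_wpM2l//; lra.
  have g4 := ler_normD (x / 2 * (a - b)) (a + b).
  have g5 : 2 * (4 ^+ d * x ^+ d) <= x * (4 ^+ d * x ^+ d) by rewrite ler_wpM2r.
  have g6 : 0 <= x * (4 ^+ d * x ^+ d) by rewrite mulr_ge0//; lra.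
  lra.
have x0 : 0 < x by lra.
have normx y : `|x * y| = x * `|y| by rewrite normrM (gtr0_norm x0).
rewrite normx normx !(ler_pM2l x0) => h; apply: le_trans h _.
by rewrite /x -exprMn mulrA (_ : 4 * 2 = 8 :> R) ?exprMn//; ring.
Qed.

Lemma critical_coeff_close n : (0 < n)%N ->
  `|n%:R `^ (- (d%:R + 2)) * shell_quad d n - critical_const * n%:R^-1|
  <= 8 ^+ d * n%:R `^ (- 1 - 1) :> R.
Proof.
move=> n0; have nn0 : n%:R != 0 :> R by rewrite pnatr_eq0 -lt0n.
have w k : n%:R `^ (- (d%:R + 2)) * n%:R ^+ k = n%:R `^ (k%:R - d%:R - 2) :> R.
  rewrite -powR_mulrn ?ler0n// -powRD ?nn0 ?implybT//; congr (_ `^ _); ring.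
have -> : n%:R^-1 = n%:R `^ (- (d%:R + 2)) * n%:R ^+ d.+1 :> R.
  by rewrite w -powR_inv1 ?ler0n// -natr1; congr (_ `^ _); ring.
have -> : n%:R `^ (- 1 - 1) = n%:R `^ (- (d%:R + 2)) * n%:R ^+ d :> R.
  by rewrite w; congr (_ `^ _); ring.
rewrite [X in _ - X]mulrCA -mulrBr normrM ger0_norm ?powR_ge0// [leRHS]mulrCA.
by apply: ler_wpM2l; [exact: powR_ge0|exact: shell_quad_main].
Qed.

End ShellMoment.

Section Critical.
Context {R : realType}.
Variable d : nat.
Hypothesis d_gt0 : (0 < d)%N.
Implicit Types (theta : 'rV[R]_d) (m n N : nat).

Lemma eucl_le_norm theta : eucl_norm theta <= d%:R * `|theta|.
Proof.
rewrite -(@ler_pXn2r _ 2) ?nnegrE ?mulr_ge0 ?sqrtr_ge0//.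
apply: le_trans (eucl_norm_le theta) _; rewrite exprMn.
by rewrite ler_wpM2r ?sqr_ge0// expr2 ler_peMl// ler1n.
Qed.

Lemma power_sum_tail_le (s : R) m N : 0 < s ->
  \sum_(m.+2 <= n < N) n%:R `^ (- 1 - s) <= s^-1 * m.+1%:R `^ (- s) :> R.
Proof.
move=> s0; have si : 0 <= s^-1 by rewrite invr_ge0 ltW.
have [Nm|mN] := leqP N m.+2; first by rewrite big_geq// mulr_ge0// powR_ge0.
have H k : \sum_(m.+2 <= n < m.+2 + k) n%:R `^ (- 1 - s)
    <= s^-1 * (m.+1%:R `^ (- s) - (m.+1 + k)%:R `^ (- s)) :> R.
  elim: k => [|k ih]; first by rewrite !addn0 big_geq// subrr mulr0.
  rewrite addnS (big_nat_recr _ _ _ (leq_addr k m.+2))/=.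
  have := power_step (m + k) s0; rewrite -!addSn => h.
  by apply: le_trans (lerD ih h) _; rewrite -mulrDr addrA subrK !addnS !addSn.
rewrite -(subnKC (ltnW mN)); apply: le_trans (H _) _.
by apply: (ler_wpM2l si); rewrite lerBlDr lerDl powR_ge0.
Qed.

(** As long as [n |theta| <= 1], the weighted error of a shell is of order at most
    [n |theta| ^ 4 <= |theta| ^ 3], and there are at most [1 / |theta|] such
    shells. *)
Lemma critical_head theta m : m%:R * `|theta| <= 1 ->
  `|\sum_(1 <= n < m.+1) n%:R `^ (- (d%:R + 2)) *
      (shell_sum n theta - shell_quad d n * eucl_norm theta ^+ 2)|
  <= shell_const d * d%:R ^+ 4 * `|theta| ^+ 2.
Proof.
move=> mt; set t := `|theta| in mt *; have t0 : 0 <= t by exact: normr_ge0.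
have c0 : 0 <= shell_const d * d%:R ^+ 4 :> R.
  by rewrite mulr_ge0 ?shell_const_ge0// exprn_ge0.
apply: le_trans (ler_norm_sum _ _ _) _.
apply: (@le_trans _ _ (\sum_(1 <= n < m.+1) shell_const d * d%:R ^+ 4 * t ^+ 3)); last first.
  rewrite sumr_const_nat subSS subn0 -[leLHS]mulr_natl.
  rewrite (_ : _ * _ = shell_const d * d%:R ^+ 4 * t ^+ 2 * (m%:R * t)); last by ring.
  by rewrite ler_piMr// mulr_ge0// sqr_ge0.
rewrite [leLHS]big_nat_cond [leRHS]big_nat_cond; apply: ler_sum => n.
rewrite andbT => /andP[n0 nm].
have nn0 : n%:R != 0 :> R by rewrite pnatr_eq0 -lt0n.
rewrite normrM ger0_norm ?powR_ge0//.
apply: le_trans (ler_wpM2l (powR_ge0 _ _) (shell_sum_quartic theta n0)) _.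
rewrite mulrCA; apply: (ler_wpM2l c0).
rewrite mulrA (weight_pred d_gt0 2 n0) -/t.
have -> : n%:R `^ (- 1 - 2) * (n%:R * t) ^+ 4 = t ^+ 3 * (n%:R * t) :> R.
  have -> : - 1 - 2 = - (3%:R) :> R by ring.
  by rewrite powRN powR_mulrn ?ler0n//; field.
rewrite ler_piMr ?exprn_ge0//; apply: le_trans mt.
by rewrite ler_wpM2r// ler_nat -ltnS.
Qed.

(** Beyond [1 / |theta|] the number of points of the shells is enough. *)
Lemma critical_tail theta m N : `|theta| <= 1 / 2 -> 1 < m.+1%:R * `|theta| ->
  \sum_(m.+1 <= n < N) n%:R `^ (- (d%:R + 2)) * shell_sum n theta
  <= 4 * shell_const d * `|theta| ^+ 2.
Proof.
set t := `|theta| => t2 mt; have t0 : 0 <= t by exact: normr_ge0.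
case: m mt => [|m] mt; first lra.
have m0 : 0 < m.+1%:R :> R by rewrite ltr0Sn.
apply: (@le_trans _ _ (2 * shell_const d * \sum_(m.+2 <= n < N) n%:R `^ (- 1 - 2))).
  rewrite mulr_sumr [leLHS]big_nat_cond [leRHS]big_nat_cond; apply: ler_sum => n.
  rewrite andbT => /andP[nm _]; have n0 : (0 < n)%N by exact: leq_trans nm.
  rewrite -(weight_pred d_gt0 2 n0).
  apply: le_trans (ler_wpM2l (powR_ge0 _ _) (shell_sum_le2 theta n0)) _.
  by rewrite le_eqVlt; apply/orP; left; apply/eqP; ring.
have c0 : 0 <= 2 * shell_const d :> R by rewrite mulr_ge0// shell_const_ge0.
apply: le_trans (ler_wpM2l c0 (power_sum_tail_le m N _)) _ => //.
have -> : 4 * shell_const d * t ^+ 2 = 2 * shell_const d * (2^-1 * (2 * t) ^+ 2) by field.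
apply: (ler_wpM2l c0); rewrite ler_wpM2l// powRN powR_mulrn ?ler0n//.
rewrite -exprVn; apply: lerXn2r; rewrite ?nnegrE ?invr_ge0 ?mulr_ge0//.
rewrite -div1r ler_pdivrMr//; move: mt; rewrite -(natr1 m.+1); lra.
Qed.

(** The harmonic sum up to [1 / |theta|] differs from [ln (1 / |theta|)] by a
    bounded quantity, and the two norms have a bounded quotient. *)
Lemma critical_main theta m : 0 < `|theta| -> `|theta| <= 1 / 2 ->
    m%:R * `|theta| <= 1 -> 1 < m.+1%:R * `|theta| ->
  `|\sum_(1 <= n < m.+1) n%:R `^ (- (d%:R + 2)) * shell_quad d n
    - critical_const d * ln (1 / eucl_norm theta)|
  <= 2 * 8 ^+ d + critical_const d * (1 + d%:R) :> R.
Proof.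
move=> t0 t2 mt mt'; set t := `|theta| in t0 t2 mt mt' *; set e := eucl_norm theta.
have c0 := @critical_const_gt0 R d.
have te : t <= e by exact: norm_le_eucl.
have e0 : 0 < e by exact: lt_le_trans te.
have d1 : 1 <= d%:R :> R by rewrite ler1n.
have et : e <= d%:R * t by exact: eucl_le_norm.
pose H : R := \sum_(1 <= n < m.+1) n%:R^-1.
have H1 : `|\sum_(1 <= n < m.+1) n%:R `^ (- (d%:R + 2)) * shell_quad d n
    - critical_const d * H| <= 2 * 8 ^+ d.
  rewrite mulr_sumr -sumrB; apply: le_trans (ler_norm_sum _ _ _) _.
  apply: (@le_trans _ _ (8 ^+ d * \sum_(1 <= n < m.+1) n%:R `^ (- 1 - 1))).
    rewrite mulr_sumr [leLHS]big_nat_cond [leRHS]big_nat_cond; apply: ler_sum => n.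
    by rewrite andbT => /andP[n0 _]; exact: critical_coeff_close.
  rewrite mulrC ler_wpM2r ?exprn_ge0//.
  by apply: le_trans (power_sum_le _ ltr01) _; rewrite invr1.
have H2 : `|H - ln (1 / e)| <= 1 + d%:R.
  have lnV x : 0 < x -> ln (1 / x) = - ln x :> R by move=> x0; rewrite div1r lnV.
  have l1 : ln t <= ln e by rewrite ler_ln ?posrE.
  have l2 : ln e <= ln d%:R + ln t.
    by rewrite -lnM ?posrE ?ltr0n// ler_ln ?posrE// mulr_gt0// ltr0n.
  have l3 : ln d%:R <= d%:R :> R.
    have := @le_ln1Dx R (d%:R - 1); rewrite (_ : 1 + (d%:R - 1) = d%:R); last by ring.
    by move=> /(_ _) h; apply: le_trans (h _) _; lra.
  have h1 : - ln t <= H.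
    apply: le_trans (harmonic_ge m); rewrite -lnV// ler_ln ?posrE ?divr_gt0//.
    by rewrite ler_pdivrMr// ltW.
  have h2 : H <= 1 - ln t.
    move: mt; rewrite /H; case: (m) mt' => [|k] mt'; first by lra.
    move=> mt; apply: le_trans (harmonic_le k) _; rewrite lerD2l -lnV//.
    by rewrite ler_ln ?posrE ?divr_gt0// ler_pdivlMr.
  by rewrite lnV// ler_norml; apply/andP; split; lra.
rewrite (_ : _ - _ = (\sum_(1 <= n < m.+1) n%:R `^ (- (d%:R + 2)) * shell_quad d n
    - critical_const d * H) + critical_const d * (H - ln (1 / e))); last by ring.
apply: le_trans (ler_normD _ _) _; apply: lerD => //.
by rewrite normrM (gtr0_norm c0) ler_pM2l.
Qed.

Definition critical_error : R := shell_const d * d%:R ^+ 4 + 4 * shell_const d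
  + (2 * 8 ^+ d + critical_const d * (1 + d%:R)).

Lemma critical_estimate theta : 0 < `|theta| -> `|theta| <= 1 / 2 ->
  `|Fd 2 theta - critical_const d * eucl_norm theta ^+ 2 * ln (1 / eucl_norm theta)|
  <= critical_error * eucl_norm theta ^+ 2.
Proof.
move=> t0 t2; set e2 := eucl_norm theta ^+ 2; set l := ln _.
have te : `|theta| ^+ 2 <= e2.
  by apply: lerXn2r (norm_le_eucl theta); rewrite nnegrE// sqrtr_ge0.
have e0 : 0 <= e2 by exact: sqr_ge0.
pose m := Num.trunc (`|theta|^-1).
have /andP[m1 m2] : m%:R <= `|theta|^-1 < m.+1%:R.
  by apply: truncn_itv; rewrite invr_ge0 ltW.
have mt : m%:R * `|theta| <= 1 by rewrite -ler_pdivlMr// div1r.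
have mt' : 1 < m.+1%:R * `|theta| by rewrite -ltr_pdivrMr// div1r.
have sc0 : 0 <= shell_const d :> R by exact: shell_const_ge0.
have head := critical_head mt.
have main := critical_main t0 t2 mt mt'.
pose w n : R := n%:R `^ (- (d%:R + 2)).
have L : `|Fd_partial 2 theta N - critical_const d * e2 * l| @[N --> \oo]
    --> `|Fd 2 theta - critical_const d * e2 * l|.
  by apply: cvg_norm; apply: cvgB; [exact: Fd_cvg|exact: cvg_cst].
apply: (cvgr_to_le L); near=> N.
have mN : (m.+1 <= N)%N by near: N; exact: nbhs_infty_ge.
have tail := critical_tail N t2 mt'.
have tail0 : 0 <= \sum_(m.+1 <= n < N) w n * shell_sum n theta.
  by apply: sumr_ge0 => n _; rewrite mulr_ge0 ?powR_ge0 ?shell_sum_ge0.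
have -> : Fd_partial 2 theta N - critical_const d * e2 * l
    = \sum_(1 <= n < m.+1) w n * (shell_sum n theta - shell_quad d n * e2)
      + \sum_(m.+1 <= n < N) w n * shell_sum n theta
      + (\sum_(1 <= n < m.+1) w n * shell_quad d n - critical_const d * l) * e2.
  rewrite /Fd_partial (big_cat_nat _ mN)//=.
  under [in RHS]eq_bigr do rewrite mulrBr mulrA.
  by rewrite sumrB -mulr_suml /w; ring.
apply: le_trans (ler_normD _ _) _; rewrite /critical_error [leRHS]mulrDl; apply: lerD.
  apply: le_trans (ler_normD _ _) _; rewrite [leRHS]mulrDl; apply: lerD.
    apply: le_trans head _; rewrite ler_wpM2l// mulr_ge0// exprn_ge0//.
  rewrite ger0_norm//; apply: le_trans tail _; rewrite ler_wpM2l// mulr_ge0//.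
by rewrite normrM (ger0_norm e0) ler_wpM2r.
Unshelve. all: by end_near. Qed.

Lemma critical :
  asymp_equiv (Fd 2)
    (fun theta : 'rV[R]_d =>
       2 ^+ (d - 1) * (d%:R + 2) / 3 *
       eucl_norm theta ^+ 2 * ln (1 / eucl_norm theta)) 0.
Proof.
apply: asymp_equivI => eta eta0; rewrite -/(critical_const d).
have c0 := @critical_const_gt0 R d.
have d0 : 0 < d%:R :> R by rewrite ltr0n.
have d1 : 1 <= d%:R :> R by rewrite ler1n.
(* Once the logarithm is at least [q], the error is at most [eta] times the main term. *)
pose q : R := Num.max 1 (critical_error / (eta * critical_const d)).
exists (Num.min (1 / 2) (expR (- q) / d%:R)).
  by rewrite lt_min !divr_gt0// expR_gt0.
move=> theta t0; rewrite lt_min => /andP[t2 tq].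
have te := norm_le_eucl theta; set e := eucl_norm theta in te *.
have e0 : 0 < e by exact: lt_le_trans te.
have et : e <= d%:R * `|theta| by exact: eucl_le_norm.
have lq : q <= ln (1 / e).
  rewrite -[leLHS]expRK ler_ln ?posrE ?expR_gt0 ?divr_gt0//.
  rewrite ler_pdivlMr// -(@ler_pM2l _ (expR (- q))) ?expR_gt0// mulrA -expRD addNr expR0.
  rewrite mul1r mulr1; apply: le_trans et _; rewrite mulrC -ler_pdivlMr//; exact: ltW.
have q1 : 1 <= q by rewrite le_max lexx.
have e20 : 0 < e ^+ 2 by rewrite exprn_gt0.
split; first by rewrite !mulr_gt0//; lra.
apply: le_trans (critical_estimate t0 (ltW t2)) _; rewrite -/e.
rewrite (_ : eta * _ = eta * critical_const d * ln (1 / e) * e ^+ 2); last by ring.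
rewrite ler_pM2r// mulrC -ler_pdivrMr ?mulr_gt0//.
by apply: le_trans lq; rewrite le_max lexx orbT.
Qed.

End Critical.

Theorem theorem2 (R : realType) (d : nat) (alpha : R)
    (d_ge2 : (2 <= d)%N) (alpha_gt0 : 0 < alpha) :
  [/\ alpha < 2 ->
        asymp_equiv (Fd alpha)
          (fun theta : 'rV[R]_d => 2 / alpha * Gamma_cos alpha * Ad alpha theta)
          0,
      alpha = 2 ->
        asymp_equiv (Fd alpha)
          (fun theta : 'rV[R]_d =>
             2 ^+ (d - 1) * (d%:R + 2) / 3 *
             eucl_norm theta ^+ 2 * ln (1 / eucl_norm theta))
          0 &
      2 < alpha ->
        asymp_equiv (Fd alpha)
          (fun theta : 'rV[R]_d =>
             1 / 6 *
             limn (fun N : nat => \sum_(1 <= n < N)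
                ((2 * n%:R + 1) ^+ d * (n%:R + 1)
                 - (2 * n%:R - 1) ^+ d * (n%:R - 1))
                / n%:R `^ (d%:R + alpha - 1)) *
             eucl_norm theta ^+ 2)
          0].
Proof.
have d_gt0 : (0 < d)%N by exact: ltnW.
split=> [alpha_lt2|->|alpha_gt2].
- exact: subcritical.
- exact: critical.
- exact: supercritical.
Qed.
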